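(* Let $p$ be holomorphic on $\mathbb{D}$ with $\mathrm{Re}(p)>0$. (a) Let $f_t$, $t\in[a,\infty)$, be a Loewner chain with initial point $f_a$ satisfying, for almost every $t$, the Loewner partial differential equation $\frac{\partial f_t}{\partial t}(z)=zp(z)f_t'(z)$ with constant infinitesimal generator $p$. Then for any $T>a$, any integer $n\ge1$ and any $\varepsilon>0$ there is a $q$ such that for all $t\in[a,T]$ and all $1\le k\le n$, the $k$th power series coefficient of $f_t$ differs in absolute value by less than $\varepsilon$ from the $k$th element of the first row of $$[f_a]\sum_{m=0}^q\frac{(t-a)^m}{m!}\langle zp\rangle^m ,$$ where $[f_a]$ and $\langle zp\rangle$ here denote the $(1,n)$ principal blocks of the corresponding matrices. (That is, the approximation is uniform in the index of the coefficient and in $t$.) (b) Let $w_t$ be the solution on $[a,\infty)$ to the Loewner ordinary differential equation $\frac{d}{dt}w_t(z)=-w_t(z)p(w_t(z))$ with initial condition $w_a=w$, where $w:\mathbb{D}\to\mathbb{D}$ is univalent, $w(0)=0$, $0<w'(0)<1$. Then for any $T>a$, any integer $n>0$ and any $\varepsilon>0$ there is a $q$ such that for all $t\in[a,T]$ and all $1\le k\le n$, the $k$th power series coefficient of $w_t$ differs in absolute value by less than $\varepsilon$ from the $k$th element of the first row of $$\left(\sum_{m=0}^q(-1)^m\frac{(t-a)^m}{m!}\langle zp\rangle^m\right)[w_a],$$ again with $(1,n)$ principal blocks.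
   Context: $\mathbb{D}$ is the open unit disc; univalent means holomorphic and injective. A Loewner chain on $[a,\infty)$ is a one-parameter family of univalent functions $f_t$ on $\mathbb{D}$, $t\in[a,\infty)$, with $f_t(0)=0$, $f_t'(0)=e^{\alpha t}$ for some constant $\alpha$ (necessarily $\alpha=p(0)$), and $f_t(\mathbb{D})\subset f_s(\mathbb{D})$ whenever $t\le s$. Matrices are doubly infinite, indexed by $\mathbb{Z}\times\mathbb{Z}$; $A^m_n$ is the entry in row $m$, column $n$. For $f(z)=\sum_{k\ge1}a_kz^k$ with $a_1\neq0$, the power matrix $[f]$ has entries given by $f(z)^n=\sum_{k\geq n}[f]^n_kz^k$, $n\in\mathbb{Z}$. For $h(z)=\sum_{k\ge1}h_kz^k$, $\langle h\rangle$ is the matrix with entry $m\,h_{n-m+1}$ in row $m$, column $n$ ($h_j=0$ for $j\le0$); $\langle zp\rangle$ is this matrix for $h(z)=zp(z)$. The $(m,n)$ principal block of $A$ is the matrix of entries $A^i_j$ with $m\le i\le n$, $m\le j\le n$. *)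

(* Defs.v *)
From Stdlib Require Import Reals ZArith ClassicalEpsilon.
From Coquelicot Require Import Coquelicot.
Open Scope R_scope.

Definition Disc (z : C) : Prop := Cmod z < 1.

(* Functions on the disc are total functions [C -> C] of which only the values
   on [Disc] matter; likewise families indexed by [t] matter only for [a <= t]. *)
Definition holomorphic (f : C -> C) : Prop :=
  forall z, Disc z -> @ex_derive C_AbsRing C_NormedModule f z.

Definition univalent (f : C -> C) : Prop :=
  holomorphic f /\
  (forall z1 z2, Disc z1 -> Disc z2 -> f z1 = f z2 -> z1 = z2).

Definition Cexp (z : C) : C := (exp (Re z) * cos (Im z), exp (Re z) * sin (Im z)).

Definition Loewner_chain (a : R) (f : R -> C -> C) : Prop :=
  exists alpha : C,
    (forall t, a <= t ->
       univalent (f t) /\ f t (RtoC 0) = RtoC 0 /\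
       C_derive (f t) (RtoC 0) = Cexp (Cmult alpha (RtoC t))) /\
    (forall t s, a <= t -> t <= s ->
       forall z, Disc z -> exists z', Disc z' /\ f t z = f s z').

(* Lebesgue null sets of the real line: coverable by countably many open
   intervals of arbitrarily small total length. *)
Definition null_set (N : R -> Prop) : Prop :=
  forall eps : R, 0 < eps ->
  exists l r : nat -> R,
    (forall i, l i <= r i) /\
    (forall x, N x -> exists i, l i < x < r i) /\
    (forall i, sum_n (fun j => r j - l j) i <= eps).

Definition almost_every_from (a : R) (P : R -> Prop) : Prop :=
  null_set (fun t => a <= t /\ ~ P t).

Definition Loewner_PDE_at (p : C -> C) (f : R -> C -> C) (t : R) : Prop :=
  forall z, Disc z ->
    @is_derive R_AbsRing C_R_NormedModule (fun s => f s z) t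
      (Cmult (Cmult z (p z)) (C_derive (f t) z)).

(* The derivative in [t] is taken relative to [a, oo), hence one-sided at [a]. *)
Definition Loewner_ODE_solution (p : C -> C) (a : R) (w0 : C -> C)
    (w : R -> C -> C) : Prop :=
  forall z, Disc z ->
    w a z = w0 z /\
    (forall t, a <= t -> Disc (w t z)) /\
    (forall t, a <= t ->
       @filterdiff R_AbsRing R_NormedModule C_R_NormedModule
         (fun s => w s z) (within (fun s => a <= s) (locally t))
         (fun h => scal h (Copp (Cmult (w t z) (p (w t z)))))).

Definition Cpow_Z (z : C) (n : Z) : C :=
  match n with
  | Z0 => RtoC 1
  | Zpos k => Cpow z (Pos.to_nat k)
  | Zneg k => Cinv (Cpow z (Pos.to_nat k))
  end.

(* [c] gives an expansion g(z) = sum_{k >= n} c_k z^k near the origin, which is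
   itself excluded since [n] may be negative. *)
Definition is_expansion (n : Z) (g : C -> C) (c : Z -> C) : Prop :=
  (forall k, (k < n)%Z -> c k = RtoC 0) /\
  exists r : R, 0 < r /\
    forall z, 0 < Cmod z < r ->
      @is_series C_AbsRing C_NormedModule
        (fun j : nat => Cmult (c (n + Z.of_nat j)%Z) (Cpow_Z z (n + Z.of_nat j)))
        (g z).

(* Such an expansion is unique when it exists; [expansion] is unspecified
   otherwise. *)
Definition expansion (n : Z) (g : C -> C) : Z -> C :=
  epsilon (inhabits (fun _ : Z => RtoC 0)) (is_expansion n g).

Definition power_coef (f : C -> C) (k : nat) : C := expansion 0 f (Z.of_nat k).

(* Doubly infinite matrices: [A m n] is the entry in row [m], column [n]. *)
Definition Zmatrix := Z -> Z -> C.

Definition power_matrix (f : C -> C) : Zmatrix :=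
  fun n k => expansion n (fun z => Cpow_Z (f z) n) k.

Definition angle_matrix (h : C -> C) : Zmatrix :=
  fun m n => Cmult (RtoC (IZR m)) (expansion 1 h (n - m + 1)%Z).

Definition block_size (m n : Z) : nat := Z.to_nat (n - m + 1).

(* Coquelicot matrices are indexed from 0, so index [i] stands for [m + i]. *)
Definition principal_block (m n : Z) (A : Zmatrix) :
    @matrix C (block_size m n) (block_size m n) :=
  mk_matrix _ _ (fun i j => A (m + Z.of_nat i)%Z (m + Z.of_nat j)%Z).

Definition Mscal {n : nat} (c : C) (A : @matrix C n n) : @matrix C n n :=
  mk_matrix n n (fun i j => Cmult c (coeff_mat (RtoC 0) A i j)).

Definition Mpow {n : nat} (A : @matrix C n n) (m : nat) : @matrix C n n :=
  @pow_n (@matrix_Ring C_Ring n) A m.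

Definition Msum {n : nat} (F : nat -> @matrix C n n) (q : nat) : @matrix C n n :=
  @sum_n (@matrix_AbelianMonoid C_AbelianMonoid n n) F q.

(* The [k]th element of the first row, [k >= 1]. *)
Definition first_row {n : nat} (A : @matrix C n n) (k : nat) : C :=
  coeff_mat (RtoC 0) A 0 (k - 1).

(* Main.v *)
(* The vector of the coefficients of f_t satisfies a linear system with constant
   coefficients, whose solutions are given by the exponential series of its matrix.

   (a) On a small disc f_t(z) is Lipschitz in t: for t <= s one has f_t = f_s o phi with phi a
   self-map of the disc fixing 0, and Schwarz-Pick applied to phi(z)/z bounds phi(z) - z by a
   multiple of |1 - phi'(0)|, where phi'(0) = exp(alpha (t - s)). Hence the coefficients
   are Lipschitz in t, so that the differential system, valid almost everywhere, determines them.

   (b) The solution w_t is holomorphic in z by differentiability in the initial value; the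
   powers w_t^m satisfy d/dt w_t^m = - m w_t^m p(w_t), and reading off the coefficient of z^k
   gives the linear system for the k-th column of [w_t]. *)

Require Import Defs.
From Stdlib Require Import Reals ZArith Lra Lia ClassicalEpsilon Classical FunctionalExtensionality.
From Coquelicot Require Import Coquelicot.
Open Scope R_scope.

(** * Derivatives within a set *)

(** Truncation to the block of order n is exact because [angle_matrix] and [power_matrix] both
    vanish below the diagonal: in (a) the k-th coefficient of f_t involves only coefficients of
    index at most k, and in (b) the powers w^j with j > n do not reach z^k for k <= n. The matrix
    acts on a row vector in (a) and on a column vector in (b); one theorem on vectors x' = b x
    serves both. Its error after q terms is at most M (K (T - a))^q / q!, which contains neither t
    nor k; hence a single q.

    An equation valid almost everywhere does not determine a continuous function, as the Cantor
    function shows; the Lipschitz bound limits the growth over the exceptional set. In (b) the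
    solution is given point by point in z, and its coefficients have a meaning only once w_t is
    known to be holomorphic.

    The analytic input is a power series with an explicit remainder, obtained from Goursat's
    theorem: Cauchy's estimates, Schwarz's lemma and the existence of expansions all come from
    it. *)

Definition nearby (U : C -> Prop) (z : C) (P : C -> Prop) : Prop :=
  exists del, 0 < del /\ forall w, U w -> Cmod (w - z) < del -> P w.

(** The set [U] restricts the increments, so that one calculus serves complex derivatives ([U]
    everything), derivatives along the real axis and one-sided derivatives from a point [a]. *)
Definition der_on (U : C -> Prop) (f : C -> C) (z d : C) : Prop :=
  forall eps, 0 < eps ->
    nearby U z (fun w => Cmod (f w - f z - d * (w - z)) <= eps * Cmod (w - z)).

Definition cder := der_on (fun _ => True).

Lemma Cmod_tri (a b c : C) (x y : R) :
  c = (a + b)%C -> Cmod a <= x -> Cmod b <= y -> Cmod c <= x + y.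
Proof. intros -> Ha Hb. generalize (Cmod_triangle a b). lra. Qed.

Lemma Cmod_sub_le (a b : C) : Cmod (a - b) <= Cmod a + Cmod b.
Proof. unfold Cminus. rewrite <- (Cmod_opp b). apply Cmod_triangle. Qed.

Lemma Cmod_sub_sym (a b : C) : Cmod (a - b) = Cmod (b - a).
Proof. rewrite <- Cmod_opp. f_equal. ring. Qed.

Lemma Cmod_sub_ge (a b : C) : Cmod a - Cmod b <= Cmod (a - b).
Proof.
  generalize (Cmod_triangle (a - b) b). replace (a - b + b)%C with a by ring. lra.
Qed.

Lemma Cmod_pos_nz (a : C) : 0 < Cmod a -> a <> 0.
Proof. apply Cmod_gt_0. Qed.

Lemma Cmod_Rabs_RtoC (x : R) : 0 <= x -> Cmod (RtoC x) = x.
Proof. intros H. rewrite Cmod_R. apply Rabs_pos_eq, H. Qed.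

Lemma small2 (a b : R) : 0 < a -> 0 < b -> exists x, 0 < x /\ x <= a /\ x <= b.
Proof.
  intros Ha Hb. exists (Rmin a b). split; [apply Rmin_pos; auto|split; [apply Rmin_l|apply Rmin_r]].
Qed.

Lemma small3 (a b c : R) : 0 < a -> 0 < b -> 0 < c ->
  exists x, 0 < x /\ x <= a /\ x <= b /\ x <= c.
Proof.
  intros Ha Hb Hc. destruct (small2 a b Ha Hb) as [x [Hx [H1 H2]]].
  destruct (small2 x c Hx Hc) as [y [Hy [H3 H4]]]. exists y. repeat split; lra.
Qed.

Lemma small_mult K eps : 0 <= K -> 0 < eps ->
  exists del, 0 < del /\ forall x, 0 <= x <= del -> K * x <= eps.
Proof.
  intros HK He. exists (eps / (K + 1)). split. apply Rdiv_lt_0_compat; lra.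
  intros x Hx. assert (E : eps / (K + 1) * (K + 1) = eps) by (field; lra). nra.
Qed.

Lemma le_of_le_eps x y : (forall e, 0 < e -> x <= y + e) -> x <= y.
Proof.
  intros H. apply Rnot_lt_le. intros L. specialize (H ((x - y) / 2) ltac:(lra)). lra.
Qed.

Lemma Rdiv_small_1 x y : 0 <= x -> x < y -> 0 <= x / y < 1.
Proof.
  intros Hx Hxy. split. apply Rdiv_le_0_compat; lra.
  apply Rmult_lt_reg_r with y. lra. unfold Rdiv; rewrite Rmult_assoc, Rinv_l by lra. lra.
Qed.

Lemma pow_small q eps : 0 <= q < 1 -> 0 < eps -> exists N, forall n, (N <= n)%nat -> q ^ n < eps.
Proof.
  intros Hq He. destruct (pow_lt_1_zero q ltac:(rewrite Rabs_pos_eq; lra) eps He) as [N HN].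
  exists N. intros n Hn. specialize (HN n Hn).
  rewrite Rabs_pos_eq in HN; auto. apply pow_le; lra.
Qed.

Lemma nearby_and U z P Q : nearby U z P -> nearby U z Q -> nearby U z (fun w => P w /\ Q w).
Proof.
  intros [d1 [H1 HP]] [d2 [H2 HQ]]. destruct (small2 d1 d2 H1 H2) as [d [Hd [L1 L2]]].
  exists d; split; auto. intros w Uw Hw. split; [apply HP|apply HQ]; auto; lra.
Qed.

Lemma nearby_imp (U : C -> Prop) z (P Q : C -> Prop) :
  (forall w, U w -> P w -> Q w) -> nearby U z P -> nearby U z Q.
Proof. intros H [d [Hd HP]]. exists d; split; auto. Qed.

Lemma nearby_ball U z r : 0 < r -> nearby U z (fun w => Cmod (w - z) < r).
Proof. intros Hr. exists r; auto. Qed.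

Lemma der_on_mono (U U' : C -> Prop) f z d :
  (forall w, U' w -> U w) -> der_on U f z d -> der_on U' f z d.
Proof.
  intros H D eps He. destruct (D eps He) as [del [Hd D']].
  exists del; split; auto.
Qed.

Lemma der_on_ext (U : C -> Prop) f g z d :
  nearby U z (fun w => f w = g w) -> f z = g z -> der_on U f z d -> der_on U g z d.
Proof.
  intros E Ez D eps He. generalize (nearby_and _ _ _ _ E (D eps He)).
  apply nearby_imp. intros w _ [<- H]. rewrite <- Ez. exact H.
Qed.

Lemma der_on_eq (U : C -> Prop) f g z d d' :
  (forall w, f w = g w) -> d = d' -> der_on U f z d -> der_on U g z d'.
Proof.
  intros E <-. apply der_on_ext; auto. exists 1; split; auto; lra.
Qed.

Lemma der_on_affine U b c z : der_on U (fun w => b * w + c)%C z b.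
Proof.
  intros eps He. exists 1; split; [lra|]. intros w _ _.
  replace (b * w + c - (b * z + c) - b * (w - z))%C with (RtoC 0) by ring.
  rewrite Cmod_0. apply Rmult_le_pos; [lra|apply Cmod_ge_0].
Qed.

Lemma der_on_const U c z : der_on U (fun _ => c) z 0.
Proof. eapply der_on_eq; [| |apply (der_on_affine U 0 c)]; [intros; cbv beta; ring|auto]. Qed.

Lemma der_on_id U z : der_on U (fun w => w) z 1.
Proof. eapply der_on_eq; [| |apply (der_on_affine U 1 0)]; [intros; cbv beta; ring|auto]. Qed.

Lemma der_on_plus U f g z d e :
  der_on U f z d -> der_on U g z e -> der_on U (fun w => f w + g w)%C z (d + e)%C.
Proof.
  intros F G eps He.
  generalize (nearby_and _ _ _ _ (F (eps / 2) ltac:(lra)) (G (eps / 2) ltac:(lra))).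
  apply nearby_imp. intros w _ [A1 A2].
  replace (eps * Cmod (w - z)) with (eps/2 * Cmod (w - z) + eps/2 * Cmod (w - z)) by field.
  eapply Cmod_tri; [|exact A1|exact A2]. ring.
Qed.

Lemma der_on_lip U f z d : der_on U f z d ->
  nearby U z (fun w => Cmod (f w - f z) <= (Cmod d + 1) * Cmod (w - z)).
Proof.
  intros F. generalize (F 1 Rlt_0_1). apply nearby_imp. intros w _ H.
  replace ((Cmod d + 1) * Cmod (w - z)) with (1 * Cmod (w-z) + Cmod (d * (w - z))) by
    (rewrite Cmod_mult; ring).
  eapply Cmod_tri; [|exact H|apply Rle_refl]. ring.
Qed.

Lemma der_on_cont U f z d : der_on U f z d ->
  forall eps, 0 < eps -> nearby U z (fun w => Cmod (f w - f z) < eps).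
Proof.
  intros F eps He.
  destruct (small_mult (Cmod d + 1) (eps / 2)) as [r [Hr H]]; [generalize (Cmod_ge_0 d); lra|lra|].
  generalize (nearby_and _ _ _ _ (der_on_lip _ _ _ _ F) (nearby_ball U z r Hr)).
  apply nearby_imp. intros w _ [A1 A2].
  specialize (H (Cmod (w - z)) ltac:(generalize (Cmod_ge_0 (w - z)); lra)). lra.
Qed.

Lemma der_on_mult U f g z d e :
  der_on U f z d -> der_on U g z e ->
  der_on U (fun w => f w * g w)%C z (d * g z + f z * e)%C.
Proof.
  intros F G eps He.
  assert (Hf := Cmod_ge_0 (f z)). assert (Hg := Cmod_ge_0 (g z)). assert (Hd := Cmod_ge_0 d).
  destruct (small_mult (Cmod (f z) + Cmod (g z)) (eps / 2)) as [e1 [He1 H1]]; [lra|lra|].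
  destruct (small_mult (Cmod d + 1) (eps / 2)) as [e2 [He2 H2]]; [lra|lra|].
  generalize (nearby_and _ _ _ _ (nearby_and _ _ _ _ (F e1 He1) (G e1 He1))
    (nearby_and _ _ _ _ (der_on_lip _ _ _ _ F) (der_on_cont _ _ _ _ G _ He2))).
  apply nearby_imp. intros w _ [[A1 A2] [A3 A4]].
  set (x := Cmod (w - z)) in *. assert (Hx : 0 <= x) by apply Cmod_ge_0.
  apply Rle_trans with ((e1 * x * Cmod (g z) + Cmod (f z) * (e1 * x)) + ((Cmod d + 1) * x) * e2).
  - eapply (Cmod_tri ((f w - f z - d * (w - z)) * g z + f z * (g w - g z - e * (w - z)))
       ((f w - f z) * (g w - g z))). ring.
    + eapply Cmod_tri; [reflexivity| |]; rewrite Cmod_mult;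
      [apply Rmult_le_compat_r|apply Rmult_le_compat_l]; auto.
    + rewrite Cmod_mult. apply Rmult_le_compat; auto using Cmod_ge_0. lra.
  - specialize (H1 e1 ltac:(lra)). specialize (H2 e2 ltac:(lra)). nra.
Qed.

Lemma der_on_scal U c f z d :
  der_on U f z d -> der_on U (fun w => c * f w)%C z (c * d)%C.
Proof.
  intros F. eapply der_on_eq; [| |exact (der_on_mult U _ f z 0 d (der_on_const U c z) F)].
  reflexivity. cbv beta. ring.
Qed.

Lemma der_on_opp U f z d :
  der_on U f z d -> der_on U (fun w => - f w)%C z (- d)%C.
Proof.
  intros F. eapply der_on_eq; [| |apply (der_on_scal U (Copp 1) f z d F)]; [intros; cbv beta; ring|ring].
Qed.

Lemma der_on_minus U f g z d e :
  der_on U f z d -> der_on U g z e -> der_on U (fun w => f w - g w)%C z (d - e)%C.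
Proof. intros F G. apply der_on_plus; [auto|apply der_on_opp; auto]. Qed.

Lemma der_on_comp U U' f g z d e :
  der_on U f z d -> der_on U' g (f z) e -> (forall w, U w -> U' (f w)) ->
  der_on U (fun w => g (f w)) z (e * d)%C.
Proof.
  intros F G HU eps He.
  assert (Hd := Cmod_ge_0 d). assert (Hee := Cmod_ge_0 e).
  destruct (small_mult (Cmod e) (eps / 2)) as [e1 [He1 H1]]; [lra|lra|].
  destruct (small_mult (Cmod d + 1) (eps / 2)) as [e2 [He2 H2]]; [lra|lra|].
  destruct (G e2 He2) as [r [Hr G2]].
  generalize (nearby_and _ _ _ _ (F e1 He1)
    (nearby_and _ _ _ _ (der_on_lip _ _ _ _ F) (der_on_cont _ _ _ _ F _ Hr))).
  apply nearby_imp. intros w Uw [A1 [A3 A4]]. assert (A2 := G2 _ (HU _ Uw) A4).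
  set (x := Cmod (w - z)) in *. assert (Hx : 0 <= x) by apply Cmod_ge_0.
  apply Rle_trans with (e2 * ((Cmod d + 1) * x) + Cmod e * (e1 * x)).
  - eapply (Cmod_tri (g (f w) - g (f z) - e * (f w - f z)) (e * (f w - f z - d * (w - z)))). ring.
    + eapply Rle_trans; [exact A2|]. apply Rmult_le_compat_l; lra.
    + rewrite Cmod_mult. apply Rmult_le_compat_l; auto.
  - specialize (H1 e1 ltac:(lra)). specialize (H2 e2 ltac:(lra)). nra.
Qed.

Lemma cder_inv (z : C) : z <> 0 -> cder Cinv z (- / (z * z))%C.
Proof.
  intros Hz eps He.
  assert (Hm : 0 < Cmod z) by (apply Cmod_gt_0; auto).
  assert (H3 : 0 < eps * (Cmod z * Cmod z * Cmod z) / 2).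
  { apply Rdiv_lt_0_compat; [|lra]. repeat apply Rmult_lt_0_compat; auto. }
  generalize (nearby_and _ _ _ _ (nearby_ball (fun _ => True) z (Cmod z / 2) ltac:(lra))
    (nearby_ball _ z _ H3)).
  apply nearby_imp. intros w _ [Hw1 Hw2].
  assert (Hwm : Cmod z / 2 <= Cmod w).
  { generalize (Cmod_sub_ge z w). rewrite Cmod_sub_sym. lra. }
  assert (Hw0 : w <> 0) by (apply Cmod_pos_nz; lra).
  replace (/ w - / z - - / (z * z) * (w - z))%C with ((w - z) * (w - z) / (z * z * w))%C
    by (field; auto).
  rewrite Cmod_div, !Cmod_mult. 2: { repeat apply Cmult_neq_0; auto. }
  set (x := Cmod (w - z)) in *. assert (Hx : 0 <= x) by apply Cmod_ge_0.
  assert (Hp : 0 < Cmod z * Cmod z) by (apply Rmult_lt_0_compat; auto).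
  apply Rle_div_l. apply Rmult_lt_0_compat; lra.
  apply Rle_trans with (eps * x * (Cmod z * Cmod z * (Cmod z / 2))).
  - replace (eps * x * (Cmod z * Cmod z * (Cmod z / 2)))
      with (x * (eps * (Cmod z * Cmod z * Cmod z) / 2)) by field.
    apply Rmult_le_compat_l; lra.
  - apply Rmult_le_compat_l. apply Rmult_le_pos; lra. apply Rmult_le_compat_l; lra.
Qed.

Lemma der_on_inv U (f : C -> C) (z d : C) : f z <> 0 -> der_on U f z d ->
  der_on U (fun w => / f w)%C z (- d / (f z * f z))%C.
Proof.
  intros Hz F. eapply der_on_eq; [| |apply (der_on_comp U (fun _ => True) f Cinv z d (- / (f z * f z)) F);
    [apply cder_inv; auto|auto]]. reflexivity. field; auto.
Qed.

Lemma der_on_div U (f g : C -> C) (z d e : C) : g z <> 0 -> der_on U f z d -> der_on U g z e ->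
  der_on U (fun w => f w / g w)%C z ((d * g z - f z * e) / (g z * g z))%C.
Proof.
  intros Hz F G.
  eapply der_on_eq; [| |exact (der_on_mult U f _ z d _ F (der_on_inv U g z e Hz G))].
  reflexivity. cbv beta. field; auto.
Qed.

Lemma der_on_pow U f z d n : der_on U f z d ->
  der_on U (fun w => f w ^ n)%C z (RtoC (INR n) * f z ^ (n - 1) * d)%C.
Proof.
  intros F. induction n as [|n IH].
  - eapply der_on_eq; [| |apply der_on_const with (c := RtoC 1)]. reflexivity.
    simpl. ring.
  - eapply der_on_eq; [| |exact (der_on_mult U f _ z d _ F IH)]. reflexivity.
    rewrite S_INR, RtoC_plus. destruct n as [|n]. simpl. ring.
    replace (S (S n) - 1)%nat with (S n) by lia.
    replace (S n - 1)%nat with n by lia. simpl. ring.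
Qed.

Lemma cder_unique f z d e : cder f z d -> cder f z e -> d = e.
Proof.
  intros F G. destruct (Ceq_dec (d - e) 0) as [E|E].
  { replace d with (d - e + e)%C by ring. rewrite E. ring. }
  exfalso. apply Cmod_gt_0 in E. assert (E4 : 0 < Cmod (d - e) / 4) by lra.
  destruct (nearby_and _ _ _ _ (F _ E4) (G _ E4)) as [r [Hr H]].
  set (h := r / 2). assert (Hh : 0 < h) by (unfold h; lra).
  assert (Ew : Cmod (z + h - z) = h).
  { replace (z + h - z)%C with (RtoC h) by ring. apply Cmod_Rabs_RtoC. lra. }
  destruct (H (z + h)%C I) as [A1 A2]. rewrite Ew; unfold h; lra.
  rewrite Ew in *.
  assert (Q : Cmod ((d - e) * h) <= Cmod (d - e) / 4 * h + Cmod (d - e) / 4 * h).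
  { eapply Cmod_tri; [|rewrite Cmod_sub_sym; apply A1|apply A2]. ring. }
  rewrite Cmod_mult, (Cmod_Rabs_RtoC h) in Q by lra. nra.
Qed.

Lemma is_derive_cder f z d : @is_derive C_AbsRing C_NormedModule f z d <-> cder f z d.
Proof.
  split.
  - intros [_ H] eps He.
    destruct (H z (fun P HP => HP) (mkposreal _ He)) as [del Hd].
    exists del; split; [apply cond_pos|]. intros w _ Hw.
    assert (B : @ball (AbsRing_UniformSpace C_AbsRing) z del w).
    { exact Hw. }
    specialize (Hd w B). change (Cmod ((f w - f z) - (w - z) * d) <= eps * Cmod (w - z)) in Hd.
    rewrite (Cmult_comm d). exact Hd.
  - intros H. split. apply is_linear_scal_l.
    intros x Hx. apply (@is_filter_lim_locally_unique C_AbsRing (AbsRing_NormedModule C_AbsRing)) in Hx.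
    rewrite <- Hx. intros eps. destruct (H eps (cond_pos eps)) as [del [Hd H']].
    exists (mkposreal _ Hd). intros w Hw.
    change (Cmod ((f w - f z) - (w - z) * d) <= eps * Cmod (w - z)).
    rewrite (Cmult_comm (w - z)). apply H'; [exact I|exact Hw].
Qed.

Lemma ex_derive_cder f z : @ex_derive C_AbsRing C_NormedModule f z -> cder f z (C_derive f z).
Proof.
  intros H. apply is_derive_cder. apply C_derive_correct; auto.
Qed.

Lemma C_derive_cder f z d : cder f z d -> C_derive f z = d.
Proof. intros H. apply is_C_derive_unique. apply is_derive_cder, H. Qed.

(** * Complex-valued integrals *)

Definition ccont (F : R -> C) (x : R) : Prop :=
  forall eps, 0 < eps -> exists del, 0 < del /\
    forall y, Rabs (y - x) < del -> Cmod (F y - F x) < eps.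

(* Functions of a real variable are differentiated as functions on the real line inside C. *)
Definition rder (F : R -> C) (x : R) (d : C) : Prop :=
  der_on (fun w => Im w = 0) (fun w => F (Re w)) (RtoC x) d.

Lemma RtoC_Re (w : C) : Im w = 0 -> w = RtoC (Re w).
Proof. destruct w as [x y]; unfold RtoC; simpl. intros ->. reflexivity. Qed.

Lemma rder_iff F x d : rder F x d <->
  forall eps, 0 < eps -> exists del, 0 < del /\
    forall y, Rabs (y - x) < del ->
      Cmod (F y - F x - d * (RtoC y - RtoC x)) <= eps * Rabs (y - x).
Proof.
  split; intros H eps He; destruct (H eps He) as [del [Hd H']]; exists del; split; auto.
  - intros y Hy. specialize (H' (RtoC y) eq_refl). simpl in H'.
    rewrite <- RtoC_minus, Cmod_R in H'. rewrite <- RtoC_minus. auto.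
  - intros w Hw. rewrite (RtoC_Re _ Hw). simpl.
    rewrite <- RtoC_minus, Cmod_R. specialize (H' (Re w)). rewrite <- RtoC_minus in H'. auto.
Qed.

Lemma rder_ccont F x d : rder F x d -> ccont F x.
Proof.
  intros H eps He. destruct (der_on_cont _ _ _ _ H eps He) as [del [Hd H']].
  exists del; split; auto. intros y Hy.
  specialize (H' (RtoC y) eq_refl). simpl in H'. apply H'.
  rewrite <- RtoC_minus, Cmod_R. auto.
Qed.

Lemma rder_comp F G x d e : rder F x d -> cder G (F x) e ->
  rder (fun y => G (F y)) x (e * d)%C.
Proof.
  intros HF HG. apply (der_on_comp _ (fun _ => True) (fun w => F (Re w)) G _ d e); auto.
Qed.

Lemma ccont_comp F G x e : ccont F x -> cder G (F x) e -> ccont (fun y => G (F y)) x.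
Proof.
  intros HF HG eps He. destruct (der_on_cont _ _ _ _ HG eps He) as [d1 [H1 H1']].
  destruct (HF d1 H1) as [d2 [H2 H2']].
  exists d2; split; auto.
Qed.

Lemma ccont_scal c F x : ccont F x -> ccont (fun y => c * F y)%C x.
Proof.
  intros HF. apply (ccont_comp F (fun z => c * z)%C x (c * 1)); auto.
  apply der_on_scal, der_on_id.
Qed.

Lemma ccont_fst F x : ccont F x -> continuous (fun y => fst (F y)) x.
Proof.
  intros H. apply filterlim_locally. intros eps.
  destruct (H eps (cond_pos eps)) as [del [Hd H']].
  exists (mkposreal _ Hd). intros y Hy. specialize (H' y Hy).
  change (Rabs (fst (F y) - fst (F x)) < eps).
  eapply Rle_lt_trans; [|exact H'].
  apply Rle_trans with (2 := Rmax_Cmod (F y - F x)%C). apply Rmax_l.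
Qed.

Lemma ccont_snd F x : ccont F x -> continuous (fun y => snd (F y)) x.
Proof.
  intros H. apply filterlim_locally. intros eps.
  destruct (H eps (cond_pos eps)) as [del [Hd H']].
  exists (mkposreal _ Hd). intros y Hy. specialize (H' y Hy).
  change (Rabs (snd (F y) - snd (F x)) < eps).
  eapply Rle_lt_trans; [|exact H'].
  apply Rle_trans with (2 := Rmax_Cmod (F y - F x)%C). apply Rmax_r.
Qed.

Lemma Cmod_le_sum (x y : R) : Cmod (x, y) <= Rabs x + Rabs y.
Proof.
  eapply (Cmod_tri (RtoC x) (Ci * RtoC y)).
  - unfold RtoC, Ci, Cmult, Cplus; simpl. f_equal; ring.
  - rewrite Cmod_R; lra.
  - rewrite Cmod_mult, Cmod_Ci, Cmod_R. lra.
Qed.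

Definition CInt (F : R -> C) (a b : R) : C :=
  (RInt (fun x => fst (F x)) a b, RInt (fun x => snd (F x)) a b).

Definition cont_int (F : R -> C) (a b : R) := forall x, a <= x <= b -> ccont F x.

Lemma cont_int_ex1 F a b : a <= b -> cont_int F a b -> ex_RInt (fun x => fst (F x)) a b.
Proof.
  intros Hab H. apply (@ex_RInt_continuous R_CompleteNormedModule). intros z.
  rewrite Rmin_left, Rmax_right by auto. intros Hz. apply ccont_fst, H, Hz.
Qed.

Lemma cont_int_ex2 F a b : a <= b -> cont_int F a b -> ex_RInt (fun x => snd (F x)) a b.
Proof.
  intros Hab H. apply (@ex_RInt_continuous R_CompleteNormedModule). intros z.
  rewrite Rmin_left, Rmax_right by auto. intros Hz. apply ccont_snd, H, Hz.
Qed.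

Lemma CInt_ext F G a b : a <= b -> (forall x, a <= x <= b -> F x = G x) -> CInt F a b = CInt G a b.
Proof.
  intros Hab H. unfold CInt.
  f_equal; apply RInt_ext; intros x; rewrite Rmin_left, Rmax_right by auto;
    intros Hx; rewrite H by lra; auto.
Qed.

Lemma CInt_plus F G a b : a <= b -> cont_int F a b -> cont_int G a b ->
  CInt (fun x => F x + G x)%C a b = (CInt F a b + CInt G a b)%C.
Proof.
  intros Hab HF HG. unfold CInt, Cplus; simpl. f_equal.
  apply (RInt_plus (V := R_CompleteNormedModule) (fun x => fst (F x)) (fun x => fst (G x)));
    apply cont_int_ex1; auto.
  apply (RInt_plus (V := R_CompleteNormedModule) (fun x => snd (F x)) (fun x => snd (G x)));
    apply cont_int_ex2; auto.
Qed.

Lemma CInt_scal c F a b : a <= b -> cont_int F a b ->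
  CInt (fun x => c * F x)%C a b = (c * CInt F a b)%C.
Proof.
  intros Hab HF.
  assert (E1 := cont_int_ex1 _ _ _ Hab HF). assert (E2 := cont_int_ex2 _ _ _ Hab HF).
  destruct c as [c1 c2].
  unfold CInt, Cmult; simpl. f_equal.
  - etransitivity. apply (RInt_minus (V := R_CompleteNormedModule)
      (fun x => scal c1 (fst (F x))) (fun x => scal c2 (snd (F x))));
    apply (ex_RInt_scal (V := R_NormedModule)); auto.
    rewrite !(RInt_scal (V := R_CompleteNormedModule)) by auto. reflexivity.
  - etransitivity. apply (RInt_plus (V := R_CompleteNormedModule)
      (fun x => scal c1 (snd (F x))) (fun x => scal c2 (fst (F x))));
    apply (ex_RInt_scal (V := R_NormedModule)); auto.
    rewrite !(RInt_scal (V := R_CompleteNormedModule)) by auto. reflexivity.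
Qed.

Lemma CInt_Chasles F a b c : a <= b -> b <= c -> cont_int F a c ->
  (CInt F a b + CInt F b c)%C = CInt F a c.
Proof.
  intros Hab Hbc H.
  assert (H1 : cont_int F a b) by (intros x Hx; apply H; lra).
  assert (H2 : cont_int F b c) by (intros x Hx; apply H; lra).
  unfold CInt, Cplus; simpl. f_equal.
  apply (RInt_Chasles (V := R_CompleteNormedModule)); apply cont_int_ex1; auto.
  apply (RInt_Chasles (V := R_CompleteNormedModule)); apply cont_int_ex2; auto.
Qed.

(** Real and imaginary parts are bounded separately, which costs the factor 2. The later Cauchy
    estimates carry it; Schwarz's lemma must be sharp, and there it disappears by taking powers. *)
Lemma CInt_bound F a b M : a <= b -> cont_int F a b ->
  (forall x, a <= x <= b -> Cmod (F x) <= M) -> Cmod (CInt F a b) <= 2 * M * (b - a).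
Proof.
  intros Hab HF HM.
  assert (A1 : Rabs (RInt (fun x => fst (F x)) a b) <= (b - a) * M).
  { apply abs_RInt_le_const; auto. apply cont_int_ex1; auto.
    intros t Ht. apply Rle_trans with (2 := HM t Ht).
    apply Rle_trans with (2 := Rmax_Cmod (F t)). apply Rmax_l. }
  assert (A2 : Rabs (RInt (fun x => snd (F x)) a b) <= (b - a) * M).
  { apply abs_RInt_le_const; auto. apply cont_int_ex2; auto.
    intros t Ht. apply Rle_trans with (2 := HM t Ht).
    apply Rle_trans with (2 := Rmax_Cmod (F t)). apply Rmax_r. }
  eapply Rle_trans; [apply Cmod_le_sum|]. lra.
Qed.

Lemma rder_fst F x d : rder F x d -> is_derive (fun y => fst (F y)) x (fst d).
Proof.
  intros H. rewrite rder_iff in H. split. apply is_linear_scal_l.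
  intros z Hz. apply (@is_filter_lim_locally_unique R_AbsRing R_NormedModule) in Hz.
  rewrite <- Hz. intros eps. destruct (H eps (cond_pos eps)) as [del [Hd H']].
  exists (mkposreal _ Hd). intros y Hy. specialize (H' y Hy).
  change (Rabs ((fst (F y) - fst (F x)) - (y - x) * fst d) <= eps * Rabs (y - x)).
  eapply Rle_trans; [|exact H'].
  eapply Rle_trans; [|apply Rmax_Cmod]. eapply Rle_trans; [|apply Rmax_l].
  right. f_equal. simpl. ring.
Qed.

Lemma rder_snd F x d : rder F x d -> is_derive (fun y => snd (F y)) x (snd d).
Proof.
  intros H. rewrite rder_iff in H. split. apply is_linear_scal_l.
  intros z Hz. apply (@is_filter_lim_locally_unique R_AbsRing R_NormedModule) in Hz.
  rewrite <- Hz. intros eps. destruct (H eps (cond_pos eps)) as [del [Hd H']].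
  exists (mkposreal _ Hd). intros y Hy. specialize (H' y Hy).
  change (Rabs ((snd (F y) - snd (F x)) - (y - x) * snd d) <= eps * Rabs (y - x)).
  eapply Rle_trans; [|exact H'].
  eapply Rle_trans; [|apply Rmax_Cmod]. eapply Rle_trans; [|apply Rmax_r].
  right. f_equal. simpl. ring.
Qed.

Lemma CInt_FTC F f a b : a <= b -> (forall x, a <= x <= b -> rder F x (f x)) ->
  cont_int f a b -> CInt f a b = (F b - F a)%C.
Proof.
  intros Hab HF Hf. unfold CInt.
  assert (E1 : is_RInt (fun x => fst (f x)) a b (fst (F b) - fst (F a))).
  { apply (is_RInt_derive (V := R_CompleteNormedModule) (fun x => fst (F x)));
    intros x; rewrite Rmin_left, Rmax_right by auto; intros Hx.
    apply rder_fst, HF, Hx. apply ccont_fst, Hf, Hx. }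
  assert (E2 : is_RInt (fun x => snd (f x)) a b (snd (F b) - snd (F a))).
  { apply (is_RInt_derive (V := R_CompleteNormedModule) (fun x => snd (F x)));
    intros x; rewrite Rmin_left, Rmax_right by auto; intros Hx.
    apply rder_snd, HF, Hx. apply ccont_snd, Hf, Hx. }
  apply (is_RInt_unique (V := R_CompleteNormedModule)) in E1.
  apply (is_RInt_unique (V := R_CompleteNormedModule)) in E2.
  rewrite E1, E2. reflexivity.
Qed.

(** * Goursat on rectangles *)

Definition hseg (y x : R) : C := (x, y).
Definition vseg (x y : R) : C := (x, y).

Lemma rder_hseg y x : rder (hseg y) x 1.
Proof.
  apply rder_iff. intros eps He. exists 1; split; [lra|]. intros t _.
  replace (hseg y t - hseg y x - 1 * (RtoC t - RtoC x))%C with (RtoC 0).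
  rewrite Cmod_0. apply Rmult_le_pos; [lra|apply Rabs_pos].
  unfold hseg, RtoC, Cminus, Cplus, Copp, Cmult; simpl. f_equal; ring.
Qed.

Lemma rder_vseg x y : rder (vseg x) y Ci.
Proof.
  apply rder_iff. intros eps He. exists 1; split; [lra|]. intros t _.
  replace (vseg x t - vseg x y - Ci * (RtoC t - RtoC y))%C with (RtoC 0).
  rewrite Cmod_0. apply Rmult_le_pos; [lra|apply Rabs_pos].
  unfold vseg, RtoC, Cminus, Cplus, Copp, Cmult, Ci; simpl. f_equal; ring.
Qed.

(** The contour integral over the boundary, counterclockwise; [Ci] on the vertical sides comes from
    dz = i dy. *)
Definition rect_int (g : C -> C) (x1 x2 y1 y2 : R) : C :=
  (CInt (fun x => g (hseg y1 x)) x1 x2 + Ci * CInt (fun y => g (vseg x2 y)) y1 y2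
   - CInt (fun x => g (hseg y2 x)) x1 x2 - Ci * CInt (fun y => g (vseg x1 y)) y1 y2)%C.

Definition holo_rect (g : C -> C) (x1 x2 y1 y2 : R) : Prop :=
  forall x y, x1 <= x <= x2 -> y1 <= y <= y2 -> exists d, cder g (x, y) d.

Lemma holo_rect_h g x1 x2 y1 y2 y : holo_rect g x1 x2 y1 y2 -> y1 <= y <= y2 ->
  cont_int (fun x => g (hseg y x)) x1 x2.
Proof.
  intros H Hy x Hx. destruct (H x y Hx Hy) as [d Hd].
  apply (ccont_comp (hseg y) g x d); auto. apply rder_ccont with (RtoC 1). apply rder_hseg.
Qed.

Lemma holo_rect_v g x1 x2 y1 y2 x : holo_rect g x1 x2 y1 y2 -> x1 <= x <= x2 ->
  cont_int (fun y => g (vseg x y)) y1 y2.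
Proof.
  intros H Hx y Hy. destruct (H x y Hx Hy) as [d Hd].
  apply (ccont_comp (vseg x) g y d); auto. apply rder_ccont with Ci. apply rder_vseg.
Qed.

Lemma rect_int_split_x g x1 xm x2 y1 y2 : x1 <= xm -> xm <= x2 -> y1 <= y2 ->
  cont_int (fun x => g (hseg y1 x)) x1 x2 -> cont_int (fun x => g (hseg y2 x)) x1 x2 ->
  rect_int g x1 x2 y1 y2 = (rect_int g x1 xm y1 y2 + rect_int g xm x2 y1 y2)%C.
Proof.
  intros H1 H2 Hy C1 C2. unfold rect_int.
  rewrite <- (CInt_Chasles _ x1 xm x2 H1 H2 C1), <- (CInt_Chasles _ x1 xm x2 H1 H2 C2). ring.
Qed.

Lemma rect_int_split_y g x1 x2 y1 ym y2 : y1 <= ym -> ym <= y2 -> x1 <= x2 ->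
  cont_int (fun y => g (vseg x1 y)) y1 y2 -> cont_int (fun y => g (vseg x2 y)) y1 y2 ->
  rect_int g x1 x2 y1 y2 = (rect_int g x1 x2 y1 ym + rect_int g x1 x2 ym y2)%C.
Proof.
  intros H1 H2 Hy C1 C2. unfold rect_int.
  rewrite <- (CInt_Chasles _ y1 ym y2 H1 H2 C1), <- (CInt_Chasles _ y1 ym y2 H1 H2 C2). ring.
Qed.

Lemma rect_int_bound g x1 x2 y1 y2 M : x1 <= x2 -> y1 <= y2 ->
  cont_int (fun x => g (hseg y1 x)) x1 x2 -> cont_int (fun x => g (hseg y2 x)) x1 x2 ->
  cont_int (fun y => g (vseg x1 y)) y1 y2 -> cont_int (fun y => g (vseg x2 y)) y1 y2 ->
  (forall x, x1 <= x <= x2 -> Cmod (g (x, y1)) <= M /\ Cmod (g (x, y2)) <= M) ->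
  (forall y, y1 <= y <= y2 -> Cmod (g (x1, y)) <= M /\ Cmod (g (x2, y)) <= M) ->
  Cmod (rect_int g x1 x2 y1 y2) <= 4 * M * ((x2 - x1) + (y2 - y1)).
Proof.
  intros Hx Hy C1 C2 C3 C4 B1 B2.
  assert (A1 := CInt_bound _ _ _ M Hx C1 (fun x H => proj1 (B1 x H))).
  assert (A2 := CInt_bound _ _ _ M Hx C2 (fun x H => proj2 (B1 x H))).
  assert (A3 := CInt_bound _ _ _ M Hy C3 (fun x H => proj1 (B2 x H))).
  assert (A4 := CInt_bound _ _ _ M Hy C4 (fun x H => proj2 (B2 x H))).
  unfold rect_int.
  set (I1 := CInt (fun x => g (hseg y1 x)) x1 x2) in *.
  set (I2 := CInt (fun x => g (hseg y2 x)) x1 x2) in *.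
  set (I3 := CInt (fun y => g (vseg x1 y)) y1 y2) in *.
  set (I4 := CInt (fun y => g (vseg x2 y)) y1 y2) in *.
  assert (T1 := Cmod_sub_le (I1 + Ci * I4 - I2) (Ci * I3)).
  assert (T2 := Cmod_sub_le (I1 + Ci * I4) I2).
  assert (T3 := Cmod_triangle I1 (Ci * I4)).
  rewrite Cmod_mult, Cmod_Ci in T1, T3. lra.
Qed.

Lemma rect_int_plus g h x1 x2 y1 y2 : x1 <= x2 -> y1 <= y2 ->
  holo_rect g x1 x2 y1 y2 -> holo_rect h x1 x2 y1 y2 ->
  rect_int (fun z => g z + h z)%C x1 x2 y1 y2 =
  (rect_int g x1 x2 y1 y2 + rect_int h x1 x2 y1 y2)%C.
Proof.
  intros Hx Hy Hg Hh. unfold rect_int.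
  rewrite (CInt_plus (fun x => g (hseg y1 x)) (fun x => h (hseg y1 x))),
    (CInt_plus (fun x => g (hseg y2 x)) (fun x => h (hseg y2 x))),
    (CInt_plus (fun y => g (vseg x1 y)) (fun y => h (vseg x1 y))),
    (CInt_plus (fun y => g (vseg x2 y)) (fun y => h (vseg x2 y))); auto.
  ring.
  all: eapply holo_rect_h || eapply holo_rect_v; eauto; lra.
Qed.

Lemma rect_int_primitive G g x1 x2 y1 y2 : x1 <= x2 -> y1 <= y2 ->
  (forall z, cder G z (g z)) -> (forall z, exists d, cder g z d) ->
  rect_int g x1 x2 y1 y2 = 0.
Proof.
  intros Hx Hy HG Hg. unfold rect_int.
  assert (HR : holo_rect g x1 x2 y1 y2) by (intros x y _ _; apply Hg).
  assert (Eh : forall y, y1 <= y <= y2 ->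
    CInt (fun x => g (hseg y x)) x1 x2 = (G (x2, y) - G (x1, y))%C).
  { intros y Hy'. apply (CInt_FTC (fun x => G (hseg y x))); auto.
    intros x Hx'. replace (g (hseg y x)) with (g (hseg y x) * 1)%C by ring.
    apply (rder_comp (hseg y) G); auto. apply rder_hseg.
    apply (holo_rect_h g x1 x2 y1 y2); auto. }
  assert (Ev : forall x, x1 <= x <= x2 ->
    (Ci * CInt (fun y => g (vseg x y)) y1 y2)%C = (G (x, y2) - G (x, y1))%C).
  { intros x Hx'. rewrite <- CInt_scal; auto. 2: apply (holo_rect_v g x1 x2 y1 y2); auto.
    apply (CInt_FTC (fun y => G (vseg x y))); auto.
    intros y Hy'. rewrite Cmult_comm.
    apply (rder_comp (vseg x) G); auto. apply rder_vseg.
    intros y Hy'. apply ccont_scal. apply (holo_rect_v g x1 x2 y1 y2); auto. }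
  rewrite !Eh, !Ev by lra. ring.
Qed.

Lemma rect_int_affine A B x1 x2 y1 y2 : x1 <= x2 -> y1 <= y2 ->
  rect_int (fun z => A + B * z)%C x1 x2 y1 y2 = 0.
Proof.
  intros Hx Hy. apply (rect_int_primitive (fun z => A * z + B / 2 * (z * z))%C); auto.
  - intros z. eapply der_on_eq; [reflexivity| |].
    2:{ apply der_on_plus. apply der_on_scal, der_on_id.
        apply der_on_scal, der_on_mult; apply der_on_id. }
    cbv beta. field.
  - intros z. exists (0 + B * 1)%C. apply der_on_plus. apply der_on_const.
    apply der_on_scal, der_on_id.
Qed.

(** Bisection as an induction principle for rectangles. If [P] failed, some quarter would fail at
    every stage; the chosen quarters shrink to a point (u, v), where the local hypothesis
    contradicts the failure. *)
Lemma rect_bisection (P : R -> R -> R -> R -> Prop) X1 X2 Y1 Y2 :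
  X1 <= X2 -> Y1 <= Y2 ->
  (forall x1 x2 y1 y2, X1 <= x1 -> x1 <= x2 -> x2 <= X2 -> Y1 <= y1 -> y1 <= y2 -> y2 <= Y2 ->
    let xm := (x1 + x2) / 2 in let ym := (y1 + y2) / 2 in
    P x1 xm y1 ym -> P xm x2 y1 ym -> P x1 xm ym y2 -> P xm x2 ym y2 -> P x1 x2 y1 y2) ->
  (forall u v, X1 <= u <= X2 -> Y1 <= v <= Y2 -> exists del, 0 < del /\
    forall x1 x2 y1 y2, X1 <= x1 -> x2 <= X2 -> Y1 <= y1 -> y2 <= Y2 ->
      x1 <= u <= x2 -> y1 <= v <= y2 -> (x2 - x1) + (y2 - y1) < del -> P x1 x2 y1 y2) ->
  P X1 X2 Y1 Y2.
Proof.
  intros HX HY Hq Hloc. apply NNPP. intros HP.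
  set (T := (R * R * (R * R))%type).
  set (bad := fun r : T => match r with ((x1, x2), (y1, y2)) =>
     X1 <= x1 /\ x1 <= x2 /\ x2 <= X2 /\ Y1 <= y1 /\ y1 <= y2 /\ y2 <= Y2 /\ ~ P x1 x2 y1 y2 end).
  set (sub := fun r s : T => match r, s with ((x1, x2), (y1, y2)), ((a1, a2), (b1, b2)) =>
     x1 <= a1 /\ a2 <= x2 /\ a2 - a1 = (x2 - x1) / 2 /\
     y1 <= b1 /\ b2 <= y2 /\ b2 - b1 = (y2 - y1) / 2 end).
  (* Bad rectangles are carried with their proofs, so that the sequence of bad quarters can be
     defined by recursion. *)
  assert (step : forall r : {r : T | bad r}, {s : {s : T | bad s} | sub (proj1_sig r) (proj1_sig s)}).
  { intros [[[x1 x2] [y1 y2]] Hb]. apply constructive_indefinite_description. simpl.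
    destruct Hb as [B1 [B2 [B3 [B4 [B5 [B6 B7]]]]]].
    assert (Hs : forall s, sub ((x1,x2),(y1,y2)) s -> bad s ->
      exists x : {s : T | bad s}, sub ((x1,x2),(y1,y2)) (proj1_sig x)).
    { intros s Hs Hb. exists (exist _ s Hb). exact Hs. }
    specialize (Hq x1 x2 y1 y2 B1 B2 B3 B4 B5 B6). cbv zeta in Hq.
    set (xm := (x1 + x2) / 2) in *. set (ym := (y1 + y2) / 2) in *.
    assert (Exm : 2 * xm = x1 + x2) by (unfold xm; lra).
    assert (Eym : 2 * ym = y1 + y2) by (unfold ym; lra).
    destruct (classic (P x1 xm y1 ym)) as [Q1|Q1].
    2: { apply (Hs ((x1, xm), (y1, ym))); simpl; repeat split; auto; lra. }
    destruct (classic (P xm x2 y1 ym)) as [Q2|Q2].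
    2: { apply (Hs ((xm, x2), (y1, ym))); simpl; repeat split; auto; lra. }
    destruct (classic (P x1 xm ym y2)) as [Q3|Q3].
    2: { apply (Hs ((x1, xm), (ym, y2))); simpl; repeat split; auto; lra. }
    destruct (classic (P xm x2 ym y2)) as [Q4|Q4].
    2: { apply (Hs ((xm, x2), (ym, y2))); simpl; repeat split; auto; lra. }
    exfalso; auto. }
  assert (Hb0 : bad ((X1, X2), (Y1, Y2))) by (simpl; repeat split; auto; lra).
  set (r := fix r n := match n with O => exist bad _ Hb0 | S m => proj1_sig (step (r m)) end).
  set (x1 := fun n => fst (fst (proj1_sig (r n)))).
  set (x2 := fun n => snd (fst (proj1_sig (r n)))).
  set (y1 := fun n => fst (snd (proj1_sig (r n)))).
  set (y2 := fun n => snd (snd (proj1_sig (r n)))).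
  assert (Hbad : forall n, bad ((x1 n, x2 n), (y1 n, y2 n))).
  { intros n. unfold x1, x2, y1, y2.
    destruct (r n) as [[[? ?] [? ?]] Hb]. simpl in *. auto. }
  assert (Hsub : forall n, sub ((x1 n, x2 n), (y1 n, y2 n)) ((x1 (S n), x2 (S n)), (y1 (S n), y2 (S n)))).
  { intros n. assert (Hs := proj2_sig (step (r n))).
    unfold x1, x2, y1, y2. change (r (S n)) with (proj1_sig (step (r n))).
    set (q := proj1_sig (step (r n))) in *. clearbody q.
    destruct (proj1_sig (r n)) as [[? ?] [? ?]].
    destruct (proj1_sig q) as [[? ?] [? ?]]. exact Hs. }
  assert (Hsize : forall n, x2 n - x1 n = (X2 - X1) / 2 ^ n /\ y2 n - y1 n = (Y2 - Y1) / 2 ^ n).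
  { induction n as [|n [I1 I2]]. unfold x1, x2, y1, y2; simpl. split; field.
    destruct (Hsub n) as [_ [_ [E1 [_ [_ E2]]]]]. rewrite E1, E2, I1, I2.
    simpl. split; field; apply pow_nonzero; lra. }
  assert (Hnest : forall n k, x1 n <= x1 (n + k)%nat /\ x2 (n + k)%nat <= x2 n /\
     y1 n <= y1 (n + k)%nat /\ y2 (n + k)%nat <= y2 n).
  { intros n k. induction k as [|k I]. rewrite Nat.add_0_r. lra.
    rewrite Nat.add_succ_r. destruct (Hsub (n + k)%nat) as [? [? [_ [? [? _]]]]]. lra. }
  assert (Hcross : forall n m, x1 n <= x2 m /\ y1 n <= y2 m).
  { intros n m. destruct (Hnest n m) as [A1 [_ [A3 _]]].
    destruct (Hnest m n) as [_ [A2 [_ A4]]]. rewrite (Nat.add_comm m n) in *.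
    destruct (Hbad (n + m)%nat) as [_ [? [_ [_ [? _]]]]]. lra. }
  destruct (completeness (fun x => exists n, x = x1 n)) as [u [Hu1 Hu2]].
  { exists (x2 O). intros x [n ->]. apply Hcross. }
  { exists (x1 O), O. reflexivity. }
  destruct (completeness (fun x => exists n, x = y1 n)) as [v [Hv1 Hv2]].
  { exists (y2 O). intros x [n ->]. apply Hcross. }
  { exists (y1 O), O. reflexivity. }
  assert (Hu : forall n, x1 n <= u <= x2 n).
  { intros n. split. apply Hu1. exists n; auto. apply Hu2. intros x [m ->]. apply Hcross. }
  assert (Hv : forall n, y1 n <= v <= y2 n).
  { intros n. split. apply Hv1. exists n; auto. apply Hv2. intros x [m ->]. apply Hcross. }
  destruct (Hloc u v) as [del [Hd Hdel]].
  { exact (Hu O). } { exact (Hv O). }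
  assert (Hn : exists n, (X2 - X1 + (Y2 - Y1)) / 2 ^ n < del).
  { destruct (pow_lt_1_zero (/ 2) ltac:(rewrite Rabs_pos_eq; lra)
      (del / (X2 - X1 + (Y2 - Y1) + 1))) as [N HN].
    apply Rdiv_lt_0_compat; lra.
    exists N. specialize (HN N (Nat.le_refl _)). rewrite Rabs_pos_eq in HN by (apply pow_le; lra).
    rewrite pow_inv in HN. unfold Rdiv.
    apply Rmult_lt_compat_l with (r := X2 - X1 + (Y2 - Y1) + 1) in HN; [|lra].
    replace ((X2 - X1 + (Y2 - Y1) + 1) * (del / (X2 - X1 + (Y2 - Y1) + 1))) with del in HN by (field; lra).
    assert (0 < / 2 ^ N) by (apply Rinv_0_lt_compat, pow_lt; lra). nra. }
  destruct Hn as [n Hn]. destruct (Hsize n) as [S1 S2].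
  destruct (Hbad n) as [B1 [B2 [B3 [B4 [B5 [B6 B7]]]]]]. apply B7.
  apply Hdel; auto.
  rewrite S1, S2. unfold Rdiv in *. rewrite <- Rmult_plus_distr_r. exact Hn.
Qed.

Lemma holo_rect_sub g x1 x2 y1 y2 a1 a2 b1 b2 : holo_rect g x1 x2 y1 y2 ->
  x1 <= a1 -> a2 <= x2 -> y1 <= b1 -> b2 <= y2 -> holo_rect g a1 a2 b1 b2.
Proof. intros H ? ? ? ? x y Hx Hy. apply H; lra. Qed.

(** The bound |integral| <= eps (half perimeter)^2 is stable under quartering, because each of the
    four quarters has half the perimeter. It holds near each point, because there the function is
    affine up to eps/4 times the distance, and the affine part integrates to zero. *)
Theorem goursat g X1 X2 Y1 Y2 : X1 <= X2 -> Y1 <= Y2 -> holo_rect g X1 X2 Y1 Y2 ->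
  rect_int g X1 X2 Y1 Y2 = 0.
Proof.
  intros HX HY HR. apply Cmod_eq_0. apply Rle_antisym; [|apply Cmod_ge_0].
  apply Rnot_lt_le. intros Hpos.
  set (s := (X2 - X1) + (Y2 - Y1)).
  (* Chosen so that eps s^2 lies strictly below the modulus of the integral: the bound for this eps
     is a contradiction. *)
  set (eps := Cmod (rect_int g X1 X2 Y1 Y2) / (2 * (s ^ 2 + 1))).
  assert (Hs : 0 <= s ^ 2) by apply pow2_ge_0.
  assert (He : 0 < eps) by (apply Rdiv_lt_0_compat; lra).
  assert (H : Cmod (rect_int g X1 X2 Y1 Y2) <= eps * ((X2 - X1) + (Y2 - Y1)) ^ 2).
  2: { fold s in H.
    assert (E : eps * (2 * (s ^ 2 + 1)) = Cmod (rect_int g X1 X2 Y1 Y2))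
      by (unfold eps; field; lra).
    rewrite <- E in H. nra. }
  apply (rect_bisection (fun x1 x2 y1 y2 =>
     Cmod (rect_int g x1 x2 y1 y2) <= eps * ((x2 - x1) + (y2 - y1)) ^ 2)); auto.
  - intros x1 x2 y1 y2 H1 H2 H3 H4 H5 H6 xm ym Q1 Q2 Q3 Q4.
    assert (Exm : xm = (x1 + x2) / 2) by auto. assert (Eym : ym = (y1 + y2) / 2) by auto.
    rewrite (rect_int_split_x g x1 xm x2 y1 y2); try lra;
      [|apply (holo_rect_h g x1 x2 y1 y2); [eapply holo_rect_sub; eauto|lra] ..].
    rewrite (rect_int_split_y g x1 xm y1 ym y2); try lra;
      [|apply (holo_rect_v g x1 x2 y1 y2); [eapply holo_rect_sub; eauto|lra] ..].
    rewrite (rect_int_split_y g xm x2 y1 ym y2); try lra;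
      [|apply (holo_rect_v g x1 x2 y1 y2); [eapply holo_rect_sub; eauto|lra] ..].
    set (J1 := rect_int g x1 xm y1 ym) in *. set (J2 := rect_int g xm x2 y1 ym) in *.
    set (J3 := rect_int g x1 xm ym y2) in *. set (J4 := rect_int g xm x2 ym y2) in *.
    assert (T1 := Cmod_triangle (J1 + J3) (J2 + J4)).
    assert (T2 := Cmod_triangle J1 J3). assert (T3 := Cmod_triangle J2 J4).
    assert (E : forall a b, xm - x1 = a -> ym - y1 = b ->
      x2 - xm = a /\ y2 - ym = b /\ x2 - x1 = 2 * a /\ y2 - y1 = 2 * b)
      by (intros; repeat split; lra).
    destruct (E _ _ eq_refl eq_refl) as [E1 [E2 [E3 E4]]].
    rewrite E1, E2, E3, E4 in *.
    set (a := xm - x1) in *. set (b := ym - y1) in *.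
    replace (eps * (2 * a + 2 * b) ^ 2) with (4 * (eps * (a + b) ^ 2)) by ring. lra.
  - intros u v Hu Hv. destruct (HR u v Hu Hv) as [d Hd].
    destruct (Hd (eps / 4)) as [del [H1 Hdel]]; [lra|].
    exists del; split; auto. intros x1 x2 y1 y2 A1 A2 A3 A4 A5 A6 A7.
    assert (HR' : holo_rect g x1 x2 y1 y2) by (eapply holo_rect_sub; eauto).
    set (w0 := (u, v) : C) in *.
    set (A := (g w0 - d * w0)%C).
    set (h := fun z => (g z - (A + d * z))%C).
    assert (Hh : holo_rect h x1 x2 y1 y2).
    { intros x y Hx Hy. destruct (HR' x y Hx Hy) as [e Hde].
      exists (e - (0 + d * 1))%C. apply der_on_minus; auto. apply der_on_plus.
      apply der_on_const. apply der_on_scal, der_on_id. }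
    assert (Ha : holo_rect (fun z => A + d * z)%C x1 x2 y1 y2).
    { intros x y _ _. exists (0 + d * 1)%C. apply der_on_plus.
      apply der_on_const. apply der_on_scal, der_on_id. }
    replace (rect_int g x1 x2 y1 y2) with (rect_int h x1 x2 y1 y2).
    2: { transitivity (rect_int h x1 x2 y1 y2 + rect_int (fun z => A + d * z) x1 x2 y1 y2)%C.
      rewrite rect_int_affine by lra. ring.
      rewrite <- rect_int_plus by (auto; lra).
      unfold rect_int. repeat (f_equal; try (apply CInt_ext; [lra|intros; unfold h; ring])). }
    replace (eps * (x2 - x1 + (y2 - y1)) ^ 2) with
      (4 * (eps / 4 * (x2 - x1 + (y2 - y1))) * (x2 - x1 + (y2 - y1))) by field.
    assert (Hin : forall x y, x1 <= x <= x2 -> y1 <= y <= y2 ->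
      Cmod (h (x, y)) <= eps / 4 * (x2 - x1 + (y2 - y1))).
    { intros x y Hx Hy.
      assert (Hz : Cmod ((x, y) - w0) <= x2 - x1 + (y2 - y1)).
      { unfold w0, Cminus, Cplus, Copp; simpl. eapply Rle_trans; [apply Cmod_le_sum|].
        apply Rplus_le_compat; apply Rabs_le; lra. }
      replace (h (x, y)) with (g (x, y) - g w0 - d * ((x, y) - w0))%C
        by (unfold h, A; ring).
      eapply Rle_trans. apply Hdel; auto. lra.
      apply Rmult_le_compat_l; lra. }
    apply rect_int_bound; try lra;
      try (eapply holo_rect_h; [eauto|lra]); try (eapply holo_rect_v; [eauto|lra]);
      intros; split; apply Hin; lra.
Qed.

(* The exceptional point is enclosed in squares of side [2 e], [e -> 0]. *)
Theorem goursat_except g X1 X2 Y1 Y2 u v M r :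
  X1 < u < X2 -> Y1 < v < Y2 -> 0 < r ->
  (forall x y, X1 <= x <= X2 -> Y1 <= y <= Y2 -> (x, y) <> (u, v) -> exists d, cder g (x, y) d) ->
  (forall z, Cmod (z - (u, v)) < r -> Cmod (g z) <= M) ->
  rect_int g X1 X2 Y1 Y2 = 0.
Proof.
  intros Hu Hv Hr HR HM. apply Cmod_eq_0. apply Rle_antisym; [|apply Cmod_ge_0].
  assert (HM0 : 0 <= M).
  { apply Rle_trans with (1 := Cmod_ge_0 (g (u, v))). apply HM.
    replace ((u, v) - (u, v))%C with (RtoC 0) by ring. rewrite Cmod_0; auto. }
  assert (Hrect : forall x1 x2 y1 y2, X1 <= x1 -> x2 <= X2 -> Y1 <= y1 -> y2 <= Y2 ->
    (x2 < u \/ u < x1 \/ y2 < v \/ v < y1) -> holo_rect g x1 x2 y1 y2).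
  { intros x1 x2 y1 y2 H1 H2 H3 H4 H5 x y Hx Hy. apply HR; try lra.
    intros E. injection E as -> ->. lra. }
  assert (Hh : forall y, Y1 <= y <= Y2 -> y <> v -> cont_int (fun x => g (hseg y x)) X1 X2).
  { intros y Hy Hyv. apply (holo_rect_h g X1 X2 y y); try lra. apply Hrect; lra. }
  assert (Hvv : forall x, X1 <= x <= X2 -> x <> u -> cont_int (fun y => g (vseg x y)) Y1 Y2).
  { intros x Hx Hxu. apply (holo_rect_v g x x Y1 Y2); try lra. apply Hrect; lra. }
  assert (Hsub : forall F a b a' b', cont_int F a b -> a <= a' -> b' <= b -> cont_int F a' b').
  { intros F a b a' b' H ? ? x Hx. apply H; lra. }
  destruct (small3 (u - X1) (X2 - u) (v - Y1)) as [m1 [Hm1 B1]]; try lra.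
  destruct (small2 m1 (Y2 - v)) as [m [Hm B2]]; try lra.
  assert (key : forall e, 0 < e -> e < m -> 2 * e < r -> Cmod (rect_int g X1 X2 Y1 Y2) <= 16 * M * e).
  { intros e He Hem Her.
    rewrite (rect_int_split_x g X1 (u - e) X2 Y1 Y2); try lra; [|apply Hh; lra ..].
    rewrite (goursat g X1 (u - e) Y1 Y2); try lra; [|apply Hrect; lra].
    rewrite (rect_int_split_x g (u - e) (u + e) X2 Y1 Y2); try lra;
      [|eapply Hsub; [apply Hh|..]; lra ..].
    rewrite (goursat g (u + e) X2 Y1 Y2); try lra; [|apply Hrect; lra].
    rewrite (rect_int_split_y g (u - e) (u + e) Y1 (v - e) Y2); try lra; [|apply Hvv; lra ..].
    rewrite (goursat g (u - e) (u + e) Y1 (v - e)); try lra; [|apply Hrect; lra].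
    rewrite (rect_int_split_y g (u - e) (u + e) (v - e) (v + e) Y2); try lra;
      [|eapply Hsub; [apply Hvv|..]; lra ..].
    rewrite (goursat g (u - e) (u + e) (v + e) Y2); try lra; [|apply Hrect; lra].
    replace (0 + (0 + (rect_int g (u - e) (u + e) (v - e) (v + e) + 0) + 0))%C
      with (rect_int g (u - e) (u + e) (v - e) (v + e)) by ring.
    replace (0 + (0 + (rect_int g (u - e) (u + e) (v - e) (v + e) + 0)) + 0)%C
      with (rect_int g (u - e) (u + e) (v - e) (v + e)) by ring.
    assert (Hin : forall x y, u - e <= x <= u + e -> v - e <= y <= v + e -> Cmod (g (x, y)) <= M).
    { intros x y Hx Hy. apply HM.
      unfold Cminus, Cplus, Copp; simpl. eapply Rle_lt_trans; [apply Cmod_le_sum|].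
      apply Rle_lt_trans with (e + e); [|lra].
      apply Rplus_le_compat; apply Rabs_le; lra. }
    replace (16 * M * e) with (4 * M * ((u + e - (u - e)) + (v + e - (v - e)))) by ring.
    apply rect_int_bound; try lra; try (eapply Hsub; [apply Hh|..]; lra);
      try (eapply Hsub; [apply Hvv|..]; lra);
      intros; split; apply Hin; lra. }
  apply le_of_le_eps. intros e0 He0.
  destruct (small_mult (16 * M) e0) as [d [Hd Hsm]]; try lra.
  destruct (small3 d (m / 2) (r / 4)) as [e [He B3]]; try lra.
  specialize (key e He ltac:(lra) ltac:(lra)). specialize (Hsm e ltac:(lra)). lra.
Qed.

(** * Circles and the exponential *)

Lemma deriv_eps f x l : derivable_pt_lim f x l ->
  forall eps, 0 < eps -> exists del, 0 < del /\ forall y, Rabs (y - x) < del ->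
    Rabs (f y - f x - l * (y - x)) <= eps * Rabs (y - x).
Proof.
  intros H eps He. destruct (H eps He) as [del Hd].
  exists del; split; [apply cond_pos|]. intros y Hy.
  destruct (Req_dec y x) as [->|E].
  { replace (f x - f x - l * (x - x)) with 0 by ring. rewrite Rabs_R0.
    apply Rmult_le_pos; [lra|apply Rabs_pos]. }
  assert (E' : y - x <> 0) by lra. specialize (Hd _ E' Hy).
  replace (x + (y - x)) with y in Hd by ring.
  replace (f y - f x - l * (y - x)) with (((f y - f x) / (y - x) - l) * (y - x)) by (field; auto).
  rewrite Rabs_mult. apply Rmult_le_compat_r; [apply Rabs_pos|lra].
Qed.

Lemma rder_pair f g x a b : derivable_pt_lim f x a -> derivable_pt_lim g x b ->
  rder (fun t => (f t, g t)) x (a, b).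
Proof.
  intros Hf Hg. apply rder_iff. intros eps He.
  destruct (deriv_eps _ _ _ Hf (eps / 2)) as [d1 [H1 F]]; [lra|].
  destruct (deriv_eps _ _ _ Hg (eps / 2)) as [d2 [H2 G]]; [lra|].
  exists (Rmin d1 d2); split; [apply Rmin_pos; auto|]. intros y Hy.
  assert (A1 := F y (Rlt_le_trans _ _ _ Hy (Rmin_l _ _))).
  assert (A2 := G y (Rlt_le_trans _ _ _ Hy (Rmin_r _ _))).
  replace ((f y, g y) - (f x, g x) - (a, b) * (RtoC y - RtoC x))%C with
    ((f y - f x - a * (y - x), g y - g x - b * (y - x)) : C).
  - eapply Rle_trans; [apply Cmod_le_sum|]. lra.
  - unfold RtoC, Cminus, Cplus, Copp, Cmult; simpl. f_equal; ring.
Qed.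

Definition cis (t : R) : C := (cos t, sin t).

Lemma rder_cis t : rder cis t (Ci * cis t)%C.
Proof.
  replace (Ci * cis t)%C with ((- sin t, cos t) : C).
  apply rder_pair; [apply derivable_pt_lim_cos|apply derivable_pt_lim_sin].
  unfold cis, Ci, Cmult; simpl. f_equal; ring.
Qed.

Lemma Cmod_cis t : Cmod (cis t) = 1.
Proof.
  unfold Cmod, cis; simpl. rewrite !Rmult_1_r.
  generalize (sin2_cos2 t). unfold Rsqr. intros E.
  replace (cos t * cos t + sin t * sin t) with 1 by lra. apply sqrt_1.
Qed.

Lemma cis_period t : cis (t + 2 * PI) = cis t.
Proof. unfold cis. rewrite cos_plus, sin_plus, cos_2PI, sin_2PI. f_equal; ring. Qed.

Lemma Cexp_cis (z : C) : Cexp z = (RtoC (exp (Re z)) * cis (Im z))%C.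
Proof. unfold Cexp, cis, RtoC, Cmult; simpl. f_equal; ring. Qed.

Lemma Cexp_add z w : Cexp (z + w) = (Cexp z * Cexp w)%C.
Proof.
  unfold Cexp, Cmult, Re, Im; simpl. rewrite exp_plus, cos_plus, sin_plus. f_equal; ring.
Qed.

Lemma Cexp_0 : Cexp 0 = 1.
Proof. unfold Cexp; simpl. rewrite exp_0, cos_0, sin_0. unfold RtoC. f_equal; ring. Qed.

Lemma Cmod_Cexp z : Cmod (Cexp z) = exp (Re z).
Proof.
  rewrite Cexp_cis, Cmod_mult, Cmod_cis, Cmod_Rabs_RtoC. ring.
  left; apply exp_pos.
Qed.

Lemma Cexp_nz z : Cexp z <> 0.
Proof. apply Cmod_pos_nz. rewrite Cmod_Cexp. apply exp_pos. Qed.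

Lemma im_le_Cmod (z : C) : Rabs (Im z) <= Cmod z.
Proof. eapply Rle_trans; [|apply Rmax_Cmod]. apply Rmax_r. Qed.

Lemma cder_Cexp_0 : cder Cexp 0 1.
Proof.
  intros eps He.
  assert (D := derivable_pt_lim_exp 0). rewrite exp_0 in D.
  destruct (deriv_eps _ _ _ D (eps / 3)) as [d1 [H1 E1]]; [lra|].
  assert (Hc := rder_cis 0). rewrite rder_iff in Hc.
  destruct (Hc (eps / 3)) as [d2 [H2 E2]]; [lra|].
  destruct (rder_ccont _ _ _ (rder_cis 0) (eps / 3)) as [d3 [H3 E3]]; [lra|].
  exists (Rmin d1 (Rmin d2 d3)); split; [repeat apply Rmin_pos; auto|].
  intros w _ Hw. rewrite Cexp_0.
  replace (w - 0)%C with w in * by ring.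
  assert (Hr := re_le_Cmod w). assert (Hi := im_le_Cmod w).
  assert (B1 := Rlt_le_trans _ _ _ Hw (Rmin_l _ _)).
  assert (B23 := Rlt_le_trans _ _ _ Hw (Rmin_r _ _)).
  assert (B2 := Rlt_le_trans _ _ _ B23 (Rmin_l _ _)).
  assert (B3 := Rlt_le_trans _ _ _ B23 (Rmin_r _ _)).
  specialize (E1 (Re w)). specialize (E2 (Im w)). specialize (E3 (Im w)).
  rewrite Rminus_0_r in *. rewrite exp_0 in E1.
  assert (C0 : cis 0 = 1) by (unfold cis; rewrite cos_0, sin_0; reflexivity).
  rewrite C0 in *.
  specialize (E1 ltac:(lra)). specialize (E2 ltac:(lra)). specialize (E3 ltac:(lra)).
  set (x := Re w) in *. set (y := Im w) in *.
  assert (Ew : w = (RtoC x + Ci * RtoC y)%C).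
  { destruct w as [a b]. unfold x, y, RtoC, Ci, Cplus, Cmult; simpl. f_equal; ring. }
  replace (eps * Cmod w) with ((eps / 3 * Cmod w + eps / 3 * Cmod w) + eps / 3 * Cmod w) by field.
  rewrite Cexp_cis. fold x. fold y.
  (* With w = x + iy: exp w - 1 - w = (e^x - 1 - x) cis y + (cis y - 1 - iy) + x (cis y - 1). *)
  eapply (Cmod_tri (RtoC (exp x - 1 - 1 * x) * cis y +
    (cis y - 1 - Ci * 1 * (RtoC y - 0))) (RtoC x * (cis y - 1))).
  - rewrite Ew at 1. rewrite !RtoC_minus, RtoC_mult. ring.
  - eapply Cmod_tri; [reflexivity| |].
    + rewrite Cmod_mult, Cmod_cis, Cmod_R, Rmult_1_r. eapply Rle_trans; [exact E1|].
      apply Rmult_le_compat_l; lra.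
    + eapply Rle_trans; [exact E2|]. apply Rmult_le_compat_l; lra.
  - rewrite Cmod_mult, Cmod_R, Rmult_comm. apply Rmult_le_compat; try lra.
    apply Cmod_ge_0. apply Rabs_pos.
Qed.

Lemma cder_Cexp z : cder Cexp z (Cexp z).
Proof.
  apply der_on_eq with (fun w => Cexp z * Cexp (w - z))%C (Cexp z * (1 * (1 - 0)))%C.
  - intros w. rewrite <- Cexp_add. f_equal. ring.
  - ring.
  - apply der_on_scal. apply (der_on_comp _ (fun _ => True) (fun w => w - z)%C Cexp); auto.
    + apply der_on_minus. apply der_on_id. apply der_on_const.
    + replace (z - z)%C with (RtoC 0) by ring. apply cder_Cexp_0.
Qed.

Lemma cos_eq_1_PI t : - PI <= t <= PI -> cos t = 1 -> t = 0.
Proof.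
  intros Ht Hc.
  assert (H : sin (t / 2) = 0).
  { replace t with (2 * (t / 2)) in Hc by field. rewrite cos_2a_sin in Hc. nra. }
  assert (HP := PI_RGT_0).
  destruct (Rtotal_order t 0) as [L|[E|G]]; auto.
  - assert (0 < sin (- (t / 2))) by (apply sin_gt_0; lra). rewrite sin_neg in *. lra.
  - assert (0 < sin (t / 2)) by (apply sin_gt_0; lra). lra.
Qed.

Lemma polar (z : C) : exists t, 0 <= t <= 2 * PI /\ z = (RtoC (Cmod z) * cis t)%C.
Proof.
  assert (HP := PI_RGT_0).
  destruct (Ceq_dec z 0) as [->|Hz].
  { exists 0. split. lra. rewrite Cmod_0. ring. }
  assert (Hm : 0 < Cmod z) by (apply Cmod_gt_0; auto).
  destruct z as [x y]. set (m := Cmod (x, y)) in *.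
  assert (Em : m ^ 2 = x ^ 2 + y ^ 2) by (unfold m; rewrite Cmod2_alt; reflexivity).
  assert (Hx : Rabs x <= m) by apply (re_le_Cmod (x, y)).
  apply Rabs_le_between in Hx.
  assert (Hb : -1 <= x / m <= 1).
  { split; apply Rmult_le_reg_r with m; auto; unfold Rdiv; rewrite Rmult_assoc, Rinv_l by lra; lra. }
  assert (Hs : sqrt (1 - (x / m)²) = Rabs y / m).
  { apply Rsqr_inj. apply sqrt_pos. apply Rdiv_le_0_compat; [apply Rabs_pos|lra].
    rewrite Rsqr_sqrt.
    - unfold Rdiv at 2. rewrite Rsqr_mult, <- Rsqr_abs, Rsqr_inv'. unfold Rsqr.
      replace (y * y) with (m * m - x * x) by (simpl in Em; lra). field. lra.
    - unfold Rsqr. nra. }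
  assert (A := acos_bound (x / m)).
  destruct (Rle_lt_dec 0 y) as [Hy|Hy].
  - exists (acos (x / m)). split. lra. unfold cis. rewrite cos_acos, sin_acos, Hs by auto.
    rewrite Rabs_pos_eq by auto. unfold RtoC, Cmult; simpl. f_equal; field; lra.
  - exists (2 * PI - acos (x / m)). split. lra. unfold cis.
    rewrite cos_minus, sin_minus, cos_2PI, sin_2PI, cos_acos, sin_acos, Hs by auto.
    rewrite Rabs_left by auto. unfold RtoC, Cmult; simpl. f_equal; field; lra.
Qed.

Lemma CInt_shift F c a b : a <= b -> (forall x, ccont F x) ->
  CInt (fun x => F (x + c)) a b = CInt F (a + c) (b + c).
Proof.
  intros Hab HF.
  assert (K : forall f : R -> R, ex_RInt f (a + c) (b + c) ->
    RInt (fun x => f (x + c)) a b = RInt f (a + c) (b + c)).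
  { intros f Hf.
    assert (E := RInt_comp_lin (V := R_CompleteNormedModule) f 1 c a b).
    rewrite !Rmult_1_l in E. rewrite <- (E Hf). apply RInt_ext. intros x _.
    unfold scal; simpl. unfold mult; simpl. rewrite !Rmult_1_l. reflexivity. }
  unfold CInt. f_equal.
  apply (K (fun x => fst (F x))). apply cont_int_ex1. lra. intros x _. apply HF.
  apply (K (fun x => snd (F x))). apply cont_int_ex2. lra. intros x _. apply HF.
Qed.

Lemma CInt_period F t : 0 <= t -> (forall x, ccont F x) ->
  (forall x, F (x + 2 * PI) = F x) ->
  CInt F (t - PI) (t + PI) = CInt F (- PI) PI.
Proof.
  intros Ht HF HP. assert (HPI := PI_RGT_0).
  assert (HC : forall a b, cont_int F a b) by (intros a b x _; apply HF).
  assert (E1 := CInt_Chasles F (- PI) (t - PI) (t + PI) ltac:(lra) ltac:(lra) (HC _ _)).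
  assert (E2 := CInt_Chasles F (- PI) PI (t + PI) ltac:(lra) ltac:(lra) (HC _ _)).
  assert (E3 : CInt F PI (t + PI) = CInt F (- PI) (t - PI)).
  { replace PI with (- PI + 2 * PI) at 1 by ring.
    replace (t + PI) with (t - PI + 2 * PI) by ring.
    rewrite <- CInt_shift by (auto; lra). apply CInt_ext. lra. intros; apply HP. }
  rewrite E3 in E2. rewrite <- E2 in E1.
  replace (CInt F (t - PI) (t + PI)) with
    (CInt F (- PI) (t - PI) + CInt F (t - PI) (t + PI) - CInt F (- PI) (t - PI))%C by ring.
  rewrite E1. ring.
Qed.

Lemma rder_circ r t : rder (fun t => RtoC r * cis t)%C t (RtoC r * (Ci * cis t))%C.
Proof. apply der_on_scal. apply rder_cis. Qed.

Lemma Cmod_circ r t : 0 <= r -> Cmod (RtoC r * cis t) = r.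
Proof. intros Hr. rewrite Cmod_mult, Cmod_cis, Cmod_Rabs_RtoC by auto. ring. Qed.

Lemma circ_cont G r : 0 <= r -> (forall z, Cmod z = r -> exists d, cder G z d) ->
  forall t, ccont (fun t => G (RtoC r * cis t)%C) t.
Proof.
  intros Hr H t. destruct (H (RtoC r * cis t)%C) as [d Hd]. apply Cmod_circ; auto.
  eapply ccont_comp; eauto. eapply rder_ccont. apply rder_circ.
Qed.

(** Integration is against dt = dz/(iz), so this is 2 pi times the mean over the circle. Up to a
    shift of the angle, a vertical side of a rectangle in s = log z gives exactly this integral. *)
Definition circ_int (G : C -> C) (r : R) : C := CInt (fun t => G (RtoC r * cis t)%C) (- PI) PI.

(* In the variable s = log z an annulus becomes a rectangle of height 2 pi, whose
   horizontal sides carry equal integrals by periodicity. *)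
Lemma circ_int_indep h r1 r2 z0 M del : 0 < r1 -> r1 < Cmod z0 < r2 -> 0 < del ->
  (forall z, r1 <= Cmod z <= r2 -> z <> z0 -> exists d, cder h z d) ->
  (forall z, Cmod (z - z0) < del -> Cmod (h z) <= M) ->
  circ_int h r1 = circ_int h r2.
Proof.
  intros Hr1 Hz0 Hdel Hh HM.
  destruct (polar z0) as [t0 [Ht0 Ez0]].
  assert (HPI := PI_RGT_0).
  set (m := Cmod z0) in *.
  set (g := fun s => h (Cexp s)).
  assert (Eexp : forall r t, 0 < r -> Cexp (ln r, t) = (RtoC r * cis t)%C).
  { intros r t Hr. rewrite Cexp_cis. simpl. rewrite exp_ln; auto. }
  (* The angular window is centred at t0, so that z0 has a single preimage under exp in the
     rectangle, and an interior one. *)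
  assert (Hne : forall x y, t0 - PI <= y <= t0 + PI -> ((x, y) : C) <> (ln m, t0) -> Cexp (x, y) <> z0).
  { intros x y Hy Hne E. apply Hne.
    assert (Ex : exp x = m).
    { assert (E' := Cmod_Cexp (x, y)). rewrite E in E'. symmetry. exact E'. }
    assert (x = ln m) by (rewrite <- Ex, ln_exp; auto). subst x. f_equal.
    rewrite Eexp, Ez0 in E by lra.
    assert (Ec : cis y = cis t0).
    { assert (Hm0 : RtoC m <> 0) by (intros E'; apply RtoC_inj in E'; lra).
      replace (cis y) with (/ RtoC m * (RtoC m * cis y))%C by (field; auto).
      rewrite E. field; auto. }
    unfold cis in Ec. injection Ec as E1 E2.
    assert (y - t0 = 0); [|lra]. apply cos_eq_1_PI. lra.
    rewrite cos_minus, E1, E2. generalize (sin2_cos2 t0). unfold Rsqr. lra. }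
  assert (Hper : forall r, 0 <= r -> (forall z, Cmod z = r -> exists d, cder h z d) ->
    CInt (fun t => h (RtoC r * cis t)%C) (t0 - PI) (t0 + PI) = circ_int h r).
  { intros r Hr Hd. apply CInt_period. lra. apply circ_cont; auto.
    intros x. rewrite cis_period. reflexivity. }
  rewrite <- !Hper; try lra.
  2,3: intros z Hz; apply Hh; [lra|intros ->; fold m in Hz; lra].
  assert (Hrect : rect_int g (ln r1) (ln r2) (t0 - PI) (t0 + PI) = 0).
  { destruct (der_on_cont _ _ _ _ (cder_Cexp (ln m, t0)) del Hdel) as [rho [Hrho Hc]].
    apply (goursat_except g _ _ _ _ (ln m) t0 M rho); auto.
    - split; apply ln_increasing; lra.
    - lra.
    - intros x y Hx Hy Hxy. destruct (Hh (Cexp (x, y))) as [d Hd].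
      + rewrite Cmod_Cexp. simpl.
        rewrite <- (exp_ln r1), <- (exp_ln r2) by lra.
        split; [destruct (proj1 Hx)|destruct (proj2 Hx)]; try (left; apply exp_increasing; lra);
        right; congruence.
      + apply Hne; auto.
      + exists (d * Cexp (x, y))%C. apply (der_on_comp _ (fun _ => True) Cexp h); auto.
        apply cder_Cexp.
    - intros z Hz. apply HM. specialize (Hc z I Hz). rewrite Eexp in Hc by lra.
      rewrite Ez0. exact Hc. }
  unfold rect_int in Hrect.
  replace (CInt (fun x => g (hseg (t0 + PI) x)) (ln r1) (ln r2)) with
    (CInt (fun x => g (hseg (t0 - PI) x)) (ln r1) (ln r2)) in Hrect.
  2: { f_equal. apply functional_extensionality. intros x. unfold g, hseg.
    rewrite !Cexp_cis; simpl. do 2 f_equal.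
    replace (t0 + PI) with (t0 - PI + 2 * PI) by ring. rewrite cis_period. reflexivity. }
  assert (Ev : forall r, 0 < r -> CInt (fun y => g (vseg (ln r) y)) (t0 - PI) (t0 + PI) =
     CInt (fun t => h (RtoC r * cis t)%C) (t0 - PI) (t0 + PI)).
  { intros r Hr. apply CInt_ext. lra. intros x _. unfold g, vseg. rewrite Eexp; auto. }
  rewrite !Ev in Hrect by lra.
  set (I1 := CInt _ _ _) in Hrect.
  set (V2 := CInt (fun t => h (RtoC r2 * cis t)%C) _ _) in *.
  set (V1 := CInt (fun t => h (RtoC r1 * cis t)%C) _ _) in *.
  replace V1 with (V2 + Ci * (I1 + Ci * V2 - I1 - Ci * V1))%C.
  rewrite Hrect. ring.
  replace (V2 + Ci * (I1 + Ci * V2 - I1 - Ci * V1))%C with (V2 + (Ci * Ci) * V2 - (Ci * Ci) * V1)%C by ring.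
  replace (Ci * Ci)%C with (-(1))%C. ring.
  unfold Ci, Cmult, Copp, RtoC; simpl. f_equal; ring.
Qed.

(** * Cauchy's formula and power series *)

(** The upper bound is excluded, unlike in [sum_n], so that the Taylor polynomial of order 0 is the
    empty sum. *)
Fixpoint csum (u : nat -> C) (n : nat) : C :=
  match n with O => RtoC 0 | S m => (csum u m + u m)%C end.

Lemma csum_ext u v n : (forall k, (k < n)%nat -> u k = v k) -> csum u n = csum v n.
Proof.
  induction n as [|n IH]; intros H; simpl; auto. rewrite IH, H; auto.
Qed.

Lemma csum_scal c u n : csum (fun k => c * u k)%C n = (c * csum u n)%C.
Proof. induction n as [|n IH]; simpl; [ring|]. rewrite IH. ring. Qed.

Lemma csum_plus u v n : csum (fun k => u k + v k)%C n = (csum u n + csum v n)%C.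
Proof. induction n as [|n IH]; simpl; [ring|]. rewrite IH. ring. Qed.

Lemma csum_minus u v n : csum (fun k => u k - v k)%C n = (csum u n - csum v n)%C.
Proof. induction n as [|n IH]; simpl; [ring|]. rewrite IH. ring. Qed.

Lemma csum_0 (u : nat -> C) n : (forall k, (k < n)%nat -> u k = 0) -> csum u n = 0.
Proof.
  intros H; induction n as [|n IH]; simpl; auto. rewrite IH, H by auto. ring.
Qed.

Lemma csum_shift u n : csum u (S n) = (u O + csum (fun k => u (S k)) n)%C.
Proof.
  induction n as [|n IH]. simpl; ring.
  change (csum u (S (S n))) with (csum u (S n) + u (S n))%C. rewrite IH. simpl. ring.
Qed.

Lemma csum_single (u : nat -> C) n i : (i < n)%nat -> (forall k, (k < n)%nat -> k <> i -> u k = 0) ->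
  csum u n = u i.
Proof.
  intros Hi H. induction n as [|n IH]. lia. simpl.
  destruct (Nat.eq_dec i n) as [->|E].
  - rewrite csum_0. ring. intros k Hk. apply H; lia.
  - rewrite IH, (H n) by (auto; lia). ring.
Qed.

Lemma csum_comm u n m : csum (fun i => csum (fun j => u i j) m) n = csum (fun j => csum (fun i => u i j) n) m.
Proof.
  induction n as [|n IH]; simpl. symmetry; apply csum_0; auto.
  rewrite IH, <- csum_plus. reflexivity.
Qed.

Lemma csum_bound u n B : (forall k, (k < n)%nat -> Cmod (u k) <= B) -> Cmod (csum u n) <= INR n * B.
Proof.
  intros H; induction n as [|n IH]. simpl. rewrite Cmod_0. lra.
  rewrite S_INR, Rmult_plus_distr_r, Rmult_1_l. eapply Cmod_tri; [reflexivity|auto|auto].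
Qed.

Lemma csum_geom_bound u n m A q : 0 <= A -> 0 <= q < 1 ->
  (forall k, Cmod (u k) <= A * q ^ k) -> (n <= m)%nat ->
  Cmod (csum u m - csum u n) <= A * q ^ n / (1 - q).
Proof.
  intros HA Hq Hu Hnm.
  assert (H : Cmod (csum u m - csum u n) <= A * (q ^ n - q ^ m) / (1 - q)).
  { induction Hnm as [|m Hnm IH].
    - replace (csum u n - csum u n)%C with (RtoC 0) by ring. rewrite Cmod_0.
      right. field. lra.
    - replace (A * (q ^ n - q ^ S m) / (1 - q)) with (A * (q ^ n - q ^ m) / (1 - q) + A * q ^ m)
        by (simpl; field; lra).
      eapply Cmod_tri; [|exact IH|apply Hu]. simpl. ring. }
  apply Rle_trans with (1 := H). apply Rmult_le_compat_r.
  left; apply Rinv_0_lt_compat; lra. apply Rmult_le_compat_l; auto.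
  assert (0 <= q ^ m) by (apply pow_le; lra). lra.
Qed.

Lemma Cminus_eq_0 (a b : C) : (a - b)%C = 0 -> a = b.
Proof. intros H. replace a with (a - b + b)%C by ring. rewrite H. ring. Qed.

Lemma Ceq_le_eps (a b : C) : (forall e, 0 < e -> Cmod (a - b) <= e) -> a = b.
Proof.
  intros H. apply Cminus_eq_0, Cmod_eq_0, Rle_antisym; [|apply Cmod_ge_0].
  apply le_of_le_eps. intros e He. rewrite Rplus_0_l. auto.
Qed.

Definition holo_ball (R0 : R) (f : C -> C) : Prop :=
  forall z, Cmod z < R0 -> exists d, cder f z d.

Lemma circ_int_bound G r M : 0 <= r -> (forall z, Cmod z = r -> exists d, cder G z d) ->
  (forall z, Cmod z = r -> Cmod (G z) <= M) -> Cmod (circ_int G r) <= 2 * M * (2 * PI).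
Proof.
  intros Hr HG HM. assert (HP := PI_RGT_0).
  replace (2 * PI) with (PI - - PI) by ring. apply CInt_bound. lra.
  intros x _. apply circ_cont; auto.
  intros x _. apply HM. apply Cmod_circ; auto.
Qed.

Lemma circ_int_ext G H r : 0 <= r -> (forall z, Cmod z = r -> G z = H z) ->
  circ_int G r = circ_int H r.
Proof.
  intros Hr E. assert (HP := PI_RGT_0). apply CInt_ext. lra.
  intros t _. apply E, Cmod_circ, Hr.
Qed.

Lemma circ_int_plus G H r : 0 <= r -> (forall z, Cmod z = r -> exists d, cder G z d) ->
  (forall z, Cmod z = r -> exists d, cder H z d) ->
  circ_int (fun z => G z + H z)%C r = (circ_int G r + circ_int H r)%C.
Proof.
  intros Hr HG HH. assert (HP := PI_RGT_0).
  apply CInt_plus; [lra| |]; intros t _; [apply (circ_cont G)|apply (circ_cont H)]; auto.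
Qed.

Lemma circ_int_scal c G r : 0 <= r -> (forall z, Cmod z = r -> exists d, cder G z d) ->
  circ_int (fun z => c * G z)%C r = (c * circ_int G r)%C.
Proof.
  intros Hr HG. assert (HP := PI_RGT_0).
  apply CInt_scal; [lra|]. intros t _. apply (circ_cont G); auto.
Qed.

(** In the angle, z^(-k) has the primitive - z^(-k) / (k i), which is periodic. *)
Lemma circ_int_pow r k : 0 < r -> (0 < k)%nat -> circ_int (fun z => / z ^ k)%C r = 0.
Proof.
  intros Hr Hk. assert (HP := PI_RGT_0).
  assert (Hnz : forall t, (RtoC r * cis t)%C <> 0).
  { intros t. apply Cmod_pos_nz. rewrite Cmod_circ; lra. }
  assert (HK : RtoC (INR k) <> 0).
  { intros E. apply RtoC_inj in E. apply (not_0_INR k); auto. lia. }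
  assert (HCi : Ci <> 0) by (apply Cmod_pos_nz; rewrite Cmod_Ci; lra).
  unfold circ_int.
  rewrite (CInt_FTC (fun t => (- / (RtoC (INR k) * Ci)) * / (RtoC r * cis t) ^ k)%C).
  - replace (cis PI) with (cis (- PI)). ring.
    rewrite <- (cis_period (- PI)). f_equal. ring.
  - lra.
  - intros x _.
    assert (H : rder (fun t => (RtoC r * cis t)%C) x (RtoC r * (Ci * cis x))%C) by apply rder_circ.
    apply (der_on_pow _ _ _ _ k) in H. apply der_on_inv in H; [|apply Cpow_nz, Hnz].
    eapply der_on_eq; [| |apply der_on_scal; exact H]. reflexivity.
    simpl Re. destruct k as [|k]. lia. rewrite Nat.sub_succ, Nat.sub_0_r.
    rewrite Cpow_S. assert (Hp := Cpow_nz _ k (Hnz x)). set (w := (RtoC r * cis x)%C) in *.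
    replace (RtoC r * (Ci * cis x))%C with (Ci * w)%C by (unfold w; ring).
    set (q := (w ^ k)%C) in *. assert (Hw := Hnz x). fold w in Hw.
    field. repeat split; auto.
  - intros x _. apply (circ_cont (fun z => / z ^ k)%C); [lra|].
    intros z Hz. eexists. apply der_on_inv.
    apply Cpow_nz, Cmod_pos_nz; lra. apply der_on_pow, der_on_id.
Qed.

Lemma holo_ball_nbhd R0 f : 0 < R0 -> holo_ball R0 f ->
  exists del, 0 < del /\ forall z, Cmod z < del -> Cmod (f z) <= Cmod (f 0) + 1.
Proof.
  intros HR Hf. destruct (Hf 0) as [d Hd]. rewrite Cmod_0; auto.
  destruct (der_on_cont _ _ _ _ Hd 1) as [del [H1 H2]]; [lra|].
  exists del; split; auto. intros z Hz.
  specialize (H2 z I). replace (z - 0)%C with z in H2 by ring. specialize (H2 Hz).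
  generalize (Cmod_sub_ge (f z) (f 0)). lra.
Qed.

(* The function z (f z - f w)/(z - w) is bounded at z = w and vanishes at 0, so
   its circular means, which do not depend on the radius, are 0. *)
Lemma cauchy_kernel f R0 r w : holo_ball R0 f -> 0 < Cmod w < r -> r < R0 ->
  circ_int (fun z => z * (f z - f w) / (z - w))%C r = 0.
Proof.
  intros Hf Hw Hr.
  set (h := fun z => (z * (f z - f w) / (z - w))%C).
  set (m := Cmod w) in *.
  assert (Hd : forall z, Cmod z < R0 -> z <> w -> exists d, cder h z d).
  { intros z Hz Hzw. destruct (Hf z Hz) as [d Hd]. eexists.
    apply der_on_div. apply Cminus_eq_contra; auto.
    apply der_on_mult. apply der_on_id. apply der_on_minus. exact Hd. apply der_on_const.
    apply der_on_minus. apply der_on_id. apply der_on_const. }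
  destruct (Hf w) as [d Hdw]. fold m; lra.
  destruct (der_on_lip _ _ _ _ Hdw) as [rho [Hrho Hlip]].
  assert (Hdm := Cmod_ge_0 d).
  set (M := (m + rho) * (Cmod d + 1)).
  assert (HM : forall z, Cmod (z - w) < rho -> Cmod (h z) <= M).
  { intros z Hz. unfold h.
    destruct (Ceq_dec z w) as [->|E].
    - replace (f w - f w)%C with (RtoC 0) by ring.
      replace (w * 0 / (w - w))%C with (RtoC 0) by (unfold Cdiv; ring).
      rewrite Cmod_0. unfold M. apply Rmult_le_pos; lra.
    - assert (Hp : (z - w)%C <> 0) by (apply Cminus_eq_contra; auto).
      rewrite Cmod_div, Cmod_mult by auto. specialize (Hlip z I Hz).
      apply Cmod_gt_0 in Hp.
      assert (Hzm : Cmod z <= m + rho).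
      { generalize (Cmod_sub_ge z w). unfold m. lra. }
      apply Rle_div_l; [exact Hp|].
      unfold M. rewrite Rmult_assoc. apply Rmult_le_compat; auto using Cmod_ge_0. }
  destruct (holo_ball_nbhd R0 f ltac:(lra) Hf) as [del [Hdel Hsm]].
  assert (HB : 0 <= Cmod (f 0) + 1 + Cmod (f w)).
  { generalize (Cmod_ge_0 (f 0)) (Cmod_ge_0 (f w)). lra. }
  set (B := Cmod (f 0) + 1 + Cmod (f w)) in *.
  assert (key : forall s, 0 < s -> s < del -> s <= m / 2 ->
    Cmod (circ_int h r) <= 2 * (s * (2 * B / m)) * (2 * PI)).
  { intros s Hs Hsd Hsm2. rewrite <- (circ_int_indep h s r w M rho); auto; try (fold m; lra).
    2: { intros z Hz. apply Hd. lra. }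
    apply circ_int_bound. lra.
    - intros z Hz. apply Hd. lra. intros ->. fold m in Hz. lra.
    - intros z Hz. unfold h.
      assert (Hzw : m / 2 <= Cmod (z - w)).
      { rewrite Cmod_sub_sym. generalize (Cmod_sub_ge w z). fold m. lra. }
      rewrite Cmod_div, Cmod_mult, Hz by (apply Cmod_pos_nz; lra).
      unfold Rdiv at 1. rewrite Rmult_assoc. apply Rmult_le_compat_l. lra.
      replace (2 * B / m) with (B * / (m / 2)) by (field; lra).
      apply Rmult_le_compat. apply Cmod_ge_0. left; apply Rinv_0_lt_compat; lra.
      generalize (Cmod_sub_le (f z) (f w)) (Hsm z ltac:(lra)). unfold B. lra.
      apply Rinv_le_contravar; lra. }
  apply Cmod_eq_0. apply Rle_antisym; [|apply Cmod_ge_0].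
  apply le_of_le_eps. intros e He. assert (HP := PI_RGT_0).
  destruct (small_mult (2 * (2 * B / m) * (2 * PI)) e) as [e1 [He1 Hsm1]]; auto.
  { apply Rmult_le_pos; [|lra]. apply Rmult_le_pos; [lra|]. apply Rdiv_le_0_compat; lra. }
  destruct (small3 e1 (del / 2) (m / 2)) as [s [Hs B3]]; try lra.
  specialize (key s Hs ltac:(lra) ltac:(lra)). specialize (Hsm1 s ltac:(lra)). lra.
Qed.

Lemma circ_bound_pos f r M : 0 <= r -> (forall z, Cmod z = r -> Cmod (f z) <= M) -> 0 <= M.
Proof.
  intros Hr HM. eapply Rle_trans; [apply Cmod_ge_0|].
  apply (HM (RtoC r)). apply Cmod_Rabs_RtoC; auto.
Qed.

Lemma geom_ratio_le_2 x r : 0 < r -> x <= r / 2 -> r / (r - x) <= 2.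
Proof. intros Hr Hx. apply Rle_div_l; lra. Qed.

(** The usual contour integral of f(z) z^(-k-1) / (2 pi i), written with dz = i z dt. *)
Definition cauchy_coef (f : C -> C) (r : R) (k : nat) : C :=
  (circ_int (fun z => f z / z ^ k) r / RtoC (2 * PI))%C.

(** The Cauchy kernel z/(z - w) is expanded as a finite geometric sum plus a remainder. The explicit
    constant lets the same theorem yield Taylor jets, derivative bounds and bounds on smaller
    discs. *)
Theorem cauchy_series f R0 r M : holo_ball R0 f -> 0 < r < R0 ->
  (forall z, Cmod z = r -> Cmod (f z) <= M) ->
  (forall k, Cmod (cauchy_coef f r k) <= 2 * M / r ^ k) /\
  (forall z, Cmod z < r -> forall n,
     Cmod (f z - csum (fun k => cauchy_coef f r k * z ^ k)%C n)
       <= 2 * M * (Cmod z / r) ^ n * (r / (r - Cmod z))).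
Proof.
  intros Hf Hr HM. assert (HP := PI_RGT_0).
  set (c := cauchy_coef f r).
  assert (HP2 : RtoC (2 * PI) <> 0) by (intros E; apply RtoC_inj in E; lra).
  assert (HM0 : 0 <= M) by (apply (circ_bound_pos _ r _ ltac:(lra) HM)).
  assert (Hnz : forall z, Cmod z = r -> z <> 0) by (intros z Hz; apply Cmod_pos_nz; lra).
  assert (Hfk : forall k z, Cmod z = r -> exists d, cder (fun z => f z / z ^ k)%C z d).
  { intros k z Hz. destruct (Hf z) as [d Hd]. lra. eexists. apply der_on_div.
    apply Cpow_nz; auto. exact Hd. apply der_on_pow, der_on_id. }
  assert (Hck : forall k, Cmod (c k) <= 2 * M / r ^ k).
  { intros k. unfold c, cauchy_coef. rewrite Cmod_div by auto. rewrite (Cmod_Rabs_RtoC (2 * PI)) by lra.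
    assert (Hrk : 0 < r ^ k) by (apply pow_lt; lra).
    assert (B := circ_int_bound (fun z => f z / z ^ k)%C r (M / r ^ k) ltac:(lra) (Hfk k)).
    apply Rmult_le_reg_r with (2 * PI). lra.
    unfold Rdiv at 1. rewrite Rmult_assoc, Rinv_l, Rmult_1_r by lra.
    replace (2 * M / r ^ k * (2 * PI)) with (2 * (M / r ^ k) * (2 * PI)) by (field; lra).
    apply B. intros z Hz. rewrite Cmod_div, Cmod_pow, Hz by (apply Cpow_nz; auto).
    apply Rmult_le_compat_r; auto. left; apply Rinv_0_lt_compat; auto. }
  split; auto.
  assert (Hgeo : forall z, Cmod z < r -> forall n m, (n <= m)%nat ->
    Cmod (csum (fun k => c k * z ^ k)%C m - csum (fun k => c k * z ^ k)%C n)
      <= 2 * M * (Cmod z / r) ^ n * (r / (r - Cmod z))).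
  { intros z Hz n m Hnm. assert (Hz0 := Cmod_ge_0 z).
    replace (2 * M * (Cmod z / r) ^ n * (r / (r - Cmod z)))
      with (2 * M * (Cmod z / r) ^ n / (1 - Cmod z / r)) by (field; lra).
    apply csum_geom_bound; auto. lra.
    apply Rdiv_small_1; lra.
    intros k. rewrite Cmod_mult, Cmod_pow. unfold Rdiv at 1. rewrite Rpow_mult_distr, pow_inv.
    replace (2 * M * (Cmod z ^ k * / r ^ k)) with (2 * M / r ^ k * Cmod z ^ k) by (unfold Rdiv; ring).
    apply Rmult_le_compat_r; auto. apply pow_le; auto. }
  assert (Hconv : forall z, 0 < Cmod z < r -> exists B, forall n,
     Cmod (f z - csum (fun k => c k * z ^ k)%C (S n)) <= B * (Cmod z / r) ^ S n).
  { intros w Hw. set (m := Cmod w) in *.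
    exists (2 * ((M + Cmod (f w)) * (r / (r - m)))). intros n.
    assert (Hr0 : 0 <= r) by lra.
    assert (Hzw : forall z, Cmod z = r -> (z - w)%C <> 0).
    { intros z Hz. apply Cminus_eq_contra. intros ->. fold m in Hz. lra. }
    (* The kernel after [k] geometric steps, multiplied by f z - f w rather than f z: for k = 0 its
       integral vanishes by [cauchy_kernel]. *)
    set (Rem := fun k z => (w ^ k * / z ^ k * (z / (z - w)) * (f z - f w))%C).
    assert (HI : forall k z, Cmod z = r -> exists d, cder (fun z => / z ^ k)%C z d).
    { intros k z Hz. eexists. apply der_on_inv. apply Cpow_nz; auto. apply der_on_pow, der_on_id. }
    assert (HR : forall k z, Cmod z = r -> exists d, cder (Rem k) z d).
    { intros k z Hz. destruct (Hf z) as [d Hd]. lra. destruct (HI k z Hz) as [e He]. eexists.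
      apply der_on_mult; [|apply der_on_minus; [exact Hd|apply der_on_const]]. apply der_on_mult.
      apply der_on_scal. exact He. apply der_on_div; auto. apply der_on_id.
      apply der_on_minus. apply der_on_id. apply der_on_const. }
    (* One step uses w^k z^(-k) z/(z - w) = w^k z^(-k) + w^(k+1) z^(-k-1) z/(z - w). The means of
       z^(-k) vanish for k > 0, so f w enters at the step k = 0 only; hence the [match]. *)
    assert (HRem : forall k, circ_int (Rem k) r =
      (RtoC (2 * PI) * ((match k with O => 0 | S _ => f w end) - csum (fun k => c k * w ^ k) k))%C).
    { induction k as [|k IH].
      - transitivity (circ_int (fun z => z * (f z - f w) / (z - w))%C r).
        apply circ_int_ext; auto. intros z Hz. unfold Rem. simpl. field. auto.
        rewrite (cauchy_kernel f R0 r w Hf Hw (proj2 Hr)). simpl. ring.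
      - assert (E : circ_int (Rem k) r = (w ^ k * (circ_int (fun z => f z / z ^ k) r
            + - f w * circ_int (fun z => / z ^ k) r) + circ_int (Rem (S k)) r)%C).
        { rewrite <- circ_int_scal, <- circ_int_plus, <- circ_int_scal, <- circ_int_plus; auto.
          - apply circ_int_ext; auto. intros z Hz. unfold Rem. simpl.
            assert (Hp := Cpow_nz z k (Hnz z Hz)). specialize (Hzw z Hz). specialize (Hnz z Hz).
            field. auto.
          - intros z Hz. destruct (Hfk k z Hz) as [d Hd]. destruct (HI k z Hz) as [e He]. eexists.
            apply der_on_scal, der_on_plus; [exact Hd|apply der_on_scal; exact He].
          - intros z Hz. destruct (Hfk k z Hz) as [d Hd]. destruct (HI k z Hz) as [e He]. eexists.
            apply der_on_plus; [exact Hd|apply der_on_scal; exact He].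
          - intros z Hz. destruct (HI k z Hz) as [e He]. eexists. apply der_on_scal; exact He. }
        assert (Ec : circ_int (fun z => f z / z ^ k)%C r = (RtoC (2 * PI) * c k)%C).
        { unfold c, cauchy_coef. field. auto. }
        rewrite IH, Ec in E. simpl csum.
        replace (circ_int (Rem (S k)) r) with (w ^ k * (RtoC (2 * PI) * c k + - f w * circ_int (fun z => (/ z ^ k)%C) r)
          + circ_int (Rem (S k)) r - w ^ k * (RtoC (2 * PI) * c k + - f w * circ_int (fun z => (/ z ^ k)%C) r))%C by ring.
        rewrite <- E. destruct k as [|k].
        + replace (circ_int (fun z => / z ^ 0)%C r) with (RtoC (2 * PI)). simpl. ring.
          unfold circ_int. rewrite (CInt_FTC (fun t => RtoC t)).
          rewrite <- RtoC_minus. f_equal. ring. lra.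
          intros x _. simpl. replace (/ 1)%C with (RtoC 1).
          apply (rder_hseg 0 x). field.
          intros x _. apply (circ_cont (fun z => / z ^ 0)%C); auto.
        + rewrite circ_int_pow by (lra || lia). ring. }
    assert (HB : Cmod (circ_int (Rem (S n)) r) <= 2 * ((m / r) ^ S n * (r / (r - m)) * (M + Cmod (f w))) * (2 * PI)).
    { apply circ_int_bound; auto. intros z Hz. unfold Rem.
      rewrite !Cmod_mult, Cmod_inv, !Cmod_pow, Cmod_div, Hz by (auto; apply Cpow_nz; auto).
      fold m. assert (0 < r ^ S n) by (apply pow_lt; lra).
      unfold Rdiv at 2. rewrite Rpow_mult_distr, pow_inv.
      assert (0 <= m ^ S n * / r ^ S n).
      { apply Rmult_le_pos. apply pow_le; lra. left; apply Rinv_0_lt_compat; auto. }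
      assert (Hzwm : r - m <= Cmod (z - w)) by (generalize (Cmod_sub_ge z w); rewrite Hz; auto).
      apply Rmult_le_compat; auto using Cmod_ge_0.
      - apply Rmult_le_pos; auto. apply Rdiv_le_0_compat; lra.
      - apply Rmult_le_compat_l; auto. apply Rmult_le_compat_l; auto.
        apply Rinv_le_contravar; lra.
      - generalize (Cmod_sub_le (f z) (f w)) (HM z Hz). lra. }
    replace (f w - csum (fun k => c k * w ^ k) (S n))%C with (circ_int (Rem (S n)) r / RtoC (2 * PI))%C
      by (rewrite HRem; field; auto).
    rewrite Cmod_div, (Cmod_Rabs_RtoC (2 * PI)) by (auto; lra).
    apply Rle_div_l; lra. }
  (* The constant in [Hconv] involves f z; it serves only to let the last index tend to infinity in
     [Hgeo], whose bound has the stated form. *)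
  assert (Hpos : forall z, 0 < Cmod z < r -> forall n,
     Cmod (f z - csum (fun k => c k * z ^ k)%C n) <= 2 * M * (Cmod z / r) ^ n * (r / (r - Cmod z))).
  { intros z Hz n. apply le_of_le_eps. intros e He.
    destruct (Hconv z Hz) as [B HB].
    destruct (small_mult (Rabs B) e (Rabs_pos B) He) as [d [Hd Hsm]].
    assert (Hq := Rdiv_small_1 _ _ (Rlt_le _ _ (proj1 Hz)) (proj2 Hz)).
    destruct (pow_small _ d Hq Hd) as [N HN]. set (m := S (n + N)).
    specialize (HN m ltac:(unfold m; lia)).
    assert (Hqm : 0 <= (Cmod z / r) ^ m) by (apply pow_le; lra).
    rewrite Rplus_comm.
    eapply (Cmod_tri (f z - csum (fun k => (c k * z ^ k)%C) m) (csum (fun k => (c k * z ^ k)%C) m - csum (fun k => (c k * z ^ k)%C) n)).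
    ring. 2: apply Hgeo; [lra|unfold m; lia].
    eapply Rle_trans; [apply HB|]. fold m. specialize (Hsm ((Cmod z / r) ^ m) ltac:(lra)).
    assert (B * (Cmod z / r) ^ m <= Rabs B * (Cmod z / r) ^ m); [|lra].
    apply Rmult_le_compat_r; auto. apply Rle_abs. }
  intros z Hz n. destruct (Ceq_dec z 0) as [->|Hz0].
  2: { apply Hpos. split; auto. apply Cmod_gt_0; auto. }
  (* The kernel argument excludes z = 0; there the value follows from the continuity of f. *)
  assert (E0 : f 0 = c O).
  { apply Ceq_le_eps. intros e He.
    destruct (Hf 0) as [d Hd]. rewrite Cmod_0; lra.
    destruct (der_on_cont _ _ _ _ Hd (e / 2)) as [del [Hdel Hc]]; [lra|].
    destruct (small_mult (2 * M) (e * r / 4)) as [d1 [Hd1 Hsm]]; [lra|apply Rdiv_lt_0_compat; [apply Rmult_lt_0_compat|]; lra|].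
    destruct (small3 d1 (del / 2) (r / 2)) as [s [Hs B3]]; try lra.
    specialize (Hsm s ltac:(lra)).
    assert (Ems : Cmod (RtoC s) = s) by (apply Cmod_Rabs_RtoC; lra).
    specialize (Hc (RtoC s) I). replace (RtoC s - 0)%C with (RtoC s) in Hc by ring.
    specialize (Hc ltac:(lra)).
    assert (Hp := Hpos (RtoC s) ltac:(lra) 1%nat). rewrite Ems in Hp. simpl in Hp.
    replace (0 + c O * 1)%C with (c O) in Hp by ring.
    replace e with (e / 2 + e / 2) by field.
    eapply (Cmod_tri (f 0 - f (RtoC s)) (f (RtoC s) - c O)). ring.
    rewrite Cmod_sub_sym. lra.
    eapply Rle_trans; [exact Hp|].
    replace (2 * M * (s / r * 1) * (r / (r - s))) with (2 * M * s / (r - s)) by (field; lra).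
    apply Rle_div_l; [lra|]. nra. }
  rewrite Cmod_0. destruct n as [|n].
  - simpl. replace (f 0 - 0)%C with (f 0) by ring. rewrite E0.
    eapply Rle_trans; [apply (Hck O)|]. simpl. right. field. lra.
  - rewrite csum_shift. rewrite csum_0 with (n := n). 2: intros; simpl; ring.
    rewrite E0. replace (c O - (c O * 0 ^ 0 + 0))%C with (RtoC 0) by (simpl; ring).
    rewrite Cmod_0. apply Rmult_le_pos. apply Rmult_le_pos. lra.
    apply pow_le. unfold Rdiv. lra. apply Rdiv_le_0_compat; lra.
Qed.

Lemma cder_poly (c : nat -> C) n z :
  cder (fun z => csum (fun k => c k * z ^ k)%C n) z
    (csum (fun k => c k * (RtoC (INR k) * z ^ (k - 1)))%C n).
Proof.
  induction n as [|n IH]; simpl. apply der_on_const.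
  apply (der_on_plus _ (fun z => csum (fun k => c k * z ^ k)%C n) (fun z => c n * z ^ n)%C); auto.
  apply der_on_scal. eapply der_on_eq; [| |apply der_on_pow, der_on_id]. reflexivity.
  cbv beta. ring.
Qed.

Lemma holo_ball_mono R1 R2 f : R1 <= R2 -> holo_ball R2 f -> holo_ball R1 f.
Proof. intros H Hf z Hz. apply Hf. lra. Qed.

Lemma holo_ball_circ_bounded f R0 r : holo_ball R0 f -> 0 < r < R0 ->
  exists M, forall z, Cmod z = r -> Cmod (f z) <= M.
Proof.
  intros Hf Hr. assert (HP := PI_RGT_0).
  destruct (continuity_ab_maj (fun t => Cmod (f (RtoC r * cis t)%C)) 0 (2 * PI)) as [t0 [Ht0 _]].
  - lra.
  - intros t _. assert (Hc : ccont (fun t => f (RtoC r * cis t)%C) t).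
    { apply circ_cont. lra. intros z Hz. apply Hf. lra. }
    intros eps He. destruct (Hc eps He) as [del [Hd H]].
    exists del; split; auto. intros y [_ Hy]. specialize (H y Hy).
    eapply Rle_lt_trans; [|exact H]. simpl. unfold R_dist.
    apply Rabs_le. split; [rewrite Cmod_sub_sym|].
    generalize (Cmod_sub_ge (f (RtoC r * cis t)%C) (f (RtoC r * cis y)%C)). lra.
    apply Cmod_sub_ge.
  - exists (Cmod (f (RtoC r * cis t0)%C)). intros z Hz.
    destruct (polar z) as [t [Ht E]]. rewrite Hz in E. rewrite E. apply Ht0, Ht.
Qed.

(** With n = 0 the remainder bound of [cauchy_series] is a bound on f itself. Boundedness on a
    circle, parametrised by a compact interval of angles, thus gives boundedness on the disc. *)
Lemma holo_ball_bounded f R0 r : holo_ball R0 f -> 0 <= r < R0 ->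
  exists M, 0 <= M /\ forall z, Cmod z <= r -> Cmod (f z) <= M.
Proof.
  intros Hf Hr. set (r' := (r + R0) / 2).
  assert (Hr' : r < r' < R0) by (unfold r'; lra).
  destruct (holo_ball_circ_bounded f R0 r' Hf) as [M HM]. lra.
  assert (HM0 : 0 <= M) by (apply (circ_bound_pos _ r' _ ltac:(lra) HM)).
  destruct (cauchy_series f R0 r' M Hf ltac:(lra) HM) as [_ H].
  exists (2 * M * (r' / (r' - r))). split.
  { apply Rmult_le_pos. lra. apply Rdiv_le_0_compat; lra. }
  intros z Hz. specialize (H z ltac:(lra) O). simpl in H.
  replace (f z - 0)%C with (f z) in H by ring. eapply Rle_trans; [exact H|].
  rewrite Rmult_1_r. apply Rmult_le_compat_l. lra.
  apply Rmult_le_compat_l. lra. apply Rinv_le_contravar; lra.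
Qed.

Lemma cder_shift f z0 u d : cder f (z0 + u) d -> cder (fun u => f (z0 + u)%C) u d.
Proof.
  intros H. replace d with (d * (0 + 1))%C by ring.
  apply (der_on_comp _ (fun _ => True) (fun u => z0 + u)%C f); auto.
  apply der_on_plus. apply der_on_const. apply der_on_id.
Qed.

(** Cauchy's series on the circle of radius R0/2: the coefficient of z is at most 2M / (R0/2), and
    for |z| <= R0/4 the factor r/(r - |z|) is at most 2. *)
Lemma taylor2 f R0 M : 0 < R0 -> holo_ball R0 f ->
  (forall z, Cmod z < R0 -> Cmod (f z) <= M) ->
  exists d, cder f 0 d /\ Cmod d <= 4 * M / R0 /\
   forall z, Cmod z <= R0 / 4 -> Cmod (f z - f 0 - d * z) <= 16 * M / (R0 * R0) * (Cmod z * Cmod z).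
Proof.
  intros HR Hf HM.
  destruct (cauchy_series f R0 (R0 / 2) M Hf ltac:(lra)) as [Hc Hs].
  { intros z Hz. apply HM. lra. }
  set (c := cauchy_coef f (R0 / 2)) in *.
  assert (E0 : f 0 = c O).
  { specialize (Hs 0). rewrite Cmod_0 in Hs. specialize (Hs ltac:(lra) 1%nat). simpl in Hs.
    apply Ceq_le_eps. intros e He.
    replace (c O) with (0 + c O * 1)%C by ring. eapply Rle_trans; [exact Hs|].
    unfold Rdiv. rewrite Rmult_0_l. lra. }
  assert (HM0 : 0 <= M).
  { eapply Rle_trans; [apply Cmod_ge_0|]. apply (HM 0). rewrite Cmod_0; lra. }
  assert (H2 : forall z, Cmod z <= R0 / 4 ->
     Cmod (f z - f 0 - c 1%nat * z) <= 16 * M / (R0 * R0) * (Cmod z * Cmod z)).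
  { intros z Hz. specialize (Hs z ltac:(lra) 2%nat). simpl in Hs.
    replace (f z - f 0 - c 1%nat * z)%C with (f z - (0 + c O * 1 + c 1%nat * (z * 1)))%C
      by (rewrite E0; ring).
    eapply Rle_trans; [exact Hs|].
    assert (Hq : R0 / 2 / (R0 / 2 - Cmod z) <= 2) by (apply geom_ratio_le_2; lra).
    replace (16 * M / (R0 * R0) * (Cmod z * Cmod z)) with
      (2 * M * (Cmod z / (R0 / 2) * (Cmod z / (R0 / 2) * 1)) * 2) by (field; lra).
    apply Rmult_le_compat_l; auto.
    assert (0 <= Cmod z / (R0 / 2)) by (apply Rdiv_le_0_compat; [apply Cmod_ge_0|lra]).
    apply Rmult_le_pos; [lra|apply Rmult_le_pos; [auto|lra]]. }
  exists (c 1%nat). split; [|split]; auto.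
  - intros eps He. set (K := 16 * M / (R0 * R0)).
    assert (HK : 0 <= K) by (apply Rdiv_le_0_compat; [lra|apply Rmult_lt_0_compat; auto]).
    destruct (small_mult K eps HK He) as [d [Hd Hsm]].
    generalize (nearby_and _ _ _ _ (nearby_ball (fun _ => True) 0 (R0 / 4) ltac:(lra)) (nearby_ball _ 0 d Hd)).
    apply nearby_imp. intros w _ [W1 W2]. replace (w - 0)%C with w in * by ring.
    eapply Rle_trans; [apply H2; lra|]. fold K. rewrite <- Rmult_assoc.
    apply Rmult_le_compat_r. apply Cmod_ge_0.
    apply Hsm. generalize (Cmod_ge_0 w). lra.
  - eapply Rle_trans; [apply Hc|]. simpl. right. field. lra.
Qed.

Lemma deriv_bound f z0 R0 M d : 0 < R0 ->
  (forall z, Cmod (z - z0) < R0 -> exists d, cder f z d) ->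
  (forall z, Cmod (z - z0) < R0 -> Cmod (f z) <= M) ->
  cder f z0 d -> Cmod d <= 4 * M / R0.
Proof.
  intros HR Hf HM Hd.
  assert (E : forall u, (z0 + u - z0)%C = u) by (intros; ring).
  destruct (taylor2 (fun u => f (z0 + u)%C) R0 M HR) as [d' [H1 [H2 _]]].
  - intros u Hu. destruct (Hf (z0 + u)%C) as [e He]. rewrite E; auto.
    exists e. apply cder_shift; auto.
  - intros u Hu. apply HM. rewrite E; auto.
  - replace d with d'; auto. eapply cder_unique; [exact H1|]. apply cder_shift.
    replace (z0 + 0)%C with z0 by ring. auto.
Qed.

(** * Taylor jets at the origin *)

(* The point z = 0 is excluded because [is_expansion] excludes it. *)
Definition jet (n : nat) (f : C -> C) (c : nat -> C) : Prop :=
  exists M r, 0 < r /\ forall z, 0 < Cmod z < r ->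
    Cmod (f z - csum (fun k => c k * z ^ k)%C n) <= M * Cmod z ^ n.

Lemma jet_bound n f c : jet n f c ->
  exists M r, 0 <= M /\ 0 < r /\ r <= 1 /\ forall z, 0 < Cmod z < r ->
    Cmod (f z - csum (fun k => c k * z ^ k)%C n) <= M * Cmod z ^ n.
Proof.
  intros [M [r [Hr H]]]. exists (Rabs M), (Rmin r 1).
  repeat split. apply Rabs_pos. apply Rmin_pos; lra. apply Rmin_r.
  intros z Hz. eapply Rle_trans; [apply H|].
  generalize (Rmin_l r 1). lra.
  apply Rmult_le_compat_r. apply pow_le; lra. apply Rle_abs.
Qed.

Lemma jet_ext_c n f c c' : (forall k, (k < n)%nat -> c k = c' k) -> jet n f c -> jet n f c'.
Proof.
  intros H [M [r [Hr HJ]]]. exists M, r; split; auto. intros z Hz.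
  rewrite <- (csum_ext (fun k => c k * z ^ k)%C). auto. intros k Hk. rewrite H; auto.
Qed.

Lemma jet_ext_f n f g c del : 0 < del -> (forall z, 0 < Cmod z < del -> f z = g z) ->
  jet n f c -> jet n g c.
Proof.
  intros Hd H [M [r [Hr HJ]]]. exists M, (Rmin r del); split. apply Rmin_pos; auto.
  intros z Hz. generalize (Rmin_l r del) (Rmin_r r del). intros.
  rewrite <- H by lra. apply HJ. lra.
Qed.

Lemma jet_O n f M r : 0 < r -> (forall z, 0 < Cmod z < r -> Cmod (f z) <= M * Cmod z ^ n) ->
  jet n f (fun _ => 0).
Proof.
  intros Hr H. exists M, r; split; auto. intros z Hz.
  rewrite csum_0. 2: intros; ring. replace (f z - 0)%C with (f z) by ring. auto.
Qed.

Lemma jet_plus n f g c d : jet n f c -> jet n g d ->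
  jet n (fun z => f z + g z)%C (fun k => c k + d k)%C.
Proof.
  intros [M1 [r1 [H1 F]]] [M2 [r2 [H2 G]]].
  exists (M1 + M2), (Rmin r1 r2); split. apply Rmin_pos; auto.
  intros z Hz. generalize (Rmin_l r1 r2) (Rmin_r r1 r2). intros.
  rewrite Rmult_plus_distr_r. eapply Cmod_tri; [|apply F; lra|apply G; lra].
  rewrite (csum_ext _ (fun k => c k * z ^ k + d k * z ^ k)%C), csum_plus by (intros; ring). ring.
Qed.

Lemma jet_scal n a f c : jet n f c -> jet n (fun z => a * f z)%C (fun k => a * c k)%C.
Proof.
  intros [M [r [H F]]]. exists (Cmod a * M), r; split; auto.
  intros z Hz.
  rewrite (csum_ext _ (fun k => a * (c k * z ^ k))%C), csum_scal by (intros; ring).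
  replace (a * f z - a * csum (fun k => (c k * z ^ k)%C) n)%C
    with (a * (f z - csum (fun k => (c k * z ^ k)%C) n))%C by ring.
  rewrite Cmod_mult, Rmult_assoc. apply Rmult_le_compat_l; auto. apply Cmod_ge_0.
Qed.

Lemma jet_csum n m (f : nat -> C -> C) (c : nat -> nat -> C) :
  (forall i, (i < m)%nat -> jet n (f i) (c i)) ->
  jet n (fun z => csum (fun i => f i z) m) (fun k => csum (fun i => c i k) m).
Proof.
  intros H. induction m as [|m IH]; simpl.
  - apply (jet_O n _ 0 1). lra. intros z _. rewrite Cmod_0. lra.
  - apply (jet_plus n (fun z => csum (fun i => f i z) m)); auto.
Qed.

Lemma csum_split (u : nat -> C) n j :
  csum u (n + j) = (csum u j + csum (fun k => u (j + k)%nat) n)%C.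
Proof.
  induction n as [|n IH]; simpl. ring. rewrite IH, (Nat.add_comm j n). ring.
Qed.

Lemma jet_mono n m f c : (m <= n)%nat -> jet n f c -> jet m f c.
Proof.
  intros Hmn HJ. apply jet_bound in HJ. destruct HJ as [M [r [HM [Hr [Hr1 HJ]]]]].
  destruct (Nat.le_exists_sub m n Hmn) as [j [-> _]].
  assert (HB : exists B, forall z, 0 < Cmod z < r ->
     Cmod (csum (fun k => c (m + k)%nat * z ^ (m + k))%C j) <= B * Cmod z ^ m).
  { clear. induction j as [|j [B IH]]. exists 0. intros; simpl. rewrite Cmod_0. lra.
    exists (B + Cmod (c (m + j)%nat) * r ^ j). intros z Hz. simpl. rewrite Rmult_plus_distr_r.
    eapply Cmod_tri; [reflexivity|auto|]. rewrite Cmod_mult, Cmod_pow, pow_add.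
    rewrite Rmult_assoc. apply Rmult_le_compat_l. apply Cmod_ge_0.
    rewrite Rmult_comm. apply Rmult_le_compat_r. apply pow_le; lra.
    apply pow_incr. lra. }
  destruct HB as [B' HB].
  exists (M + B'), r; split; auto. intros z Hz. specialize (HJ z Hz). specialize (HB z Hz).
  rewrite Rmult_plus_distr_r. rewrite csum_split in HJ.
  eapply Cmod_tri; [| |exact HB].
  2: { eapply Rle_trans; [exact HJ|]. apply Rmult_le_compat_l; auto.
    rewrite pow_add. rewrite <- (Rmult_1_l (Cmod z ^ m)) at 2.
    apply Rmult_le_compat_r. apply pow_le; lra.
    rewrite <- (pow1 j). apply pow_incr. lra. }
  ring.
Qed.

(** Once the lower coefficients agree, the two jets are compared at a small positive s and divided
    by s^n. *)
Lemma jet_unique n f c d : jet n f c -> jet n f d -> forall k, (k < n)%nat -> c k = d k.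
Proof.
  induction n as [|n IH]; intros HC HD k Hk. lia.
  assert (IH' := IH (jet_mono (S n) n _ _ ltac:(lia) HC) (jet_mono (S n) n _ _ ltac:(lia) HD)).
  destruct (Nat.eq_dec k n) as [->|E]. 2: apply IH'; lia.
  apply jet_bound in HC. apply jet_bound in HD.
  destruct HC as [M1 [r1 [HM1 [Hr1 [_ F]]]]]. destruct HD as [M2 [r2 [HM2 [Hr2 [_ G]]]]].
  apply Ceq_le_eps. intros e He.
  destruct (small_mult (M1 + M2) e) as [d0 [Hd0 Hsm]]; [lra|lra|].
  destruct (small3 d0 (r1 / 2) (r2 / 2)) as [s [Hs B3]]; try lra. specialize (Hsm s ltac:(lra)).
  assert (Es : Cmod (RtoC s) = s) by (apply Cmod_Rabs_RtoC; lra).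
  assert (F' := F (RtoC s) ltac:(lra)). assert (G' := G (RtoC s) ltac:(lra)).
  rewrite Es in *. simpl csum in F', G'.
  rewrite (csum_ext _ (fun k => d k * RtoC s ^ k)%C n) in F' by (intros; rewrite IH'; auto).
  assert (H : Cmod ((c n - d n) * RtoC s ^ n) <= M1 * s ^ S n + M2 * s ^ S n).
  { eapply Cmod_tri; [|rewrite Cmod_sub_sym; exact F'|exact G']. ring. }
  rewrite Cmod_mult, Cmod_pow, Es in H. simpl in H.
  assert (Hp : 0 < s ^ n) by (apply pow_lt; auto).
  apply Rmult_le_reg_r with (1 := Hp). eapply Rle_trans; [exact H|].
  replace (M1 * (s * s ^ n) + M2 * (s * s ^ n)) with ((M1 + M2) * s * s ^ n) by ring.
  apply Rmult_le_compat_r; lra.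
Qed.

Lemma jet_mulpow n j f c : jet n f c ->
  jet n (fun z => z ^ j * f z)%C (fun k => if (k <? j)%nat then RtoC 0 else c (k - j)%nat).
Proof.
  intros HJ. apply jet_mono with (n + j)%nat. lia.
  destruct HJ as [M [r [Hr H]]]. exists M, r; split; auto. intros z Hz.
  rewrite csum_split, csum_0.
  2: { intros k Hk. apply Nat.ltb_lt in Hk. rewrite Hk. ring. }
  rewrite (csum_ext _ (fun k => z ^ j * (c k * z ^ k))%C), csum_scal.
  2: { intros k _. replace (j + k <? j)%nat with false by (symmetry; apply Nat.ltb_ge; lia).
       replace (j + k - j)%nat with k by lia. rewrite Cpow_add_r. ring. }
  replace (z ^ j * f z - (0 + z ^ j * csum (fun k => c k * z ^ k) n))%C with
    (z ^ j * (f z - csum (fun k => c k * z ^ k) n))%C by ring.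
  rewrite Cmod_mult, Cmod_pow, pow_add.
  rewrite (Rmult_comm (Cmod z ^ n)), <- Rmult_assoc, (Rmult_comm M), Rmult_assoc.
  apply Rmult_le_compat_l; auto. apply pow_le; lra.
Qed.

Lemma cauchy_jet f R0 r M n : holo_ball R0 f -> 0 < r < R0 ->
  (forall z, Cmod z = r -> Cmod (f z) <= M) -> jet n f (cauchy_coef f r).
Proof.
  intros Hf Hr HM. destruct (cauchy_series f R0 r M Hf Hr HM) as [_ Hs].
  assert (HM0 : 0 <= M) by (apply (circ_bound_pos _ r _ ltac:(lra) HM)).
  exists (2 * M * (/ r) ^ n * 2), (r / 2). split. lra. intros z Hz.
  eapply Rle_trans; [apply Hs; lra|]. unfold Rdiv at 1. rewrite Rpow_mult_distr.
  assert (Hq : r / (r - Cmod z) <= 2) by (apply geom_ratio_le_2; lra).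
  replace (2 * M * (/ r) ^ n * 2 * Cmod z ^ n) with
    (2 * M * (Cmod z ^ n * (/ r) ^ n) * 2) by ring.
  apply Rmult_le_compat_l; auto. apply Rmult_le_pos. lra.
  apply Rmult_le_pos; apply pow_le. lra. left; apply Rinv_0_lt_compat; lra.
Qed.

(* The remainder f - (Taylor polynomial) is O(z^(n+1)); Cauchy's estimate on the disc
   of radius |z| around z makes its derivative O(z^n). *)
Lemma jet_deriv n f f' c R0 : 0 < R0 -> (forall z, Cmod z < R0 -> cder f z (f' z)) ->
  jet (S n) f c -> jet n f' (fun k => RtoC (INR (S k)) * c (S k))%C.
Proof.
  intros HR Hf HJ. apply jet_bound in HJ. destruct HJ as [M [r [HM [Hr [Hr1 HJ]]]]].
  set (rho := Rmin r R0).
  assert (Hrho : 0 < rho) by (apply Rmin_pos; auto).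
  assert (R1 : rho <= r) by apply Rmin_l. assert (R2 : rho <= R0) by apply Rmin_r.
  exists (4 * (M * 2 ^ S n)), (rho / 2). split. lra. intros z Hz.
  set (P := fun z => csum (fun k => c k * z ^ k)%C (S n)).
  replace (4 * (M * 2 ^ S n) * Cmod z ^ n) with (4 * (M * (2 * Cmod z) ^ S n) / Cmod z).
  2: { rewrite Rpow_mult_distr. simpl. field. lra. }
  apply (deriv_bound (fun z => f z - P z)%C z).
  - lra.
  - intros w Hw. assert (Cmod w < R0) by (generalize (Cmod_sub_ge w z); lra).
    eexists. apply der_on_minus. apply Hf; auto. apply cder_poly.
  - intros w Hw.
    assert (B : Cmod w <= 2 * Cmod z) by (generalize (Cmod_sub_ge w z); lra).
    (* The open disc of radius |z| about z omits the origin, where the jet says nothing. *)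
    assert (B0 : 0 < Cmod w) by (rewrite Cmod_sub_sym in Hw; generalize (Cmod_sub_ge z w); lra).
    eapply Rle_trans; [apply HJ; lra|]. apply Rmult_le_compat_l; auto.
    apply pow_incr. lra.
  - eapply der_on_eq; [| |apply der_on_minus; [apply Hf; lra|apply cder_poly]]. reflexivity.
    f_equal. rewrite csum_shift. simpl. 
    replace (c O * (0 * 1))%C with (RtoC 0) by ring. rewrite Cplus_0_l.
    apply csum_ext. intros k _. rewrite Nat.sub_0_r. ring.
Qed.

(** * Expansions *)

Lemma Cpow_Z_nat (z : C) (k : nat) : Cpow_Z z (Z.of_nat k) = (z ^ k)%C.
Proof.
  destruct k as [|k]. reflexivity.
  change (Cpow z (Pos.to_nat (Pos.of_succ_nat k)) = Cpow z (S k)).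
  rewrite SuccNat2Pos.id_succ. reflexivity.
Qed.

Lemma sum_n_csum (u : nat -> C) n :
  @sum_n C_AbelianMonoid u n = csum u (S n).
Proof.
  induction n as [|n IH]. rewrite sum_O. simpl. ring.
  rewrite sum_Sn, IH. reflexivity.
Qed.

Lemma is_series_eps (u : nat -> C) (l : C) : @is_series C_AbsRing C_NormedModule u l <->
  forall eps, 0 < eps -> exists N, forall n, (N <= n)%nat -> Cmod (csum u (S n) - l) < eps.
Proof.
  assert (Hs : 0 < sqrt 2) by (apply sqrt_lt_R0; lra).
  assert (Es : forall n, @sum_n C_NormedModule u n = csum u (S n)) by (intros; apply (sum_n_csum u)).
  split.
  - intros H eps He.
    (* Balls of the product topology compare with [Cmod] up to the factor sqrt 2. *)
    assert (H' := proj1 (filterlim_locally (U := C_UniformSpace) _ _) H (mkposreal _ (Rdiv_lt_0_compat _ _ He Hs))).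
    destruct H' as [N HN]. exists N. intros n Hn. specialize (HN n Hn).
    apply (C_NormedModule_mixin_compat2 l) in HN. rewrite Es in HN. simpl in HN.
    replace (sqrt 2 * (eps / sqrt 2)) with eps in HN by (field; lra). exact HN.
  - intros H. apply (filterlim_locally (U := C_UniformSpace)). intros eps.
    destruct (H eps (cond_pos eps)) as [N HN]. exists N. intros n Hn.
    apply C_NormedModule_mixin_compat1. rewrite Es. apply HN, Hn.
Qed.

(** Abel's lemma: convergence at the single point rho bounds all u_k rho^k, so that the tail is
    dominated by a geometric one of ratio at most 1/2 when |z| < rho/2. *)
Lemma expansion_jet m g c : is_expansion (Z.of_nat m) g c ->
  forall n, jet n g (fun k => c (Z.of_nat k)).
Proof.
  intros [H0 [r [Hr H]]] n.
  set (u := fun k => c (Z.of_nat k)).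
  set (rho := r / 2). assert (Hrho : 0 < rho < r) by (unfold rho; lra).
  assert (Hsum : forall z N, csum (fun j => c (Z.of_nat m + Z.of_nat j)%Z * Cpow_Z z (Z.of_nat m + Z.of_nat j))%C N
     = csum (fun k => u k * z ^ k)%C (N + m)).
  { intros z N. rewrite csum_split, (csum_0 _ m).
    2: { intros k Hk. unfold u. rewrite H0 by lia. ring. }
    rewrite Cplus_0_l. apply csum_ext. intros k _. rewrite <- Nat2Z.inj_add, Cpow_Z_nat. reflexivity. }
  assert (Hlim : forall z, 0 < Cmod z < r -> forall eps, 0 < eps -> exists N, forall n, (N <= n)%nat ->
     Cmod (csum (fun k => u k * z ^ k)%C n - g z) < eps).
  { intros z Hz eps He. destruct (proj1 (is_series_eps _ _) (H z Hz) eps He) as [N HN].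
    exists (S N + m)%nat. intros k Hk.
    specialize (HN (k - m - 1)%nat ltac:(lia)). rewrite Hsum in HN.
    replace (S (k - m - 1) + m)%nat with k in HN by lia. exact HN. }
  assert (Erho : Cmod (RtoC rho) = rho) by (apply Cmod_Rabs_RtoC; lra).
  assert (HB : exists B, 0 <= B /\ forall k, Cmod (u k) * rho ^ k <= B).
  { destruct (Hlim (RtoC rho) ltac:(lra) 1) as [N HN]. lra.
    assert (Hfin : exists B, 0 <= B /\ forall k, (k < N)%nat -> Cmod (u k) * rho ^ k <= B).
    { clear. induction N as [|N [B [HB IH]]]. exists 0. split. lra. intros; lia.
      exists (Rmax B (Cmod (u N) * rho ^ N)). split. eapply Rle_trans; [exact HB|apply Rmax_l].
      intros k Hk. destruct (Nat.eq_dec k N) as [->|E]. apply Rmax_r.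
      eapply Rle_trans; [apply IH; lia|apply Rmax_l]. }
    destruct Hfin as [B [HB0 HB]]. exists (B + 2). split. lra. intros k.
    destruct (Nat.lt_ge_cases k N) as [L|L]. specialize (HB k L). lra.
    assert (A1 := HN k L). assert (A2 := HN (S k) ltac:(lia)). simpl in A2.
    assert (A3 : Cmod (u k * RtoC rho ^ k) <= 1 + 1).
    { eapply Cmod_tri; [|left; exact A2|left; rewrite Cmod_sub_sym; exact A1]. ring. }
    rewrite Cmod_mult, Cmod_pow, Erho in A3. lra. }
  destruct HB as [B [HB0 HB]].
  exists (2 * B * (/ rho) ^ n), (rho / 2). split. lra. intros z Hz.
  apply le_of_le_eps. intros e He. destruct (Hlim z ltac:(lra) e He) as [N HN].
  specialize (HN (n + N)%nat ltac:(lia)). rewrite Cmod_sub_sym in HN.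
  rewrite Rplus_comm. eapply Cmod_tri; [|left; exact HN|].
  2: { assert (Hq : 0 <= Cmod z / rho < 1) by (apply Rdiv_small_1; lra).
    eapply Rle_trans. apply (csum_geom_bound (fun k => u k * z ^ k)%C n (n + N) B (Cmod z / rho)); auto; try lia.
    - intros k. rewrite Cmod_mult, Cmod_pow. unfold Rdiv. rewrite Rpow_mult_distr, pow_inv.
      assert (Hp : 0 < rho ^ k) by (apply pow_lt; lra).
      replace (Cmod (u k) * Cmod z ^ k) with (Cmod (u k) * rho ^ k * (Cmod z ^ k * / rho ^ k)) by (field; lra).
      apply Rmult_le_compat_r; auto. apply Rmult_le_pos. apply pow_le; lra.
      left; apply Rinv_0_lt_compat; auto.
    - assert (Hq2 : Cmod z / rho <= 1 / 2).
      { apply Rmult_le_reg_r with rho. lra. unfold Rdiv at 1; rewrite Rmult_assoc, Rinv_l; lra. }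
      replace (2 * B * (/ rho) ^ n * Cmod z ^ n) with (B * (Cmod z / rho) ^ n * 2)
        by (unfold Rdiv; rewrite Rpow_mult_distr; ring).
      unfold Rdiv at 1. apply Rmult_le_compat_l. apply Rmult_le_pos; auto. apply pow_le; lra.
      replace 2 with (/ (1 / 2)) by field. apply Rinv_le_contravar; lra. }
  unfold u. ring.
Qed.

(** [expansion] is picked by [epsilon], so nothing is known of it until some expansion exists. The
    Cauchy coefficients provide one, and uniqueness of jets makes those below [m] vanish. *)
Lemma expansion_exists m g c R0 : 0 < R0 -> holo_ball R0 g ->
  jet m g c -> (forall k, (k < m)%nat -> c k = RtoC 0) ->
  exists c', is_expansion (Z.of_nat m) g c'.
Proof.
  intros HR Hf HJ H0. destruct (holo_ball_circ_bounded g R0 (R0 / 2) Hf) as [M HM]. lra.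
  destruct (cauchy_series g R0 (R0 / 2) M Hf ltac:(lra) HM) as [_ Hs].
  assert (HM0 : 0 <= M) by (apply (circ_bound_pos _ (R0 / 2) _ ltac:(lra) HM)).
  set (c1 := cauchy_coef g (R0 / 2)) in *. set (r := R0 / 2) in *.
  assert (Hr : 0 < r) by (unfold r; lra).
  assert (E0 : forall k, (k < m)%nat -> c1 k = 0).
  { intros k Hk. rewrite <- (H0 k Hk). apply (jet_unique m g); auto.
    apply (cauchy_jet g R0 r M); auto. unfold r; lra. }
  exists (fun k => if (k <? 0)%Z then RtoC 0 else c1 (Z.to_nat k)). split.
  - intros k Hk. destruct (Z.ltb_spec k 0); auto. apply E0. lia.
  - exists r. split; auto. intros z Hz. apply is_series_eps. intros eps He.
    assert (Hq : 0 <= Cmod z / r < 1) by (apply Rdiv_small_1; lra).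
    set (K := 2 * M * (r / (r - Cmod z))).
    assert (HK : 0 <= K) by (apply Rmult_le_pos; [lra|apply Rdiv_le_0_compat; lra]).
    destruct (small_mult K (eps / 2) HK) as [d [Hd Hsm]]; [lra|].
    destruct (pow_small _ d Hq Hd) as [N HN].
    exists N. intros n Hn.
    assert (E : csum (fun j => (if (Z.of_nat m + Z.of_nat j <? 0)%Z then RtoC 0 else
        c1 (Z.to_nat (Z.of_nat m + Z.of_nat j))) * Cpow_Z z (Z.of_nat m + Z.of_nat j))%C (S n)
        = csum (fun k => c1 k * z ^ k)%C (S n + m)).
    { rewrite (csum_split _ (S n) m), (csum_0 _ m).
      2: { intros k Hk. rewrite E0 by auto. ring. }
      rewrite Cplus_0_l. apply csum_ext. intros k _. rewrite <- Nat2Z.inj_add, Cpow_Z_nat, Nat2Z.id.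
      destruct (Z.ltb_spec (Z.of_nat (m + k)) 0); auto. lia. }
    rewrite E, Cmod_sub_sym. eapply Rle_lt_trans; [apply Hs; lra|].
    specialize (HN (S n + m)%nat ltac:(lia)).
    replace (2 * M * (Cmod z / r) ^ (S n + m) * (r / (r - Cmod z))) with (K * (Cmod z / r) ^ (S n + m))
      by (unfold K; ring).
    assert (0 <= (Cmod z / r) ^ (S n + m)) by (apply pow_le; lra).
    specialize (Hsm ((Cmod z / r) ^ (S n + m)) ltac:(lra)). lra.
Qed.

Lemma expansion_coef m g c R0 : 0 < R0 -> holo_ball R0 g ->
  jet m g c -> (forall k, (k < m)%nat -> c k = RtoC 0) ->
  (forall k, (k < Z.of_nat m)%Z -> expansion (Z.of_nat m) g k = 0) /\
  forall n, jet n g (fun k => expansion (Z.of_nat m) g (Z.of_nat k)).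
Proof.
  intros HR Hf HJ H0.
  assert (HE : is_expansion (Z.of_nat m) g (expansion (Z.of_nat m) g)).
  { unfold expansion. apply epsilon_spec. eapply expansion_exists; eauto. }
  split. apply HE. apply (expansion_jet m); auto.
Qed.

Lemma power_coef_jet R0 g n : 0 < R0 -> holo_ball R0 g -> jet n g (power_coef g).
Proof.
  intros HR Hf. apply (expansion_coef 0 g (fun _ => 0) R0); auto.
  destruct (holo_ball_nbhd R0 g HR Hf) as [d [H1 H2]].
  apply (jet_O 0 g (Cmod (g 0) + 1) d); auto. intros z Hz. rewrite Rmult_1_r. apply H2. lra.
Qed.

Lemma power_coef_eq R0 g n c k : 0 < R0 -> holo_ball R0 g -> jet n g c -> (k < n)%nat ->
  power_coef g k = c k.
Proof.
  intros HR Hf HJ Hk. apply (jet_unique n g); auto. eapply power_coef_jet; eauto.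
Qed.

Lemma power_coef_bound R0 g M k : 0 < R0 -> holo_ball R0 g ->
  (forall z, Cmod z < R0 -> Cmod (g z) <= M) ->
  Cmod (power_coef g k) <= 2 * M / (R0 / 2) ^ k.
Proof.
  intros HR Hf HM.
  destruct (cauchy_series g R0 (R0 / 2) M Hf ltac:(lra)) as [Hc Hs].
  { intros z Hz. apply HM. lra. }
  assert (HM0 : 0 <= M).
  { eapply Rle_trans; [apply Cmod_ge_0|]. apply (HM 0). rewrite Cmod_0; lra. }
  rewrite (power_coef_eq R0 g (S k) (cauchy_coef g (R0 / 2))); auto.
  apply (cauchy_jet g R0 (R0 / 2) M); auto. lra. intros z Hz. apply HM. lra.
Qed.

(** * Differential inequalities off a null set *)

Lemma null_set_empty (N : R -> Prop) : (forall x, ~ N x) -> null_set N.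
Proof.
  intros H eps He. exists (fun _ => 0), (fun _ => 0). split; [|split].
  - intros; lra.
  - intros x Hx. destruct (H x Hx).
  - intros i. induction i as [|i IH]; [rewrite sum_O|rewrite sum_Sn; unfold plus; simpl]; lra.
Qed.

Lemma sum_n_le (u v : nat -> R) n : (forall k, u k <= v k) -> sum_n u n <= sum_n v n.
Proof. intros H. apply sum_n_m_le, H. Qed.

Definition covered_length (l r x : R) : R := Rmax 0 (Rmin x r - l).

Lemma covered_length_le l r x : l <= r -> covered_length l r x <= r - l.
Proof.
  intros H. unfold covered_length. apply Rmax_lub. lra. generalize (Rmin_r x r). lra.
Qed.

Lemma covered_length_mono l r x y : x <= y -> covered_length l r x <= covered_length l r y.
Proof.
  intros H. unfold covered_length. apply Rle_max_compat_l.
  apply Rplus_le_compat_r. apply Rle_min_compat_r; auto.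
Qed.

Lemma covered_length_in l r x y : l < x -> x <= y -> y < r ->
  covered_length l r y = covered_length l r x + (y - x).
Proof.
  intros H1 H2 H3. unfold covered_length. rewrite !Rmin_left, !Rmax_right by lra. ring.
Qed.

(* The set is covered by intervals of total length [eps]; [S x] is the length covered
   to the left of [x]. The inequality [f x <= f a + eps (x - a) + L S x] is propagated
   from left to right: inside a covering interval [S] grows at unit speed. *)
Lemma real_mono (f : R -> R) (N : R -> Prop) a b L : a <= b -> 0 <= L -> null_set N ->
  (forall x, a < x <= b -> forall eps, 0 < eps -> exists del, 0 < del /\
     forall y, a <= y < x -> x - y < del -> f x <= f y + eps) ->
  (forall x, a <= x < b -> ~ N x -> forall eps, 0 < eps -> exists del, 0 < del /\
     forall y, x < y <= b -> y - x < del -> f y - f x <= eps * (y - x)) ->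
  (forall x, a <= x < b -> N x -> forall y, x < y <= b -> f y - f x <= L * (y - x)) ->
  f b <= f a.
Proof.
  intros Hab HL HN Hleft Hder Hlip.
  assert (key : forall eps, 0 < eps -> f b <= f a + eps * (b - a) + L * eps).
  { intros eps He. destruct (HN eps He) as [l [r [Hlr [Hcov Hlen]]]].
    set (Sn := fun x n => @sum_n R_AbelianMonoid (fun j => covered_length (l j) (r j) x) n).
    assert (HSn_le : forall x n, Sn x n <= eps).
    { intros x n. eapply Rle_trans; [|apply (Hlen n)]. apply sum_n_le.
      intros j. apply covered_length_le; auto. }
    assert (HSn_ge : forall x n, 0 <= covered_length (l n) (r n) x) by (intros; apply Rmax_l).
    assert (HSn_incr : forall x n m, (n <= m)%nat -> Sn x n <= Sn x m).
    { intros x n m Hnm. induction Hnm as [|m _ IH]. lra.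
      unfold Sn. rewrite sum_Sn. eapply Rle_trans; [exact IH|]. unfold plus; simpl.
      generalize (HSn_ge x (S m)). unfold Sn. lra. }
    (* [S x], the supremum of the partial sums, counts overlaps of the intervals several times; this
       is harmless, since it still stays below [eps]. *)
    assert (HS : exists S : R -> R, forall x, (forall n, Sn x n <= S x) /\
       (forall B, (forall n, Sn x n <= B) -> S x <= B)).
    { assert (HS : forall x, {s | (forall n, Sn x n <= s) /\ (forall B, (forall n, Sn x n <= B) -> s <= B)}).
      { intros x. destruct (completeness (fun s => exists n, s = Sn x n)) as [s [H1 H2]].
        exists eps. intros s [n ->]. auto. exists (Sn x O), O. auto.
        exists s. split. intros n; apply H1; exists n; auto.
        intros B HB. apply H2. intros t [n ->]. auto. }
      exists (fun x => proj1_sig (HS x)). intros x. apply (proj2_sig (HS x)). }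
    destruct HS as [S HS].
    assert (HS_le : forall x, S x <= eps) by (intros x; apply HS; auto).
    assert (HS_ge : forall x, 0 <= S x).
    { intros x. eapply Rle_trans; [|apply (proj1 (HS x) O)]. unfold Sn. rewrite sum_O. auto. }
    assert (HS_mono : forall x y, x <= y -> S x <= S y).
    { intros x y Hxy. apply HS. intros n. eapply Rle_trans; [|apply (proj1 (HS y) n)].
      apply sum_n_le. intros j. apply covered_length_mono; auto. }
    assert (HS_in : forall i x y, l i < x -> x <= y -> y < r i -> S x + (y - x) <= S y).
    { intros i x y H1 H2 H3.
      assert (Hi : forall n, Sn x (n + i)%nat + (y - x) <= Sn y (n + i)%nat).
      { intros n. induction n as [|n IH].
        - simpl. destruct i as [|i]; unfold Sn.
          + rewrite !sum_O. rewrite (covered_length_in _ _ x y) by auto. lra.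
          + rewrite !sum_Sn. rewrite (covered_length_in _ _ x y) by auto.
            unfold plus; simpl.
            assert (sum_n (fun j => covered_length (l j) (r j) x) i <=
                    sum_n (fun j => covered_length (l j) (r j) y) i).
            { apply sum_n_le. intros j. apply covered_length_mono; auto. }
            unfold plus in *; simpl in *. lra.
        - simpl. unfold Sn in *. rewrite !sum_Sn. unfold plus; simpl.
          generalize (covered_length_mono (l (Datatypes.S (n + i))) (r (Datatypes.S (n + i))) x y H2). lra. }
      apply Rplus_le_reg_r with (- (y - x)).
      replace (S x + (y - x) + - (y - x)) with (S x) by ring.
      apply HS. intros n.
      assert (A1 := HSn_incr x n (n + i)%nat ltac:(lia)).
      assert (A2 := Hi n). assert (A3 := proj1 (HS y) (n + i)%nat). lra. }
    (* Supremum argument: [c] is the last point where [P] holds. If c < b, a point of [N] is passed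
       inside a covering interval, where the gain of [S] pays for the Lipschitz growth, and any
       other point is passed by the bound on its derivative. *)
    set (P := fun x => f x <= f a + eps * (x - a) + L * S x).
    destruct (completeness (fun x => a <= x <= b /\ P x)) as [c [Hc1 Hc2]].
    { exists b. intros x [? _]. lra. }
    { exists a. split. lra. unfold P. generalize (HS_ge a). intros. assert (0 <= L * S a) by (apply Rmult_le_pos; auto). lra. }
    assert (Hac : a <= c).
    { apply Hc1. split. lra. unfold P. generalize (HS_ge a). intros. assert (0 <= L * S a) by (apply Rmult_le_pos; auto). lra. }
    assert (Hcb : c <= b) by (apply Hc2; intros x [? _]; lra).
    assert (Pc : P c).
    { destruct (Req_dec c a) as [->|Hca].
      { unfold P. generalize (HS_ge a). intros. assert (0 <= L * S a) by (apply Rmult_le_pos; auto). lra. }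
      unfold P. apply le_of_le_eps. intros e Hee.
      destruct (Hleft c ltac:(lra) e Hee) as [del [Hdel Hl]].
      assert (Hx : exists x, a <= x <= b /\ P x /\ c - del < x).
      { apply NNPP. intros Hno. assert (c <= c - del); [|lra].
        apply Hc2. intros x [Hx Px]. apply Rnot_lt_le. intros Hlt. apply Hno. exists x; auto. }
      destruct Hx as [x [Hx [Px Hxc]]].
      assert (Hxc' : x <= c) by (apply Hc1; auto).
      destruct Hxc' as [Hxc'| ->].
      - specialize (Hl x ltac:(lra) ltac:(lra)). unfold P in Px.
        assert (L * S x <= L * S c) by (apply Rmult_le_compat_l; auto; apply HS_mono; lra).
        nra.
      - unfold P in Px. lra. }
    destruct (Req_dec c b) as [->|Hneq].
    { unfold P in Pc. assert (L * S b <= L * eps) by (apply Rmult_le_compat_l; auto). lra. }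
    exfalso.
    assert (Hext : exists y, c < y <= b /\ P y).
    { destruct (classic (N c)) as [Nc|Nc].
      - destruct (Hcov c Nc) as [i [Hi1 Hi2]].
        set (y := Rmin b ((c + r i) / 2)).
        assert (Hy1 : y <= b) by apply Rmin_l. assert (Hy2 : y <= (c + r i) / 2) by apply Rmin_r.
        assert (Hy : c < y) by (apply Rmin_glb_lt; lra).
        exists y. split. lra. unfold P in *.
        assert (A := Hlip c ltac:(lra) Nc y ltac:(lra)).
        assert (B := HS_in i c y Hi1 ltac:(lra) ltac:(lra)).
        assert (L * (y - c) <= L * (S y - S c)) by (apply Rmult_le_compat_l; lra). nra.
      - destruct (Hder c ltac:(lra) Nc eps He) as [del [Hdel Hd]].
        set (y := Rmin b (c + del / 2)).
        assert (Hy1 : y <= b) by apply Rmin_l. assert (Hy2 : y <= c + del / 2) by apply Rmin_r.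
        assert (Hy : c < y) by (apply Rmin_glb_lt; lra).
        exists y. split. lra. unfold P in *.
        assert (A := Hd y ltac:(lra) ltac:(lra)).
        assert (L * S c <= L * S y) by (apply Rmult_le_compat_l; auto; apply HS_mono; lra). nra. }
    destruct Hext as [y [Hy Py]].
    assert (y <= c) by (apply Hc1; split; auto; lra). lra. }
  apply le_of_le_eps. intros e He.
  set (eps := e / (b - a + L + 1)).
  assert (Heps : 0 < eps) by (apply Rdiv_lt_0_compat; lra).
  assert (E : eps * (b - a + L + 1) = e) by (unfold eps; field; lra).
  specialize (key eps Heps). lra.
Qed.

(** * One-sided derivatives and mean value inequalities *)

Definition rder_from (a : R) (F : R -> C) (x : R) (d : C) : Prop :=
  der_on (fun w => Im w = 0 /\ a <= Re w) (fun w => F (Re w)) (RtoC x) d.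

Lemma rder_from_iff a F x d : rder_from a F x d <->
  forall eps, 0 < eps -> exists del, 0 < del /\
    forall y, a <= y -> Rabs (y - x) < del ->
      Cmod (F y - F x - d * (RtoC y - RtoC x)) <= eps * Rabs (y - x).
Proof.
  split; intros H eps He; destruct (H eps He) as [del [Hd H']]; exists del; split; auto.
  - intros y Hay Hy. specialize (H' (RtoC y) (conj eq_refl Hay)). simpl in H'.
    rewrite <- RtoC_minus, Cmod_R in H'. rewrite <- RtoC_minus. auto.
  - intros w [Hw Haw]. rewrite (RtoC_Re _ Hw). simpl.
    rewrite <- RtoC_minus, Cmod_R. specialize (H' (Re w)). rewrite <- RtoC_minus in H'. auto.
Qed.

Lemma rder_from_mono a b F x d : a <= b -> rder_from a F x d -> rder_from b F x d.
Proof. intros H. apply der_on_mono. intros w [? ?]; split; auto; lra. Qed.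

Lemma rder_rder_from a F x d : rder F x d -> rder_from a F x d.
Proof. apply der_on_mono. tauto. Qed.

Lemma Re_minus (z w : C) : Re (z - w) = Re z - Re w.
Proof. reflexivity. Qed.

Lemma Re_mult_minus (u z w : C) : Re (u * (z - w)) = Re (u * z) - Re (u * w).
Proof. rewrite <- Re_minus. f_equal. ring. Qed.

Lemma Re_mult_R (z : C) (x : R) : Re (z * RtoC x) = Re z * x.
Proof. destruct z; simpl. ring. Qed.

Lemma exists_unit (z : C) : exists u, Cmod u = 1 /\ Re (u * z) = Cmod z.
Proof.
  destruct (Ceq_dec z 0) as [->|Hz].
  - exists 1. split. apply Cmod_1. rewrite Cmod_0. simpl. ring.
  - assert (Hm := proj1 (Cmod_gt_0 z) Hz).
    assert (Hmz : RtoC (Cmod z) <> 0) by (intros E; apply RtoC_inj in E; lra).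
    exists (Cconj z / RtoC (Cmod z))%C. split.
    + rewrite Cmod_div, Cmod_conj, Cmod_Rabs_RtoC by (auto; lra). field. lra.
    + replace (Cconj z / RtoC (Cmod z) * z)%C with (RtoC (Cmod z)). reflexivity.
      replace (Cconj z / RtoC (Cmod z) * z)%C with ((z * Cconj z) / RtoC (Cmod z))%C by (field; auto).
      rewrite <- Cmod2_conj. rewrite RtoC_pow. field. auto.
Qed.

(* Only Re (u F) is estimated, where |u| = 1 is chosen so that
   Re (u (F b - F a)) = |F b - F a|. *)
Lemma mvt_ae (F : R -> C) (g g' : R -> R) (N : R -> Prop) a b L :
  a <= b -> 0 <= L -> null_set N ->
  (forall x, a < x <= b -> forall eps, 0 < eps -> exists del, 0 < del /\
     forall y, a <= y < x -> x - y < del -> Cmod (F x - F y) <= eps) ->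
  (forall x, a <= x < b -> N x -> forall y, x < y <= b -> Cmod (F y - F x) <= L * (y - x)) ->
  (forall x, a <= x < b -> ~ N x -> exists d, rder_from x F x d /\ Cmod d <= g' x) ->
  (forall x, a <= x < b -> derivable_pt_lim g x (g' x)) ->
  (forall x y, a <= x -> x <= y -> y <= b -> g x <= g y) ->
  Cmod (F b - F a) <= g b - g a.
Proof.
  intros Hab HL HN Hleft Hlip Hder Hg Hgm.
  destruct (exists_unit (F b - F a)) as [u [Hu Eu]].
  assert (HRe : forall z, Re (u * z) <= Cmod z).
  { intros z. eapply Rle_trans; [apply Rle_abs|]. eapply Rle_trans; [apply re_le_Cmod|].
    rewrite Cmod_mult, Hu. lra. }
  set (f := fun x => Re (u * F x) - g x).
  assert (H : f b <= f a).
  { apply (real_mono f N a b L); auto.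
    - intros x Hx eps He. destruct (Hleft x Hx eps He) as [del [Hd H]].
      exists del; split; auto. intros y Hy Hxy. specialize (H y Hy Hxy).
      assert (A := HRe (F x - F y)%C). rewrite Re_mult_minus in A.
      assert (B := Hgm y x ltac:(lra) ltac:(lra) ltac:(lra)). unfold f. lra.
    - intros x Hx Nx eps He. destruct (Hder x Hx Nx) as [d [Hd Hdg]].
      destruct (proj1 (rder_from_iff _ _ _ _) Hd (eps / 2) ltac:(lra)) as [d1 [H1 A1]].
      destruct (deriv_eps _ _ _ (Hg x Hx) (eps / 2) ltac:(lra)) as [d2 [H2 A2]].
      exists (Rmin d1 d2); split. apply Rmin_pos; auto.
      intros y Hy Hyx. assert (Eyx : Rabs (y - x) = y - x) by (apply Rabs_pos_eq; lra).
      generalize (Rmin_l d1 d2) (Rmin_r d1 d2). intros.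
      specialize (A1 y ltac:(lra) ltac:(lra)). specialize (A2 y ltac:(lra)).
      rewrite Eyx in *. unfold f.
      assert (B1 := HRe (F y - F x - d * (RtoC y - RtoC x))%C).
      assert (B2 := HRe d).
      assert (E : Re (u * (F y - F x - d * (RtoC y - RtoC x))) =
         Re (u * F y) - Re (u * F x) - Re (u * d) * (y - x)).
      { rewrite <- Re_mult_R, <- !Re_minus. f_equal. rewrite RtoC_minus. ring. }
      rewrite E in B1. apply Rabs_le_between in A2.
      assert (Re (u * d) * (y - x) <= g' x * (y - x)) by (apply Rmult_le_compat_r; lra). lra.
    - intros x Hx Nx y Hy. assert (A := Hlip x Hx Nx y Hy).
      assert (B := HRe (F y - F x)%C). rewrite Re_mult_minus in B.
      assert (B' := Hgm x y ltac:(lra) ltac:(lra) ltac:(lra)). unfold f. lra. }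
  unfold f in H. rewrite <- Eu, Re_mult_minus. lra.
Qed.

Lemma rder_from_left a F x d : rder_from a F x d -> forall eps, 0 < eps -> exists del, 0 < del /\
     forall y, a <= y < x -> x - y < del -> Cmod (F x - F y) <= eps.
Proof.
  intros H eps He. destruct (der_on_cont _ _ _ _ H eps He) as [del [Hd H']].
  exists del; split; auto. intros y Hy Hyx. specialize (H' (RtoC y)). simpl in H'.
  rewrite Cmod_sub_sym. left. apply H'. split; auto; lra.
  rewrite <- RtoC_minus, Cmod_R, Rabs_left; lra.
Qed.

Lemma mvt_const (F : R -> C) a b K : a <= b ->
  (forall x, a <= x <= b -> exists d, rder_from a F x d /\ Cmod d <= K) ->
  Cmod (F b - F a) <= K * (b - a).
Proof.
  intros Hab H.
  assert (HK : 0 <= K).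
  { destruct (H a ltac:(lra)) as [d [_ Hd]]. generalize (Cmod_ge_0 d). lra. }
  replace (K * (b - a)) with (K * b - K * a) by ring.
  apply (mvt_ae F (fun x => K * x) (fun _ => K) (fun _ => False) a b 0); auto.
  - lra.
  - apply null_set_empty; auto.
  - intros x Hx. destruct (H x ltac:(lra)) as [d [Hd _]]. eapply rder_from_left; eauto.
  - intros x _ [].
  - intros x Hx _. destruct (H x ltac:(lra)) as [d [Hd HdK]]. exists d. split; auto.
    apply rder_from_mono with a; auto; lra.
  - intros x _. assert (D := derivable_pt_lim_scal id K x 1 (derivable_pt_lim_id x)).
    rewrite Rmult_1_r in D. exact D.
  - intros x y _ Hxy _. apply Rmult_le_compat_l; auto.
Qed.

Lemma cder_lipschitz (f : C -> C) z0 r K u v :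
  (forall z, Cmod (z - z0) < r -> exists d, cder f z d /\ Cmod d <= K) ->
  Cmod (u - z0) < r -> Cmod (v - z0) < r -> Cmod (f u - f v) <= K * Cmod (u - v).
Proof.
  intros H Hu Hv.
  assert (A := mvt_const (fun t => f (v + RtoC t * (u - v))%C) 0 1 (K * Cmod (u - v)) ltac:(lra)).
  simpl in A. replace (v + 1 * (u - v))%C with u in A by ring.
  replace (v + 0 * (u - v))%C with v in A by ring.
  replace (K * Cmod (u - v)) with (K * Cmod (u - v) * (1 - 0)) by ring. apply A.
  intros t Ht. destruct (H (v + RtoC t * (u - v))%C) as [d [Hd HdK]].
  - replace (v + RtoC t * (u - v) - z0)%C with (RtoC (1 - t) * (v - z0) + RtoC t * (u - z0))%C
      by (rewrite RtoC_minus; ring).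
    eapply Rle_lt_trans; [apply Cmod_triangle|].
    rewrite !Cmod_mult, !Cmod_Rabs_RtoC by lra.
    destruct (Req_dec t 0) as [->|]; [lra|]. destruct (Req_dec t 1) as [->|]; [lra|]. nra.
  - exists (d * (u - v))%C. split.
    + apply rder_rder_from.
      apply (rder_comp (fun t => v + RtoC t * (u - v))%C f t (u - v) d); auto.
      apply rder_iff. intros eps He. exists 1. split. lra. intros y _.
      replace (v + RtoC y * (u - v) - (v + RtoC t * (u - v)) - (u - v) * (RtoC y - RtoC t))%C
        with (RtoC 0) by ring. rewrite Cmod_0. apply Rmult_le_pos. lra. apply Rabs_pos.
    + rewrite Cmod_mult. apply Rmult_le_compat_r; auto. apply Cmod_ge_0.
Qed.

Lemma pow_lip m B : 0 <= B -> exists K, 0 <= K /\ forall u v, 0 <= u <= B -> 0 <= v <= B ->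
  Rabs (u ^ m - v ^ m) <= K * Rabs (u - v).
Proof.
  intros HB. induction m as [|m [K [HK IH]]].
  - exists 0. split. lra. intros u v _ _. simpl. rewrite Rminus_diag, Rabs_R0. lra.
  - exists (B * K + B ^ m). split.
    { assert (0 <= B ^ m) by (apply pow_le; auto). nra. }
    intros u v Hu Hv. simpl.
    replace (u * u ^ m - v * v ^ m) with (u * (u ^ m - v ^ m) + v ^ m * (u - v)) by ring.
    eapply Rle_trans; [apply Rabs_triang|]. rewrite !Rabs_mult, Rmult_plus_distr_r.
    specialize (IH u v Hu Hv).
    apply Rplus_le_compat.
    + rewrite Rmult_assoc. apply Rmult_le_compat; auto using Rabs_pos.
      rewrite Rabs_pos_eq; lra.
    + apply Rmult_le_compat_r. apply Rabs_pos.
      rewrite Rabs_pos_eq by (apply pow_le; lra). apply pow_incr. lra.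
Qed.

Lemma finite_bound2 (b : nat -> nat -> C) n m : exists B, 0 <= B /\
  forall k j, (k < n)%nat -> (j < m)%nat -> Cmod (b k j) <= B.
Proof.
  assert (H1 : forall k, exists B, 0 <= B /\ forall j, (j < m)%nat -> Cmod (b k j) <= B).
  { intros k. induction m as [|m' [B [HB IH]]]. exists 0; split; [lra|intros; lia].
    exists (Rmax B (Cmod (b k m'))). split. eapply Rle_trans; [exact HB|apply Rmax_l].
    intros j Hj. destruct (Nat.eq_dec j m') as [->|E]. apply Rmax_r.
    eapply Rle_trans; [apply IH; lia|apply Rmax_l]. }
  induction n as [|n [B [HB IH]]]. exists 0; split; [lra|intros; lia].
  destruct (H1 n) as [B' [HB' IH']].
  exists (Rmax B B'). split. eapply Rle_trans; [exact HB|apply Rmax_l].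
  intros k j Hk Hj. destruct (Nat.eq_dec k n) as [->|E].
  eapply Rle_trans; [apply IH'; auto|apply Rmax_r].
  eapply Rle_trans; [apply IH; auto; lia|apply Rmax_l].
Qed.

(** * Linear systems and the exponential series *)

Definition exp_coef (t : R) (m : nat) : R := t ^ m / INR (fact m).

Lemma exp_coef_deriv a m t :
  derivable_pt_lim (fun t => exp_coef (t - a) (S m)) t (exp_coef (t - a) m).
Proof.
  unfold exp_coef.
  apply is_derive_Reals. auto_derive. auto.
  change (1 * (INR (S m) * (t - a) ^ m) * / INR (S m * fact m) = (t - a) ^ m / INR (fact m)).
  rewrite mult_INR. assert (H1 := INR_fact_neq_0 m).
  assert (H2 : INR (S m) <> 0) by (apply not_0_INR; lia). field. auto.
Qed.

Lemma exp_coef_rder a m t :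
  rder (fun t => RtoC (exp_coef (t - a) (S m))) t (RtoC (exp_coef (t - a) m)).
Proof.
  apply (rder_pair (fun t => exp_coef (t - a) (S m)) (fun _ => 0)).
  apply exp_coef_deriv. apply derivable_pt_lim_const.
Qed.

Lemma exp_coef_mono a m x y : a <= x -> x <= y -> exp_coef (x - a) m <= exp_coef (y - a) m.
Proof.
  intros H1 H2. apply Rmult_le_compat_r. left. apply Rinv_0_lt_compat. apply INR_fact_lt_0.
  apply pow_incr. lra.
Qed.

(** The remainder after q + 1 terms vanishes at [a], and its derivative is almost everywhere [b]
    applied to the remainder after q terms. Integrating the bound M K^q (t - a)^q / q! therefore
    produces the next one. The iterates [y m] are kept as vectors, so that row and column
    multiplication are both covered. *)
Theorem linear_ode n (x : nat -> R -> C) (b : nat -> nat -> C) (y : nat -> nat -> C) a T N L :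
  a <= T -> 0 <= L -> null_set N ->
  (forall k, (k < n)%nat -> forall s t, a <= s <= T -> a <= t <= T ->
     Cmod (x k t - x k s) <= L * Rabs (t - s)) ->
  (forall t, a <= t < T -> ~ N t -> forall k, (k < n)%nat ->
     rder_from t (x k) t (csum (fun j => b k j * x j t)%C n)) ->
  (forall k, (k < n)%nat -> y O k = x k a) ->
  (forall m k, (k < n)%nat -> y (S m) k = csum (fun j => b k j * y m j)%C n) ->
  forall eps, 0 < eps -> exists q0, forall q, (q0 <= q)%nat -> forall t k, a <= t <= T -> (k < n)%nat ->
    Cmod (x k t - csum (fun m => RtoC (exp_coef (t - a) m) * y m k)%C q) < eps.
Proof.
  intros HaT HL HN Hlip Hder Hy0 HyS.
  destruct (finite_bound2 b n n) as [B [HB0 HB]].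
  destruct (finite_bound2 (fun k _ => x k a) n 1) as [X [HX0 HX]].
  (* [K] bounds the matrix [b] for the maximum norm, and [M] bounds the unknowns on [a, T] through
     the Lipschitz condition. *)
  set (K := INR n * B). assert (HK : 0 <= K) by (apply Rmult_le_pos; auto using pos_INR).
  set (M := X + L * (T - a)). assert (HM : 0 <= M) by (assert (0 <= L * (T - a)) by (apply Rmult_le_pos; lra); unfold M; lra).
  assert (key : forall q k t, (k < n)%nat -> a <= t <= T ->
    Cmod (x k t - csum (fun m => RtoC (exp_coef (t - a) m) * y m k)%C q) <= M * K ^ q * exp_coef (t - a) q).
  { induction q as [|q IH]; intros k t Hk Ht.
    - simpl. replace (x k t - 0)%C with (x k a + (x k t - x k a))%C by ring.
      unfold exp_coef; simpl. replace (M * 1 * (1 / 1)) with (X + L * (T - a)) by (unfold M; field).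
      eapply Cmod_tri; [reflexivity|apply (HX k O); auto|].
      eapply Rle_trans; [apply Hlip; auto; lra|]. apply Rmult_le_compat_l; auto.
      rewrite Rabs_pos_eq; lra.
    - set (P := fun t => csum (fun m => RtoC (exp_coef (t - a) m) * y m k)%C (S q)).
      set (D := fun t => (x k t - P t)%C).
      assert (Ha : forall m, exp_coef (a - a) (S m) = 0).
      { intros m. unfold exp_coef. rewrite Rminus_diag. simpl. rewrite Rmult_0_l. unfold Rdiv. ring. }
      assert (Da : D a = 0).
      { unfold D, P. rewrite csum_shift, csum_0.
        2: { intros m _. rewrite Ha. ring. }
        rewrite Hy0 by auto. unfold exp_coef. simpl. replace (1 / 1) with 1 by field. ring. }
      replace (x k t - csum (fun m => RtoC (exp_coef (t - a) m) * y m k) (S q))%C with (D t - D a)%C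
        by (rewrite Da; unfold D, P; ring).
      (* The partial sum is Lipschitz as well, hence so is the remainder; [mvt_ae] needs this on the
         exceptional set and for left continuity. *)
      assert (HP : exists K', 0 <= K' /\ forall s t, a <= s <= T -> a <= t <= T -> Cmod (P t - P s) <= K' * Rabs (t - s)).
      { unfold P. clear. induction (S q) as [|m [K' [HK' IH]]].
        - exists 0. split. lra. intros. simpl. replace (0 - 0)%C with (RtoC 0) by ring. rewrite Cmod_0. lra.
        - destruct (Rle_lt_dec a T) as [HaT|HaT].
          2: { exists 0. split. lra. intros; lra. }
          destruct (pow_lip m (T - a) ltac:(lra)) as [J [HJ0 HJ]].
          assert (Hf := INR_fact_lt_0 m). assert (Hfi := Rinv_0_lt_compat _ Hf).
          exists (K' + J * / INR (fact m) * Cmod (y m k)). split.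
          + assert (0 <= J * / INR (fact m) * Cmod (y m k)); [|lra].
            apply Rmult_le_pos; auto using Cmod_ge_0. apply Rmult_le_pos; lra.
          + intros s t Hs Ht. simpl. rewrite Rmult_plus_distr_r.
            eapply (Cmod_tri (csum (fun m => RtoC (exp_coef (t - a) m) * y m k)%C m -
               csum (fun m => RtoC (exp_coef (s - a) m) * y m k)%C m)
               (RtoC (exp_coef (t - a) m - exp_coef (s - a) m) * y m k)); [|apply IH; auto|].
            rewrite RtoC_minus. ring.
            rewrite Cmod_mult, Cmod_R. unfold exp_coef, Rdiv.
            rewrite <- Rmult_minus_distr_r, Rabs_mult, (Rabs_pos_eq (/ INR (fact m))) by lra.
            replace (J * / INR (fact m) * Cmod (y m k) * Rabs (t - s)) with
              (J * Rabs (t - s) * / INR (fact m) * Cmod (y m k)) by ring.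
            apply Rmult_le_compat_r. apply Cmod_ge_0. apply Rmult_le_compat_r. lra.
            replace (t - s) with (t - a - (s - a)) by ring. apply HJ; lra. }
      destruct HP as [K' [HK' HP]].
      assert (HD : forall s t, a <= s <= T -> a <= t <= T -> Cmod (D t - D s) <= (L + K') * Rabs (t - s)).
      { intros s t' Hs Ht'. rewrite Rmult_plus_distr_r. unfold D.
        eapply (Cmod_tri (x k t' - x k s) (P s - P t')). ring. auto.
        rewrite Cmod_sub_sym. auto. }
      set (g := fun t => M * K ^ S q * exp_coef (t - a) (S q)).
      set (g' := fun t => M * K ^ S q * exp_coef (t - a) q).
      replace (M * K ^ S q * exp_coef (t - a) (S q)) with (g t - g a)
        by (unfold g; rewrite Ha; ring).
      assert (HMK : 0 <= M * K ^ S q) by (apply Rmult_le_pos; auto; apply pow_le; auto).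
      apply (mvt_ae D g g' N a t (L + K')); try lra; auto.
      + intros s Hs eps He. exists (eps / (L + K' + 1)).
        split. apply Rdiv_lt_0_compat; lra. intros s' Hs' Hss.
        eapply Rle_trans; [apply HD; lra|]. rewrite Rabs_pos_eq by lra.
        apply Rmult_lt_compat_l with (r := L + K' + 1) in Hss; [|lra].
        replace ((L + K' + 1) * (eps / (L + K' + 1))) with eps in Hss by (field; lra). lra.
      + intros s Hs _ s' Hs'. rewrite <- (Rabs_pos_eq (s' - s)) by lra. apply HD; lra.
      + intros s Hs Ns.
        exists (csum (fun j => b k j * (x j s - csum (fun m => RtoC (exp_coef (s - a) m) * y m j) q))%C n).
        split.
        * eapply der_on_eq; [reflexivity| |].
          2: { apply der_on_minus. apply (Hder s ltac:(lra) Ns k Hk).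
            (* Differentiating t^(m+1) / (m+1)! shifts the index by one: the constant term m = 0
               drops, and [y (S m)] takes the place of [y m]. *)
            assert (HPd : rder_from s P s (csum (fun m => RtoC (exp_coef (s - a) m) * y (S m) k)%C q)).
            { unfold P. clear - HyS. induction q as [|q IH].
              - simpl. eapply der_on_eq; [| |apply der_on_const with (c := (RtoC 1 * y O k)%C)].
                intros w. unfold exp_coef; simpl. replace (1 / 1) with 1 by field. ring. reflexivity.
              - apply (der_on_plus _ (fun w => csum (fun m => RtoC (exp_coef (Re w - a) m) * y m k)%C (S q))
                  (fun w => RtoC (exp_coef (Re w - a) (S q)) * y (S q) k)%C); auto.
                eapply der_on_eq; [| |apply der_on_mult; [apply rder_rder_from, exp_coef_rder|apply der_on_const]].
                reflexivity. cbv beta. ring. }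
            exact HPd. }
          rewrite (csum_ext (fun m => RtoC (exp_coef (s - a) m) * y (S m) k)%C
             (fun m => csum (fun j => b k j * (RtoC (exp_coef (s - a) m) * y m j))%C n)).
          2: { intros m _. rewrite HyS by auto. rewrite <- csum_scal. apply csum_ext. intros; ring. }
          rewrite csum_comm. rewrite <- csum_minus. apply csum_ext. intros j _. rewrite csum_scal. ring.
        * replace (g' s) with (INR n * (B * (M * K ^ q * exp_coef (s - a) q))) by (unfold g', K; simpl; ring).
          apply csum_bound. intros j Hj. rewrite Cmod_mult.
          apply Rmult_le_compat; auto using Cmod_ge_0. apply IH; auto; lra.
      + intros s Hs. apply (derivable_pt_lim_scal (fun s => exp_coef (s - a) (S q))). apply exp_coef_deriv.
      + intros s s' H1 H2 H3. apply Rmult_le_compat_l; auto. apply exp_coef_mono; auto. }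
  intros eps He.
  (* x^q / q! tends to 0; dividing by M + 1 instead of M covers the case M = 0. *)
  destruct (cv_speed_pow_fact (K * (T - a)) (eps / (M + 1))) as [q0 Hq0].
  { apply Rdiv_lt_0_compat; lra. }
  exists q0. intros q Hq t k Ht Hk. eapply Rle_lt_trans; [apply key; auto|].
  specialize (Hq0 q Hq). unfold R_dist in Hq0. rewrite Rminus_0_r in Hq0.
  assert (E : M * K ^ q * exp_coef (T - a) q = M * ((K * (T - a)) ^ q / INR (fact q))).
  { unfold exp_coef. rewrite Rpow_mult_distr. unfold Rdiv. ring. }
  apply Rle_lt_trans with (M * K ^ q * exp_coef (T - a) q).
  { apply Rmult_le_compat_l. apply Rmult_le_pos; auto. apply pow_le; auto. apply exp_coef_mono; lra. }
  rewrite E. assert (Hle := Rle_abs ((K * (T - a)) ^ q / INR (fact q))).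
  assert (0 <= (K * (T - a)) ^ q / INR (fact q)).
  { apply Rdiv_le_0_compat. apply pow_le. apply Rmult_le_pos; lra. apply INR_fact_lt_0. }
  apply Rle_lt_trans with ((M + 1) * ((K * (T - a)) ^ q / INR (fact q))). nra.
  apply Rmult_lt_compat_l with (r := M + 1) in Hq0; [|lra].
  replace ((M + 1) * (eps / (M + 1))) with eps in Hq0 by (field; lra). nra.
Qed.

(** Conjugation commutes with this derivative because the increments w - z are real. *)
Lemma der_on_conj (U : C -> Prop) (f : C -> C) (z d : C) : (forall w, U w -> Im w = 0) -> Im z = 0 ->
  der_on U f z d -> der_on U (fun w => Cconj (f w)) z (Cconj d).
Proof.
  intros HU Hz H eps He. destruct (H eps He) as [del [Hd H']]. exists del; split; auto.
  intros w Uw Hw. rewrite <- Cmod_conj.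
  replace (Cconj (Cconj (f w) - Cconj (f z) - Cconj d * (w - z)))%C with (f w - f z - d * (w - z))%C.
  auto. specialize (HU w Uw).
  destruct w as [w1 w2], z as [z1 z2]. simpl in HU, Hz. subst.
  destruct (f (w1, 0)), (f (z1, 0)), d.
  unfold Cconj, Cminus, Cplus, Copp, Cmult; simpl. f_equal; ring.
Qed.

(* Gronwall: exp(-c (t - a)) (|v t|^2 + m) does not increase. *)
Lemma energy_estimate (v v' : R -> C) a T c m : a <= T ->
  (forall t, a <= t <= T -> rder_from a v t (v' t)) ->
  (forall t, a <= t <= T -> 2 * Re (Cconj (v t) * v' t) <= c * (Cmod (v t) ^ 2 + m)) ->
  Cmod (v T) ^ 2 + m <= exp (c * (T - a)) * (Cmod (v a) ^ 2 + m).
Proof.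
  intros HaT Hv Hin.
  set (W := fun t => (RtoC (exp (- c * (t - a))) * (RtoC (Cmod (v t) ^ 2) + RtoC m))%C).
  assert (HW : forall t, a <= t <= T -> exists d, rder_from a W t d /\ Re d <= 0).
  { intros t Ht. specialize (Hv t Ht).
    set (d := (RtoC (exp (- c * (t - a))) * (v' t * Cconj (v t) + v t * Cconj (v' t) - RtoC c * (RtoC (Cmod (v t) ^ 2) + RtoC m)))%C).
    exists d. split.
    - apply der_on_eq with (fun w => RtoC (exp (- c * (Re w - a))) * (v (Re w) * Cconj (v (Re w)) + RtoC m))%C
        (RtoC (exp (- c * (t - a)) * - c) * (v t * Cconj (v t) + RtoC m) + RtoC (exp (- c * (t - a))) * (v' t * Cconj (v t) + v t * Cconj (v' t) + 0))%C.
      + intros w. unfold W. rewrite Cmod2_conj. reflexivity.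
      + unfold d. rewrite <- Cmod2_conj, RtoC_mult, RtoC_opp. ring.
      + apply (der_on_mult _ (fun w => RtoC (exp (- c * (Re w - a))))
          (fun w => v (Re w) * Cconj (v (Re w)) + RtoC m)%C (RtoC t) (RtoC (exp (- c * (t - a)) * - c))
          (v' t * Cconj (v t) + v t * Cconj (v' t) + 0)%C).
        * apply (rder_rder_from a (fun t => RtoC (exp (- c * (t - a))))).
          apply (rder_pair (fun t => exp (- c * (t - a))) (fun _ => 0)).
          apply is_derive_Reals. auto_derive. auto. unfold Rminus. ring.
          apply derivable_pt_lim_const.
        * apply der_on_plus; [|apply der_on_const].
          apply (der_on_mult _ (fun w => v (Re w)) (fun w => Cconj (v (Re w))) (RtoC t)); auto.
          apply der_on_conj; auto. tauto.
    - assert (E : Re d = exp (- c * (t - a)) * (2 * Re (Cconj (v t) * v' t) - c * (Cmod (v t) ^ 2 + m))).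
      { unfold d. rewrite <- RtoC_plus, <- RtoC_mult. destruct (v t), (v' t). simpl. ring. }
      rewrite E. specialize (Hin t Ht). assert (0 < exp (- c * (t - a))) by apply exp_pos. nra. }
  assert (H : Re (W T) <= Re (W a)).
  { apply (real_mono (fun t => Re (W t)) (fun _ => False) a T 0); auto; try lra.
    - apply null_set_empty; auto.
    - intros x Hx eps He. destruct (HW x ltac:(lra)) as [d [Hd _]].
      destruct (rder_from_left _ _ _ _ Hd eps He) as [del [Hdel H]].
      exists del; split; auto. intros y Hy Hyx. specialize (H y Hy Hyx).
      assert (A := re_le_Cmod (W x - W y)). rewrite Re_minus in A.
      generalize (Rle_abs (Re (W x) - Re (W y))). lra.
    - intros x Hx _ eps He. destruct (HW x ltac:(lra)) as [d [Hd Hd0]].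
      destruct (proj1 (rder_from_iff _ _ _ _) Hd eps He) as [del [Hdel H]].
      exists del; split; auto. intros y Hy Hyx.
      assert (Eyx : Rabs (y - x) = y - x) by (apply Rabs_pos_eq; lra).
      specialize (H y ltac:(lra) ltac:(lra)). rewrite Eyx in H.
      assert (A := re_le_Cmod (W y - W x - d * (RtoC y - RtoC x))).
      rewrite <- RtoC_minus, !Re_minus, Re_mult_R in A.
      generalize (Rle_abs (Re (W y) - Re (W x) - Re d * (y - x))). rewrite <- RtoC_minus in H. nra.
    - intros x _ []. }
  assert (EW : forall t, Re (W t) = exp (- c * (t - a)) * (Cmod (v t) ^ 2 + m)).
  { intros t. unfold W. rewrite <- RtoC_plus, <- RtoC_mult. reflexivity. }
  rewrite !EW in H. replace (- c * (a - a)) with 0 in H by ring. rewrite exp_0, Rmult_1_l in H.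
  apply Rmult_le_reg_l with (exp (- c * (T - a))). apply exp_pos.
  rewrite <- Rmult_assoc, <- exp_plus. replace (- c * (T - a) + c * (T - a)) with 0 by ring.
  rewrite exp_0. lra.
Qed.

(** * Schwarz and Schwarz-Pick *)

(** If q < x, the powers (q/x)^n would stay above 1/A although they tend to 0. *)
Lemma le_of_pow_le x q A : 0 <= x -> 0 <= q -> (forall n, x ^ n <= A * q ^ n) -> x <= q.
Proof.
  intros Hx Hq H. apply Rnot_lt_le. intros Hlt.
  assert (HA : 1 <= A) by (specialize (H O); simpl in H; lra).
  destruct (pow_small (q / x) (/ (A + 1)) (Rdiv_small_1 _ _ Hq Hlt)) as [n Hn].
  apply Rinv_0_lt_compat; lra.
  specialize (Hn n (Nat.le_refl _)). specialize (H n).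
  assert (Hp : 0 < x ^ n) by (apply pow_lt; lra).
  assert (E : q ^ n = (q / x) ^ n * x ^ n).
  { rewrite <- Rpow_mult_distr. f_equal. field. lra. }
  rewrite E in H.
  apply Rmult_lt_compat_l with (r := A + 1) in Hn; [|lra].
  rewrite Rinv_r in Hn by lra.
  assert (0 <= (q / x) ^ n) by (apply pow_le, Rdiv_le_0_compat; lra). nra.
Qed.

(* F^n vanishes to order n at 0, so Cauchy's estimates give
   |F z|^n <= A (|z|/r)^n with A independent of n. *)
Lemma schwarz F : holo_ball 1 F -> (forall z, Cmod z < 1 -> Cmod (F z) <= 1) -> F 0 = 0 ->
  forall z, Cmod z < 1 -> Cmod (F z) <= Cmod z.
Proof.
  intros HF H1 H0 z Hz.
  assert (HJ : forall n, jet n (fun z => F z ^ n)%C (fun _ => 0)).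
  { intros n. destruct (HF 0) as [d Hd]. rewrite Cmod_0; lra.
    destruct (der_on_lip _ _ _ _ Hd) as [del [Hdel Hl]].
    apply (jet_O n _ ((Cmod d + 1) ^ n) del); auto. intros w Hw.
    rewrite Cmod_pow, <- Rpow_mult_distr. apply pow_incr. split. apply Cmod_ge_0.
    specialize (Hl w I). rewrite H0 in Hl.
    replace (w - 0)%C with w in Hl by ring. replace (F w - 0)%C with (F w) in Hl by ring.
    apply Hl. lra. }
  assert (key : forall r, Cmod z < r < 1 -> Cmod (F z) <= Cmod z / r).
  { intros r Hr. assert (Hz0 := Cmod_ge_0 z).
    apply (le_of_pow_le _ _ (2 * 1 * (r / (r - Cmod z)))). apply Cmod_ge_0.
    apply Rdiv_le_0_compat; lra. intros n.
    assert (HFn : holo_ball 1 (fun z => F z ^ n)%C).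
    { intros w Hw. destruct (HF w Hw) as [d Hd]. eexists. apply der_on_pow. exact Hd. }
    assert (HMn : forall w, Cmod w = r -> Cmod (F w ^ n) <= 1).
    { intros w Hw. rewrite Cmod_pow. rewrite <- (pow1 n). apply pow_incr.
      split. apply Cmod_ge_0. apply H1. lra. }
    destruct (cauchy_series _ 1 r 1 HFn ltac:(lra) HMn) as [_ Hs].
    specialize (Hs z ltac:(lra) n).
    rewrite csum_0 in Hs.
    2: { intros k Hk. rewrite (jet_unique n (fun z => F z ^ n)%C _ (fun _ => 0)
           (cauchy_jet _ 1 r 1 n HFn ltac:(lra) HMn) (HJ n) k Hk). ring. }
    replace (F z ^ n - 0)%C with (F z ^ n)%C in Hs by ring.
    rewrite Cmod_pow in Hs. lra. }
  apply le_of_le_eps. intros e He.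
  (* The radius tends to 1 while staying above |z|; the loss is |F z| (1 - r) <= e. *)
  set (r := Rmax (1 - e) ((1 + Cmod z) / 2)).
  assert (R1 : 1 - e <= r) by apply Rmax_l. assert (R2 : (1 + Cmod z) / 2 <= r) by apply Rmax_r.
  assert (R3 : r < 1) by (apply Rmax_lub_lt; lra).
  assert (Hz0 := Cmod_ge_0 z).
  specialize (key r ltac:(lra)). specialize (H1 z Hz).
  apply Rmult_le_compat_r with (r := r) in key; [|lra].
  unfold Rdiv in key. rewrite Rmult_assoc, Rinv_l, Rmult_1_r in key by lra.
  assert (Cmod (F z) * (1 - r) <= 1 * (1 - r)) by (apply Rmult_le_compat_r; lra). lra.
Qed.

(** The right side is non-negative when |c| and |g| are at most 1, so that (g - c) / (1 - conj(c) g)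
    has modulus at most 1. *)
Lemma moebius_identity (g c : C) :
  Cmod (1 - Cconj c * g) ^ 2 - Cmod (g - c) ^ 2 = (1 - Cmod c ^ 2) * (1 - Cmod g ^ 2).
Proof.
  rewrite !Cmod2_alt. destruct g as [g1 g2], c as [c1 c2]. simpl. ring.
Qed.

(** Schwarz's lemma is applied to g followed by the Moebius map that sends g 0 to 0. As g may reach
    modulus 1, where the denominator can vanish, the argument is run for l g with l < 1, and l then
    tends to 1. *)
Lemma schwarz_pick g : holo_ball 1 g -> (forall z, Cmod z < 1 -> Cmod (g z) <= 1) ->
  forall z, Cmod z < 1 ->
    Cmod (g z - g 0) * (1 - Cmod z) <= Cmod z * (1 - Cmod (g 0) ^ 2).
Proof.
  intros Hg H1 z Hz.
  assert (H10 : Cmod (g 0) <= 1) by (apply H1; rewrite Cmod_0; lra).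
  assert (key : forall l, 0 < l < 1 ->
    l * Cmod (g z - g 0) * (1 - Cmod z) <= Cmod z * (1 - l ^ 2 * Cmod (g 0) ^ 2)).
  { intros l Hl.
    set (h := fun w => (RtoC l * g w)%C). set (c := h 0).
    assert (Hh : forall w, Cmod w < 1 -> Cmod (h w) <= l).
    { intros w Hw. unfold h. rewrite Cmod_mult, Cmod_Rabs_RtoC by lra. specialize (H1 w Hw). nra. }
    assert (Hc : Cmod c <= l) by (apply Hh; rewrite Cmod_0; lra).
    assert (Hc0 := Cmod_ge_0 c).
    assert (Hden : forall w, Cmod w < 1 -> (1 - Cconj c * h w)%C <> 0).
    { intros w Hw E. assert (Cmod (Cconj c * h w) < 1).
      { rewrite Cmod_mult, Cmod_conj. specialize (Hh w Hw). generalize (Cmod_ge_0 (h w)). nra. }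
      replace (Cconj c * h w)%C with (RtoC 1) in H. rewrite Cmod_1 in H. lra.
      symmetry. replace (Cconj c * h w)%C with (1 - (1 - Cconj c * h w))%C by ring. rewrite E. ring. }
    assert (S : Cmod ((h z - c) / (1 - Cconj c * h z)) <= Cmod z).
    { apply (schwarz (fun w => (h w - c) / (1 - Cconj c * h w))%C); auto.
      - intros w Hw. destruct (Hg w Hw) as [d Hd]. eexists. apply der_on_div. apply Hden; auto.
        apply der_on_minus. apply der_on_scal. exact Hd. apply der_on_const.
        apply der_on_minus. apply der_on_const. apply der_on_scal. apply der_on_scal. exact Hd.
      - intros w Hw. rewrite Cmod_div by (apply Hden; auto).
        assert (Hp := proj1 (Cmod_gt_0 _) (Hden w Hw)).
        apply Rmult_le_reg_r with (1 := Hp). unfold Rdiv. rewrite Rmult_assoc, Rinv_l, Rmult_1_l, Rmult_1_r by lra.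
        apply Rsqr_incr_0_var; [|lra]. rewrite !Rsqr_pow2.
        assert (M := moebius_identity (h w) c). specialize (Hh w Hw).
        generalize (Cmod_ge_0 (h w)). intros.
        assert (0 <= (1 - Cmod c ^ 2) * (1 - Cmod (h w) ^ 2)); [|lra].
        apply Rmult_le_pos; nra.
      - unfold c. replace (h 0 - h 0)%C with (RtoC 0) by ring. unfold Cdiv. ring. }
    assert (Hp := proj1 (Cmod_gt_0 _) (Hden z Hz)).
    rewrite Cmod_div in S by (apply Hden; auto).
    apply Rmult_le_compat_r with (r := Cmod (1 - Cconj c * h z)) in S; [|lra].
    unfold Rdiv in S. rewrite Rmult_assoc, Rinv_l, Rmult_1_r in S by lra.
    (* Writing the denominator as (1 - |c|^2) - conj(c) (h z - c) turns Schwarz's bound into one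
       that is linear in |h z - c|. *)
    assert (T : Cmod (1 - Cconj c * h z) <= (1 - Cmod c ^ 2) + 1 * Cmod (h z - c)).
    { eapply (Cmod_tri (RtoC (1 - Cmod c ^ 2)) (- (Cconj c * (h z - c)))).
      - rewrite RtoC_minus, Cmod2_conj. ring.
      - rewrite Cmod_Rabs_RtoC by nra. lra.
      - rewrite Cmod_opp, Cmod_mult, Cmod_conj. apply Rmult_le_compat_r. apply Cmod_ge_0. lra. }
    assert (Eh : Cmod (h z - c) = l * Cmod (g z - g 0)).
    { unfold c, h. replace (l * g z - l * g 0)%C with (RtoC l * (g z - g 0))%C by ring.
      rewrite Cmod_mult, Cmod_Rabs_RtoC by lra. reflexivity. }
    assert (Ec : Cmod c ^ 2 = l ^ 2 * Cmod (g 0) ^ 2).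
    { unfold c, h. rewrite Cmod_mult, Cmod_Rabs_RtoC by lra. ring. }
    rewrite <- Ec, <- Eh. assert (Hz0 := Cmod_ge_0 z).
    assert (Cmod z * Cmod (1 - Cconj c * h z) <= Cmod z * (1 - Cmod c ^ 2 + 1 * Cmod (h z - c)))
      by (apply Rmult_le_compat_l; auto). lra. }
  apply le_of_le_eps. intros e He.
  set (l := Rmax (1 / 2) (1 - e / 4)).
  assert (L1 : 1 / 2 <= l) by apply Rmax_l. assert (L2 : 1 - e / 4 <= l) by apply Rmax_r.
  assert (L3 : l < 1) by (apply Rmax_lub_lt; lra).
  specialize (key l ltac:(lra)).
  assert (Hz0 := Cmod_ge_0 z). assert (Hg0 := Cmod_ge_0 (g 0)).
  assert (Hd : Cmod (g z - g 0) <= 2) by (generalize (Cmod_sub_le (g z) (g 0)) (H1 z Hz); lra).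
  assert (Hd0 := Cmod_ge_0 (g z - g 0)).
  set (D := Cmod (g z - g 0)) in *. set (x := Cmod z) in *. set (q := Cmod (g 0)) in *.
  assert (Hq : 0 <= q ^ 2 <= 1) by nra.
  assert (A1 : (1 - l) * (D * (1 - x)) <= (1 - l) * 2) by (apply Rmult_le_compat_l; nra).
  assert (A2 : (1 - l ^ 2) * (x * q ^ 2) <= (1 - l ^ 2) * 1).
  { apply Rmult_le_compat_l; nra. }
  assert (A3 : 1 - l ^ 2 <= 2 * (1 - l)) by nra. nra.
Qed.

Lemma jet2_holo R0 f d : 0 < R0 -> holo_ball R0 f -> cder f 0 d ->
  jet 2 f (fun k => match k with O => f 0 | S _ => d end).
Proof.
  intros HR Hf Hd. destruct (holo_ball_bounded f R0 (R0 / 2) Hf) as [M [_ HM]]. lra.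
  destruct (taylor2 f (R0 / 2) M) as [d' [H1 [_ H2]]].
  lra. apply holo_ball_mono with R0; auto; lra. intros z Hz. apply HM. lra.
  replace d with d' by (eapply cder_unique; eauto).
  exists (16 * M / (R0 / 2 * (R0 / 2))), (R0 / 2 / 4). split. lra.
  intros z Hz. simpl. replace (f z - (0 + f 0 * 1 + d' * (z * 1)))%C with (f z - f 0 - d' * z)%C by ring.
  rewrite Rmult_1_r. apply H2. lra.
Qed.

Lemma power_coef_0 R0 f : 0 < R0 -> holo_ball R0 f -> power_coef f 0 = f 0.
Proof.
  intros HR Hf. destruct (Hf 0) as [d Hd]. rewrite Cmod_0; auto.
  rewrite (power_coef_eq R0 f 2 _ 0 HR Hf (jet2_holo R0 f d HR Hf Hd)); auto.
Qed.

Lemma power_coef_1 R0 f d : 0 < R0 -> holo_ball R0 f -> cder f 0 d -> power_coef f 1 = d.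
Proof.
  intros HR Hf Hd.
  rewrite (power_coef_eq R0 f 2 _ 1 HR Hf (jet2_holo R0 f d HR Hf Hd)); auto.
Qed.

Lemma cder_local f g z d del : 0 < del -> (forall w, Cmod (w - z) < del -> f w = g w) ->
  cder f z d -> cder g z d.
Proof.
  intros Hdel H. apply der_on_ext.
  exists del; auto. apply H. replace (z - z)%C with (RtoC 0) by ring. rewrite Cmod_0; auto.
Qed.

(* Schwarz-Pick applied to phi(z)/z. *)
Lemma self_map_near_id phi c : holo_ball 1 phi -> (forall z, Cmod z < 1 -> Cmod (phi z) <= 1) ->
  phi 0 = 0 -> cder phi 0 c -> Cmod c <= 1 /\
  forall z, Cmod z <= 1 / 2 -> Cmod (phi z - z) <= Cmod (1 - c) + (1 - Cmod c ^ 2).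
Proof.
  intros Hphi H1 H0 Hc.
  assert (HS := schwarz phi Hphi H1 H0).
  assert (Hc1 : Cmod c <= 1).
  { apply le_of_le_eps. intros e He. destruct (Hc e He) as [del [Hdel Hd]].
    destruct (small2 (1 / 2) (del / 2)) as [s [Hs [S1 S2]]]; try lra.
    assert (Es : Cmod (RtoC s) = s) by (apply Cmod_Rabs_RtoC; lra).
    specialize (Hd (RtoC s) I). rewrite H0 in Hd.
    replace (RtoC s - 0)%C with (RtoC s) in Hd by ring. specialize (Hd ltac:(lra)).
    specialize (HS (RtoC s) ltac:(lra)). rewrite Es in *.
    assert (A : Cmod (c * RtoC s) <= s + e * s).
    { eapply (Cmod_tri (phi s) (- (phi s - 0 - c * s))); [|exact HS|]. ring.
      rewrite Cmod_opp. exact Hd. }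
    rewrite Cmod_mult, Es in A. nra. }
  split; auto.
  (* The quotient phi(z)/z, with its removable singularity filled by phi'(0) = c. *)
  set (g := fun z => if Ceq_dec z 0 then c else (phi z / z)%C).
  assert (Eg : forall z : C, z <> 0 -> g z = (phi z / z)%C).
  { intros z Hz. unfold g. destruct (Ceq_dec z 0); congruence. }
  assert (Eg0 : g 0 = c) by (unfold g; destruct (Ceq_dec 0 0); congruence).
  assert (Hg : holo_ball 1 g).
  { intros z Hz. destruct (Ceq_dec z 0) as [->|Hz0].
    (* Differentiability of the quotient at 0 is read off the jet of phi of order three; the
       derivative is the coefficient of z^2. *)
    - assert (HJ := power_coef_jet 1 phi 3 Rlt_0_1 Hphi).
      assert (C0 := power_coef_0 1 phi Rlt_0_1 Hphi).
      assert (C1 := power_coef_1 1 phi c Rlt_0_1 Hphi Hc).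
      destruct (jet_bound _ _ _ HJ) as [M [r [HM [Hr [_ HJ']]]]].
      exists (power_coef phi 2). intros e He.
      destruct (small_mult M e HM He) as [d1 [Hd1 Hsm]].
      generalize (nearby_and _ _ _ _ (nearby_ball (fun _ => True) 0 r Hr) (nearby_ball _ 0 d1 Hd1)).
      apply nearby_imp. intros w _ [W1 W2]. rewrite Eg0. replace (w - 0)%C with w in * by ring.
      destruct (Ceq_dec w 0) as [->|Hw0].
      { rewrite Eg0. replace (c - c - power_coef phi 2 * 0)%C with (RtoC 0) by ring.
        rewrite Cmod_0. lra. }
      rewrite Eg by auto. assert (Wp := proj1 (Cmod_gt_0 w) Hw0).
      specialize (HJ' w (conj Wp W1)). simpl in HJ'. rewrite C0, C1, H0 in HJ'.
      replace (phi w / w - c - power_coef phi 2 * w)%C with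
        ((phi w - (0 + 0 * 1 + c * (w * 1) + power_coef phi 2 * (w * (w * 1)))) / w)%C by (field; auto).
      rewrite Cmod_div by auto. apply Rle_div_l; [exact Wp|].
      eapply Rle_trans; [exact HJ'|].
      replace (M * (Cmod w * (Cmod w * (Cmod w * 1)))) with (M * Cmod w * Cmod w * Cmod w) by ring.
      specialize (Hsm (Cmod w) ltac:(lra)).
      apply Rmult_le_compat_r. lra. apply Rmult_le_compat_r; lra.
    - destruct (Hphi z Hz) as [d Hd]. eexists.
      apply (cder_local (fun z => phi z / z)%C g z _ (Cmod z)).
      apply Cmod_gt_0; auto.
      intros w Hw. symmetry. apply Eg. intros ->. rewrite Cmod_sub_sym in Hw.
      replace (z - 0)%C with z in Hw by ring. lra.
      apply der_on_div; auto. exact Hd. apply der_on_id. }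
  assert (Hg1 : forall z, Cmod z < 1 -> Cmod (g z) <= 1).
  { intros z Hz. destruct (Ceq_dec z 0) as [->|Hz0]. rewrite Eg0; auto.
    rewrite Eg, Cmod_div by auto. assert (Hp := proj1 (Cmod_gt_0 z) Hz0).
    apply Rle_div_l; [exact Hp|].
    specialize (HS z Hz). lra. }
  intros z Hz. destruct (Ceq_dec z 0) as [->|Hz0].
  { rewrite H0. replace (0 - 0)%C with (RtoC 0) by ring. rewrite Cmod_0.
    generalize (Cmod_ge_0 (1 - c)) (Cmod_ge_0 c). nra. }
  assert (A := schwarz_pick g Hg Hg1 z ltac:(lra)). rewrite Eg0 in A.
  assert (Hd0 := Cmod_ge_0 (g z - c)). assert (Hp := proj1 (Cmod_gt_0 z) Hz0).
  assert (Hc0 := Cmod_ge_0 c).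
  (* Here |z| / (1 - |z|) <= 1, because |z| <= 1/2. *)
  assert (B : Cmod (g z - c) <= 1 - Cmod c ^ 2) by nra.
  replace (phi z - z)%C with (z * (g z - 1))%C by (rewrite Eg by auto; field; auto).
  assert (B' : Cmod (g z - 1) <= Cmod (1 - c) + (1 - Cmod c ^ 2)).
  { eapply (Cmod_tri (c - 1) (g z - c)); [ring| |exact B]. rewrite Cmod_sub_sym. lra. }
  rewrite Cmod_mult. generalize (Cmod_ge_0 (g z - 1)). nra.
Qed.

(** * Univalent functions *)

Lemma C_complete (s : nat -> C) :
  (forall eps, 0 < eps -> exists N, forall n m, (N <= n)%nat -> (N <= m)%nat -> Cmod (s n - s m) < eps) ->
  exists l : C, forall eps, 0 < eps -> exists N, forall n, (N <= n)%nat -> Cmod (s n - l) < eps.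
Proof.
  intros H.
  destruct (Rcomplete.R_complete (fun n => Re (s n))) as [x Hx].
  { intros eps He. destruct (H eps He) as [N HN]. exists N. intros n m Hn Hm.
    unfold R_dist. rewrite <- Re_minus. eapply Rle_lt_trans; [apply re_le_Cmod|auto]. }
  destruct (Rcomplete.R_complete (fun n => Im (s n))) as [y Hy].
  { intros eps He. destruct (H eps He) as [N HN]. exists N. intros n m Hn Hm.
    unfold R_dist. replace (Im (s n) - Im (s m)) with (Im (s n - s m)) by reflexivity.
    eapply Rle_lt_trans; [apply im_le_Cmod|auto]. }
  exists (x, y). intros eps He.
  destruct (Hx (eps / 2) ltac:(lra)) as [N1 H1]. destruct (Hy (eps / 2) ltac:(lra)) as [N2 H2].
  exists (N1 + N2)%nat. intros n Hn.
  specialize (H1 n ltac:(lia)). specialize (H2 n ltac:(lia)). unfold R_dist in *.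
  destruct (s n) as [a b]. simpl in *.
  eapply Rle_lt_trans; [apply Cmod_le_sum|]. simpl. unfold Rminus in *. lra.
Qed.

Lemma contraction_zero (F : C -> C) (A : C) (sig rho : R) : A <> 0 -> 0 < sig < rho ->
  (forall s, Cmod s < rho -> exists d, cder F s d /\ Cmod (d - A) <= Cmod A / 2) ->
  Cmod (F 0) <= Cmod A * sig / 2 -> exists s, Cmod s <= sig /\ F s = 0.
Proof.
  intros HA Hsig HF HF0.
  assert (HAp := proj1 (Cmod_gt_0 A) HA).
  set (T := fun s => (s - F s / A)%C).
  assert (HT : forall u v, Cmod u < rho -> Cmod v < rho -> Cmod (T u - T v) <= 1 / 2 * Cmod (u - v)).
  { intros u v Hu Hv. assert (E0 : forall z, (z - 0)%C = z) by (intros; ring).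
    apply (cder_lipschitz T 0 rho); rewrite ?E0; auto.
    intros s Hs. rewrite E0 in Hs. destruct (HF s Hs) as [d [Hd HdA]].
    exists (1 - d / A)%C. split.
    - apply der_on_minus. apply der_on_id.
      eapply der_on_eq; [| |apply (der_on_scal _ (/ A)%C F s d Hd)].
      intros w. unfold Cdiv. ring. unfold Cdiv. ring.
    - replace (1 - d / A)%C with (- ((d - A) / A))%C by (field; auto).
      rewrite Cmod_opp, Cmod_div by auto.
      apply Rle_div_l; [exact HAp|]. lra. }
  assert (HT0 : Cmod (T 0) <= sig / 2).
  { unfold T. replace (0 - F 0 / A)%C with (- (F 0 / A))%C by ring.
    rewrite Cmod_opp, Cmod_div by auto. apply Rle_div_l; [exact HAp|]. lra. }
  assert (HTb : forall s, Cmod s <= sig -> Cmod (T s) <= sig).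
  { intros s Hs. replace sig with (1 / 2 * sig + sig / 2) by field.
    eapply (Cmod_tri (T s - T 0) (T 0)); [ring| |auto].
    eapply Rle_trans; [apply HT; rewrite ?Cmod_0; lra|].
    replace (s - 0)%C with s by ring. lra. }
  set (s := fix s n := match n with O => RtoC 0 | S m => T (s m) end).
  assert (Hs : forall n, Cmod (s n) <= sig).
  { induction n as [|n IH]; simpl. rewrite Cmod_0; lra. auto. }
  assert (Hst : forall n, Cmod (s (S n) - s n) <= sig * (1 / 2) ^ n).
  { induction n as [|n IH].
    - simpl. replace (T 0 - 0)%C with (T 0) by ring. lra.
    - change (Cmod (T (s (S n)) - T (s n)) <= sig * (1 / 2) ^ S n).
      eapply Rle_trans; [apply HT; eapply Rle_lt_trans; try apply Hs; lra|].
      replace (sig * (1 / 2) ^ S n) with (1 / 2 * (sig * (1 / 2) ^ n)) by (simpl; ring). lra. }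
  assert (Ecs : forall n, s n = csum (fun k => s (S k) - s k)%C n).
  { induction n as [|n IH]. reflexivity.
    change (s (S n) = (csum (fun k => s (S k) - s k)%C n + (s (S n) - s n))%C). rewrite <- IH. ring. }
  assert (Hcau : forall n m, (n <= m)%nat -> Cmod (s m - s n) <= sig * (1 / 2) ^ n * 2).
  { intros n m Hnm. rewrite (Ecs m), (Ecs n).
    eapply Rle_trans; [apply (csum_geom_bound _ n m sig (1 / 2)); auto; lra|].
    right. field. }
  destruct (C_complete s) as [l Hl].
  { intros eps He. destruct (small_mult (sig * 2) (eps / 2)) as [d [Hd Hsm]]; try lra.
    destruct (pow_small (1 / 2) d ltac:(lra) Hd) as [N HN].
    exists N. assert (W : forall n m, (N <= n)%nat -> (n <= m)%nat -> Cmod (s m - s n) < eps).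
    { intros n m Hn Hnm. eapply Rle_lt_trans; [apply Hcau; auto|].
      specialize (HN n Hn). assert (0 < (1 / 2) ^ n) by (apply pow_lt; lra).
      specialize (Hsm ((1 / 2) ^ n) ltac:(lra)). lra. }
    intros n m Hn Hm. destruct (Nat.le_ge_cases n m).
    rewrite Cmod_sub_sym. apply W; auto. apply W; auto. }
  assert (Hlsig : Cmod l <= sig).
  { apply le_of_le_eps. intros e He. destruct (Hl e He) as [N HN].
    specialize (HN N (Nat.le_refl _)). rewrite Cmod_sub_sym in HN.
    generalize (Cmod_sub_ge l (s N)) (Hs N). lra. }
  exists l. split; auto.
  assert (ETl : T l = l).
  { apply Ceq_le_eps. intros e He. destruct (Hl (e / 2) ltac:(lra)) as [N HN].
    assert (A1 := HN N ltac:(lia)). assert (A2 := HN (S N) ltac:(lia)).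
    replace e with (e / 2 + e / 2) by field.
    eapply (Cmod_tri (T l - T (s N)) (s (S N) - l)).
    simpl. ring. 2: lra.
    eapply Rle_trans. apply HT. lra. eapply Rle_lt_trans; [apply Hs|lra].
    rewrite Cmod_sub_sym. lra. }
  unfold T in ETl. assert (E : (F l / A)%C = 0).
  { replace (F l / A)%C with (l - (l - F l / A))%C by ring. rewrite ETl. ring. }
  replace (F l) with (F l / A * A)%C by (field; auto). rewrite E. ring.
Qed.

Lemma holo_C_derive R0 f z : holo_ball R0 f -> Cmod z < R0 -> cder f z (C_derive f z).
Proof.
  intros Hf Hz. destruct (Hf z Hz) as [d Hd]. rewrite (C_derive_cder f z d Hd). exact Hd.
Qed.

(** By the jet of the derivative, f' stays within |A|/2 of A near 0; [contraction_zero] applied to f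
    - y then solves f s = y. *)
Lemma local_surjective R0 f A : 0 < R0 -> holo_ball R0 f -> cder f 0 A -> A <> 0 ->
  forall eps, 0 < eps -> exists del, 0 < del /\
    forall y, Cmod (y - f 0) < del -> exists z, Cmod z < eps /\ f z = y.
Proof.
  intros HR Hf HA HA0 eps He.
  assert (HAp := proj1 (Cmod_gt_0 A) HA0).
  assert (HJ := jet_deriv 1 f (C_derive f) _ R0 HR (fun z => holo_C_derive R0 f z Hf)
    (power_coef_jet R0 f 2 HR Hf)).
  destruct (jet_bound _ _ _ HJ) as [M [r [HM [Hr [_ HJ']]]]].
  destruct (small_mult M (Cmod A / 2) HM) as [d0 [Hd0 Hsm]]; [lra|].
  destruct (small3 r R0 eps) as [rho1 [Hrho1 B1]]; auto.
  destruct (small2 rho1 d0) as [rho [Hrho B2]]; auto.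
  exists (Cmod A * (rho / 2) / 2). split.
  { apply Rdiv_lt_0_compat; [|lra]. apply Rmult_lt_0_compat; lra. }
  intros y Hy.
  destruct (contraction_zero (fun s => f s - y)%C A (rho / 2) rho HA0) as [s [Hs Es]].
  - lra.
  - intros s Hs. exists (C_derive f s). split.
    + replace (C_derive f s) with (C_derive f s - 0)%C by ring.
      apply der_on_minus; [apply (holo_C_derive R0); auto; lra|apply der_on_const].
    + destruct (Ceq_dec s 0) as [->|Hs0].
      * rewrite (C_derive_cder _ _ _ HA). replace (A - A)%C with (RtoC 0) by ring. rewrite Cmod_0. lra.
      * assert (Hsp := proj1 (Cmod_gt_0 s) Hs0). specialize (HJ' s ltac:(lra)).
        simpl in HJ'. rewrite (power_coef_1 R0 f A HR Hf HA) in HJ'.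
        replace (0 + 1 * A * 1)%C with A in HJ' by ring.
        eapply Rle_trans; [exact HJ'|]. rewrite Rmult_1_r. apply Hsm. lra.
  - rewrite Cmod_sub_sym. lra.
  - exists s. split. lra. apply Cminus_eq_0; auto.
Qed.

Lemma constant_of_coefs R0 f : 0 < R0 -> holo_ball R0 f ->
  (forall k, (0 < k)%nat -> power_coef f k = 0) -> forall z, Cmod z < R0 / 2 -> f z = f 0.
Proof.
  intros HR Hf Hk z Hz. destruct (holo_ball_circ_bounded f R0 (R0 / 2) Hf) as [M HM]. lra.
  destruct (cauchy_series f R0 (R0 / 2) M Hf ltac:(lra) HM) as [_ Hs].
  assert (Ec : forall k, cauchy_coef f (R0 / 2) k = power_coef f k).
  { intros k. symmetry. apply (power_coef_eq R0 f (S k)); auto.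
    apply (cauchy_jet f R0 (R0 / 2) M); auto; lra. }
  assert (HM0 : 0 <= M) by (apply (circ_bound_pos _ (R0 / 2) _ ltac:(lra) HM)).
  apply Ceq_le_eps. intros e He.
  assert (Hq := Rdiv_small_1 _ _ (Cmod_ge_0 z) Hz).
  set (K := 2 * M * (R0 / 2 / (R0 / 2 - Cmod z))).
  assert (HK : 0 <= K) by (apply Rmult_le_pos; [lra|apply Rdiv_le_0_compat; lra]).
  destruct (small_mult K e HK He) as [d [Hd Hsm]].
  destruct (pow_small _ d Hq Hd) as [N HN].
  specialize (HN (S N) ltac:(lia)). specialize (Hs z Hz (S N)).
  rewrite csum_shift, csum_0 in Hs.
  2: { intros k _. rewrite Ec, Hk by lia. ring. }
  rewrite Ec, (power_coef_0 R0 f HR Hf) in Hs.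
  replace (f 0 * z ^ 0 + 0)%C with (f 0) in Hs by (simpl; ring).
  eapply Rle_trans; [exact Hs|].
  assert (0 <= (Cmod z / (R0 / 2)) ^ S N) by (apply pow_le; lra).
  specialize (Hsm _ (conj H (Rlt_le _ _ HN))). unfold K in *. lra.
Qed.

Lemma least_nonzero (c : nat -> C) k : c k <> 0 -> exists m, (m <= k)%nat /\ c m <> 0 /\
  forall j, (j < m)%nat -> c j = 0.
Proof.
  induction k as [k IH] using lt_wf_ind. intros Hk.
  destruct (classic (exists j, (j < k)%nat /\ c j <> 0)) as [[j [Hj Hcj]]|Hno].
  - destruct (IH j Hj Hcj) as [m [H1 H2]]. exists m. split; auto. lia.
  - exists k. repeat split; auto. intros j Hj. apply NNPP. intros H. apply Hno. eauto.
Qed.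

Lemma cis_pow t n : (cis t ^ n)%C = cis (INR n * t).
Proof.
  induction n as [|n IH].
  - simpl. rewrite Rmult_0_l. unfold cis. rewrite cos_0, sin_0. reflexivity.
  - rewrite Cpow_S, IH, S_INR. unfold cis, Cmult; simpl.
    replace ((INR n + 1) * t) with (t + INR n * t) by ring. rewrite cos_plus, sin_plus.
    f_equal; ring.
Qed.

Lemma root_of_unity m : (2 <= m)%nat -> exists w : C, (w ^ m)%C = 1 /\ w <> 1 /\ Cmod w = 1.
Proof.
  intros Hm. assert (HP := PI_RGT_0). assert (H2 : 2 <= INR m) by (apply (le_INR 2); auto).
  exists (cis (2 * PI / INR m)). split; [|split].
  - rewrite cis_pow. replace (INR m * (2 * PI / INR m)) with (0 + 2 * PI) by (field; lra).
    rewrite cis_period. unfold cis. rewrite cos_0, sin_0. reflexivity.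
  - intros E. injection E as E1 _.
    assert (0 < 2 * PI / INR m) by (apply Rdiv_lt_0_compat; lra).
    assert (2 * PI / INR m <= PI).
    { apply Rmult_le_reg_r with (INR m). lra. unfold Rdiv; rewrite Rmult_assoc, Rinv_l by lra. nra. }
    apply cos_eq_1_PI in E1; lra.
  - apply Cmod_cis.
Qed.

(* If f = f 0 + c z^m + O(z^(m+1)) with m >= 2, and w^m = 1 with w <> 1, then the equation
   f(w t (1+s)) = f(t) has a small solution s, which contradicts injectivity. *)
Lemma injective_deriv_nz R0 f d : 0 < R0 -> holo_ball R0 f ->
  (forall z1 z2, Cmod z1 < R0 -> Cmod z2 < R0 -> f z1 = f z2 -> z1 = z2) ->
  cder f 0 d -> d <> 0.
Proof.
  intros HR Hf Hinj Hd E. subst d.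
  (* Index 0 is masked, so that the first nonzero entry gives the order of f - f 0. *)
  set (c := fun k => match k with O => RtoC 0 | S _ => power_coef f k end).
  assert (Hex : exists k, c k <> 0).
  { apply NNPP. intros Hno.
    assert (E : f (RtoC (R0 / 4)) = f 0).
    { apply (constant_of_coefs R0); auto.
      - intros k Hk. apply NNPP. intros H. apply Hno. exists k. destruct k; [lia|exact H].
      - rewrite Cmod_Rabs_RtoC; lra. }
    apply Hinj in E; rewrite ?Cmod_0, ?Cmod_Rabs_RtoC; try lra.
    apply RtoC_inj in E. lra. }
  destruct Hex as [k Hk]. destruct (least_nonzero c k Hk) as [m [_ [Hm Hlt]]].
  assert (Hm2 : (2 <= m)%nat).
  { destruct m as [|[|m]]; [exfalso; apply Hm; reflexivity| |lia].
    exfalso; apply Hm. apply (power_coef_1 R0 f 0 HR Hf Hd). }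
  assert (Ecm : power_coef f m = c m) by (destruct m; [lia|reflexivity]).
  set (cm := c m) in *.
  assert (Hlow : forall j, (0 < j < m)%nat -> power_coef f j = 0).
  { intros j Hj. rewrite <- (Hlt j) by lia. destruct j; [lia|reflexivity]. }
  destruct (jet_bound _ _ _ (power_coef_jet R0 f (S m) HR Hf)) as [M [r [HM [Hr [_ HJ]]]]].
  assert (HJd := jet_deriv m f (C_derive f) _ R0 HR (fun z => holo_C_derive R0 f z Hf)
    (power_coef_jet R0 f (S m) HR Hf)).
  destruct (jet_bound _ _ _ HJd) as [M' [r' [HM' [Hr' [_ HJ']]]]].
  assert (HJ1 : forall z, 0 < Cmod z < r -> Cmod (f z - f 0 - cm * z ^ m) <= M * Cmod z ^ S m).
  { intros z Hz. replace (f z - f 0 - cm * z ^ m)%C with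
      (f z - csum (fun k => power_coef f k * z ^ k)%C (S m))%C. auto.
    simpl. destruct m as [|m']; [lia|]. rewrite csum_shift, csum_0.
    rewrite (power_coef_0 R0 f HR Hf), Ecm. simpl. ring.
    intros j Hj. rewrite Hlow by lia. ring. }
  assert (HJ2 : forall z, 0 < Cmod z < r' -> Cmod (C_derive f z - RtoC (INR m) * cm * z ^ (m - 1)) <= M' * Cmod z ^ m).
  { intros z Hz. replace (C_derive f z - RtoC (INR m) * cm * z ^ (m - 1))%C with
      (C_derive f z - csum (fun k => RtoC (INR (S k)) * power_coef f (S k) * z ^ k)%C m)%C. auto.
    destruct m as [|m']; [lia|].
    change (csum (fun k => RtoC (INR (S k)) * power_coef f (S k) * z ^ k)%C (S m')) with
      (csum (fun k => RtoC (INR (S k)) * power_coef f (S k) * z ^ k)%C m' +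
       RtoC (INR (S m')) * power_coef f (S m') * z ^ m')%C.
    rewrite csum_0.
    rewrite Ecm. replace (S m' - 1)%nat with m' by lia. ring.
    intros j Hj. rewrite Hlow by lia. ring. }
  destruct (root_of_unity m Hm2) as [w [Hwm [Hw1 Hwn]]].
  assert (Hwp : 0 < Cmod (1 - w)).
  { apply Cmod_gt_0. intros E. apply Hw1. symmetry. apply Cminus_eq_0; auto. }
  assert (Hcmp := proj1 (Cmod_gt_0 cm) Hm).
  assert (Hmpos : 2 <= INR m) by (apply (le_INR 2); auto).
  assert (HmC : RtoC (INR m) <> 0) by (intros E; apply RtoC_inj in E; lra).
  assert (Hcont : exists rho0, 0 < rho0 /\ forall s, Cmod s < rho0 -> Cmod ((1 + s) ^ (m - 1) - 1) < 1 / 4).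
  { assert (Hd1 : exists d, cder (fun s => (1 + s) ^ (m - 1))%C 0 d).
    { eexists. apply der_on_pow. apply der_on_plus. apply der_on_const. apply der_on_id. }
    destruct Hd1 as [d1 Hd1]. destruct (der_on_cont _ _ _ _ Hd1 (1 / 4) ltac:(lra)) as [del [Hdel H]].
    exists del; split; auto. intros s Hs. specialize (H s I).
    replace (s - 0)%C with s in H by ring. replace (1 + 0)%C with (RtoC 1) in H by ring.
    rewrite Cpow_1_l in H. auto. }
  destruct Hcont as [rho0 [Hrho0 Hcont]].
  (* The bound rho <= |1 - w| prepares the contradiction: injectivity forces w (1 + s) = 1, so |s| =
     |1 - w|, while |s| <= rho/2. *)
  destruct (small3 rho0 1 (Cmod (1 - w))) as [rho [Hrho Brho]]; auto; [lra|].
  set (K := M' * 2 ^ m + 2 * M + 1).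
  assert (HK : 0 < K).
  { assert (0 <= M' * 2 ^ m) by (apply Rmult_le_pos; auto; apply pow_le; lra). unfold K; lra. }
  destruct (small_mult (4 * K) (Cmod cm * rho)) as [d0 [Hd0 Hsm]]; [lra|apply Rmult_lt_0_compat; auto|].
  destruct (small3 (r / 4) (r' / 4) (R0 / 4)) as [t1 [Ht1 B1]]; try lra.
  destruct (small2 t1 d0) as [t [Ht B2]]; auto.
  assert (HtK := Hsm t ltac:(lra)).
  assert (Et : Cmod (RtoC t) = t) by (apply Cmod_Rabs_RtoC; lra).
  assert (HtC : RtoC t <> 0) by (apply Cmod_pos_nz; lra).
  assert (HtmC : (RtoC t ^ m)%C <> 0) by (apply Cpow_nz; auto).
  assert (Htm : 0 < t ^ m) by (apply pow_lt; auto).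
  (* This normalises the equation: (f(w t (1 + s)) - f t) / (cm t^m) is close to (1 + s)^m - 1,
     whose slope at s = 0 is m. *)
  set (den := (cm * RtoC t ^ m)%C).
  assert (Hden : den <> 0) by (apply Cmult_neq_0; auto).
  assert (Eden : Cmod den = Cmod cm * t ^ m) by (unfold den; rewrite Cmod_mult, Cmod_pow, Et; auto).
  assert (Epow : (RtoC t ^ m)%C = (RtoC t * RtoC t ^ (m - 1))%C).
  { rewrite <- Cpow_S. f_equal. lia. }
  assert (Ewpow : (w * w ^ (m - 1))%C = 1).
  { rewrite <- Cpow_S, <- Hwm. f_equal. lia. }
  set (pt := fun s => (w * RtoC t * (1 + s))%C).
  assert (Hpt : forall s, Cmod s < rho -> Cmod (pt s) <= 2 * t).
  { intros s Hs. unfold pt. rewrite !Cmod_mult, Hwn, Et.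
    generalize (Cmod_triangle 1 s) (Cmod_ge_0 (1 + s)). rewrite Cmod_1. nra. }
  destruct (contraction_zero (fun s => (f (pt s) - f (RtoC t)) / den)%C (RtoC (INR m)) (rho / 2) rho HmC)
    as [s [Hs Es]].
  - lra.
  - intros s Hs. assert (Hps := Hpt s Hs).
    exists (C_derive f (pt s) * (w * RtoC t) / den)%C. split.
    + eapply der_on_eq; [| |apply (der_on_scal _ (/ den)%C (fun s => f (pt s) - f (RtoC t))%C s
        (C_derive f (pt s) * (w * RtoC t * (0 + 1)) - 0)%C)].
      intros z. cbv beta. unfold Cdiv. ring. unfold Cdiv. ring.
      apply der_on_minus; [|apply der_on_const].
      apply (der_on_comp _ (fun _ => True) pt f); auto.
      * unfold pt. apply der_on_scal. apply der_on_plus. apply der_on_const. apply der_on_id.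
      * apply (holo_C_derive R0); auto. lra.
    + assert (H1s : (1 + s)%C <> 0).
      { intros E. assert (Cmod s = 1); [|lra]. rewrite <- Cmod_1, <- (Cmod_opp 1). f_equal.
        replace s with (1 + s - 1)%C by ring. rewrite E. ring. }
      assert (Hpp : 0 < Cmod (pt s)).
      { apply Cmod_gt_0. unfold pt. repeat apply Cmult_neq_0; auto. apply Cmod_pos_nz. lra. }
      specialize (HJ2 (pt s) ltac:(lra)).
      set (err := (C_derive f (pt s) - RtoC (INR m) * cm * pt s ^ (m - 1))%C) in *.
      replace (C_derive f (pt s) * (w * RtoC t) / den - RtoC (INR m))%C with
        (RtoC (INR m) * ((1 + s) ^ (m - 1) - 1) + err * (w * RtoC t) / den)%C.
      2: { unfold err, pt. rewrite !Cpow_mult_l. unfold den. rewrite Epow.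
        set (X := (RtoC t ^ (m - 1))%C) in *. set (Y := ((1 + s) ^ (m - 1))%C) in *.
        assert (HX : X <> 0) by (apply Cpow_nz; auto).
        transitivity (RtoC (INR m) * (Y - 1) + (C_derive f (w * RtoC t * (1 + s)) * w / (cm * X)
           - RtoC (INR m) * Y * (w * w ^ (m - 1))))%C.
        field; auto. rewrite Ewpow. field; auto. }
      rewrite (Cmod_Rabs_RtoC (INR m)) by lra.
      replace (INR m / 2) with (INR m * (1 / 4) + INR m / 4) by field.
      eapply Cmod_tri; [reflexivity| |].
      * rewrite Cmod_mult, Cmod_Rabs_RtoC by lra. apply Rmult_le_compat_l. lra. left. apply Hcont. lra.
      * rewrite Cmod_div, !Cmod_mult, Hwn, Et, Eden by auto.
        assert (Hcp : 0 < Cmod cm * t ^ m) by (apply Rmult_lt_0_compat; auto).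
        apply Rle_div_l; [exact Hcp|].
        apply Rle_trans with (M' * (2 * t) ^ m * (1 * t)).
        { apply Rmult_le_compat_r. lra. eapply Rle_trans; [exact HJ2|].
          apply Rmult_le_compat_l; auto. apply pow_incr. lra. }
        rewrite Rpow_mult_distr.
        replace (M' * (2 ^ m * t ^ m) * (1 * t)) with ((M' * 2 ^ m * t) * t ^ m) by ring.
        rewrite <- Rmult_assoc. apply Rmult_le_compat_r. lra.
        assert (M' * 2 ^ m * t <= K * t) by (apply Rmult_le_compat_r; unfold K; lra).
        assert (Cmod cm * rho <= Cmod cm * 1) by (apply Rmult_le_compat_l; lra).
        nra.
  - replace (pt 0) with (w * RtoC t)%C by (unfold pt; ring).
    assert (Ewt : Cmod (w * RtoC t) = t) by (rewrite Cmod_mult, Hwn, Et; ring).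
    assert (A1 := HJ1 (w * RtoC t)%C ltac:(lra)). assert (A2 := HJ1 (RtoC t) ltac:(lra)).
    rewrite Ewt in A1. rewrite Et in A2.
    rewrite Cpow_mult_l, Hwm in A1.
    rewrite Cmod_div, Eden, (Cmod_Rabs_RtoC (INR m)) by (auto; lra).
    assert (Hcp : 0 < Cmod cm * t ^ m) by (apply Rmult_lt_0_compat; auto).
    apply Rle_div_l; [exact Hcp|].
    apply Rle_trans with (M * t ^ S m + M * t ^ S m).
    { eapply (Cmod_tri _ (- (f (RtoC t) - f 0 - cm * RtoC t ^ m))%C); [|exact A1|rewrite Cmod_opp; exact A2]. ring. }
    simpl. replace (M * (t * t ^ m) + M * (t * t ^ m)) with (2 * M * t * t ^ m) by ring.
    rewrite <- Rmult_assoc. apply Rmult_le_compat_r. lra.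
    assert (0 <= M' * 2 ^ m) by (apply Rmult_le_pos; auto; apply pow_le; lra).
    assert (2 * M * t <= K * t) by (apply Rmult_le_compat_r; unfold K; lra).
    assert (Cmod cm * rho * 2 <= Cmod cm * rho * INR m).
    { apply Rmult_le_compat_l; auto. apply Rmult_le_pos; lra. }
    nra.
  - assert (Ef : f (pt s) = f (RtoC t)).
    { apply Cminus_eq_0. replace (f (pt s) - f (RtoC t))%C with ((f (pt s) - f (RtoC t)) / den * den)%C by (field; auto).
      rewrite Es. ring. }
    assert (Hps := Hpt s ltac:(lra)).
    apply Hinj in Ef; [|lra|lra].
    assert (E1 : (w * (1 + s))%C = 1).
    { replace (w * (1 + s))%C with (pt s / RtoC t)%C by (unfold pt; field; auto).
      rewrite Ef. field; auto. }
    assert (E2 : (w * s)%C = (1 - w)%C).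
    { rewrite <- E1. ring. }
    assert (E3 : Cmod s = Cmod (1 - w)).
    { rewrite <- E2, Cmod_mult, Hwn. ring. }
    lra.
Qed.

Lemma holomorphic_ball f : holomorphic f -> holo_ball 1 f.
Proof. intros H z Hz. exists (C_derive f z). apply ex_derive_cder, H, Hz. Qed.

Lemma univalent_deriv_nz f z0 d : univalent f -> Disc z0 -> cder f z0 d -> d <> 0.
Proof.
  intros [Hf Hinj] Hz Hd. unfold Disc in *.
  assert (Hin : forall u, Cmod u < 1 - Cmod z0 -> Cmod (z0 + u) < 1).
  { intros u Hu. generalize (Cmod_triangle z0 u). lra. }
  apply (injective_deriv_nz (1 - Cmod z0) (fun u => f (z0 + u)%C)).
  - lra.
  - intros u Hu. destruct (holomorphic_ball f Hf (z0 + u)%C) as [e He]. auto.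
    exists e. apply cder_shift; auto.
  - intros u v Hu Hv E. apply Hinj in E; auto. replace u with (z0 + u - z0)%C by ring.
    rewrite E. ring.
  - apply cder_shift. replace (z0 + 0)%C with z0 by ring. auto.
Qed.

Lemma univalent_local_surj f z0 : univalent f -> Disc z0 ->
  forall eps, 0 < eps -> exists del, 0 < del /\
    forall y, Cmod (y - f z0) < del -> exists z, Cmod (z - z0) < eps /\ f z = y.
Proof.
  intros Hu Hz eps He. unfold Disc in *. assert (Hf := holomorphic_ball f (proj1 Hu)).
  assert (Hd := holo_C_derive 1 f z0 Hf Hz).
  destruct (local_surjective (1 - Cmod z0) (fun u => f (z0 + u)%C) (C_derive f z0)) with (eps := eps)
    as [del [Hdel H]]; auto.
  - lra.
  - intros u Hu'. destruct (Hf (z0 + u)%C) as [e He']. generalize (Cmod_triangle z0 u). lra.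
    exists e. apply cder_shift; auto.
  - apply cder_shift. replace (z0 + 0)%C with z0 by ring. auto.
  - apply (univalent_deriv_nz f z0); auto.
  - exists del; split; auto. intros y Hy. replace (z0 + 0)%C with z0 in H by ring.
    destruct (H y Hy) as [u [Hu1 Hu2]]. exists (z0 + u)%C. split; auto.
    replace (z0 + u - z0)%C with u by ring. auto.
Qed.

(** phi is the inverse of g after f, chosen pointwise. Local surjectivity and injectivity of g make
    phi continuous, and the nonvanishing of g' then makes it differentiable. *)
Lemma transition_map f g : univalent f -> univalent g -> f 0 = 0 -> g 0 = 0 ->
  (forall z, Disc z -> exists z', Disc z' /\ f z = g z') ->
  exists phi, (forall z, Disc z -> Disc (phi z) /\ f z = g (phi z)) /\ holo_ball 1 phi /\
    phi 0 = 0 /\ cder phi 0 (C_derive f 0 / C_derive g 0)%C.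
Proof.
  intros Hf Hg Hf0 Hg0 Hsub.
  assert (HD0 : Disc 0) by (unfold Disc; rewrite Cmod_0; lra).
  assert (Hphi : forall z, exists z', Disc z -> Disc z' /\ f z = g z').
  { intros z. destruct (classic (Disc z)) as [Hz|Hz]. destruct (Hsub z Hz) as [z' H]. eauto.
    exists 0. tauto. }
  set (phi := fun z => proj1_sig (constructive_indefinite_description _ (Hphi z))).
  assert (H : forall z, Disc z -> Disc (phi z) /\ f z = g (phi z)).
  { intros z. unfold phi. destruct constructive_indefinite_description as [z' H]. exact H. }
  exists phi. clearbody phi. clear Hphi.
  assert (Hfh := holomorphic_ball f (proj1 Hf)). assert (Hgh := holomorphic_ball g (proj1 Hg)).
  assert (Hder : forall z1, Disc z1 -> cder phi z1 (C_derive f z1 / C_derive g (phi z1))%C).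
  { intros z1 Hz1. destruct (H z1 Hz1) as [Hw1 Ew1]. set (w1 := phi z1) in *.
    assert (HB := holo_C_derive 1 f z1 Hfh Hz1). assert (HA := holo_C_derive 1 g w1 Hgh Hw1).
    assert (HA0 := univalent_deriv_nz g w1 _ Hg Hw1 HA).
    set (B := C_derive f z1) in *. set (A := C_derive g w1) in *.
    assert (HAp := proj1 (Cmod_gt_0 A) HA0). assert (HBp := Cmod_ge_0 B).
    assert (Hcont : forall eps, 0 < eps -> exists del, 0 < del /\
      forall z, Disc z -> Cmod (z - z1) < del -> Cmod (phi z - w1) < eps).
    { intros eps He. unfold Disc in Hw1.
      destruct (small2 eps (1 - Cmod w1)) as [e' [He' Be]]; try lra.
      destruct (univalent_local_surj g w1 Hg Hw1 e' He') as [d1 [Hd1 H1]].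
      destruct (der_on_cont _ _ _ _ HB d1 Hd1) as [d2 [Hd2 H2]].
      exists d2; split; auto. intros z Hz Hzz. specialize (H2 z I Hzz). rewrite Ew1 in H2.
      destruct (H1 _ H2) as [w [Hw Ew]].
      destruct (H z Hz) as [P1 P2]. replace (phi z) with w. lra.
      apply (proj2 Hg); auto. unfold Disc. generalize (Cmod_sub_ge w w1). lra.
      rewrite Ew. auto. }
    intros eps He. set (K := 2 * (Cmod B + 1) / Cmod A).
    assert (HK : 0 < K) by (apply Rdiv_lt_0_compat; lra).
    destruct (small_mult K (eps * Cmod A / 2)) as [e0 [He0 Hsm]]; [lra|apply Rdiv_lt_0_compat; [apply Rmult_lt_0_compat|]; lra|].
    destruct (small2 (Cmod A / 2) e0) as [e1 [He1 B1]]; try lra.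
    destruct (small2 1 (eps * Cmod A / 2)) as [e2 [He2 B2]]; [lra|apply Rdiv_lt_0_compat; [apply Rmult_lt_0_compat|]; lra|].
    destruct (HA e1 He1) as [d1 [Hd1 H1]].
    destruct (Hcont d1 Hd1) as [d3 [Hd3 H3]]. unfold Disc in Hz1.
    assert (Hd3' : nearby (fun _ => True) z1 (fun z => Disc z /\ Cmod (phi z - w1) < d1)).
    { destruct (small2 d3 (1 - Cmod z1)) as [d [Hd Bd]]; try lra. exists d; split; auto.
      intros z _ Hz. assert (Dz : Disc z) by (unfold Disc; generalize (Cmod_sub_ge z z1); lra).
      split; auto. apply H3; auto; lra. }
    generalize (nearby_and _ _ _ _ (HB e2 He2) Hd3'). apply nearby_imp.
    intros z _ [H2 [Hz Z2]]. fold w1.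
    destruct (H z Hz) as [P1 P2]. specialize (H1 (phi z) I Z2).
    rewrite P2, Ew1 in H2.
    set (x := Cmod (z - z1)) in *. set (y := Cmod (phi z - w1)) in *.
    assert (Hx : 0 <= x) by apply Cmod_ge_0. assert (Hy : 0 <= y) by apply Cmod_ge_0.
    set (r1 := (g (phi z) - g w1 - A * (phi z - w1))%C) in *.
    set (r2 := (g (phi z) - g w1 - B * (z - z1))%C) in *.
    (* An a priori Lipschitz bound for phi at z1: the error e1 y, with e1 <= |A|/2, is absorbed by
       the left side |A| y. *)
    assert (HyK : y <= K * x).
    { assert (Q : Cmod (A * (phi z - w1)) <= Cmod B * x + e2 * x + e1 * y).
      { eapply (Cmod_tri (B * (z - z1) + r2) (- r1)). unfold r1, r2; ring.
        eapply Cmod_tri; [reflexivity|rewrite Cmod_mult; apply Rle_refl|auto]. rewrite Cmod_opp; auto. }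
      rewrite Cmod_mult in Q. fold y in Q.
      assert (e1 * y <= Cmod A / 2 * y) by (apply Rmult_le_compat_r; lra).
      assert (e2 * x <= 1 * x) by (apply Rmult_le_compat_r; lra).
      apply Rmult_le_reg_l with (Cmod A). auto. unfold K.
      replace (Cmod A * (2 * (Cmod B + 1) / Cmod A * x)) with (2 * (Cmod B + 1) * x) by (field; lra). lra. }
    replace (phi z - w1 - B / A * (z - z1))%C with ((r2 - r1) / A)%C by (unfold r1, r2; field; auto).
    rewrite Cmod_div by auto. apply Rle_div_l; [exact HAp|].
    eapply Rle_trans; [apply Cmod_sub_le|].
    assert (e1 * y <= eps * Cmod A / 2 * x).
    { apply Rle_trans with (e1 * (K * x)). apply Rmult_le_compat_l; lra.
      rewrite <- Rmult_assoc, (Rmult_comm e1). apply Rmult_le_compat_r; auto. apply Hsm. lra. }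
    assert (e2 * x <= eps * Cmod A / 2 * x) by (apply Rmult_le_compat_r; lra). lra. }
  assert (H00 : phi 0 = 0).
  { destruct (H 0 HD0) as [P1 P2]. apply (proj2 Hg); auto. rewrite <- P2, Hf0, Hg0. reflexivity. }
  split; auto. split; [|split]; auto.
  - intros z Hz. eexists. apply Hder, Hz.
  - assert (HD := Hder 0 HD0). rewrite H00 in HD. exact HD.
Qed.

Lemma Cexp_lip alpha B x : Rabs x <= B ->
  Cmod (Cexp (alpha * RtoC x) - 1) <= exp (Cmod alpha * B + 1) * (Cmod alpha * Rabs x).
Proof.
  intros Hx. assert (Ha := Cmod_ge_0 alpha).
  assert (E0 : forall z, (z - 0)%C = z) by (intros; ring).
  rewrite <- Cexp_0.
  replace (Cmod alpha * Rabs x) with (Cmod (alpha * RtoC x - 0)) by (rewrite E0, Cmod_mult, Cmod_R; auto).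
  assert (Hax : Cmod alpha * Rabs x <= Cmod alpha * B) by (apply Rmult_le_compat_l; auto).
  assert (0 <= Cmod alpha * Rabs x) by (apply Rmult_le_pos; auto using Rabs_pos).
  apply (cder_lipschitz Cexp 0 (Cmod alpha * B + 1)).
  - intros z Hz. rewrite E0 in Hz. exists (Cexp z). split. apply cder_Cexp.
    rewrite Cmod_Cexp. generalize (Rle_abs (Re z)) (re_le_Cmod z). intros.
    assert (Re z < Cmod alpha * B + 1) by lra. left. apply exp_increasing; auto.
  - rewrite E0, Cmod_mult, Cmod_R. lra.
  - rewrite E0, Cmod_0. lra.
Qed.

Theorem chain_lipschitz a f T : a < T -> Loewner_chain a f ->
  exists K, 0 <= K /\ forall s t, a <= s <= T -> a <= t <= T -> forall z, Cmod z < 1 / 4 ->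
    Cmod (f t z - f s z) <= K * Rabs (t - s).
Proof.
  intros HaT [alpha [Hf Hsub]].
  assert (Htr : forall t s, a <= t -> t <= s -> exists phi,
    (forall z, Disc z -> Disc (phi z) /\ f t z = f s (phi z)) /\ holo_ball 1 phi /\
    phi 0 = 0 /\ cder phi 0 (Cexp (alpha * RtoC (t - s)))).
  { intros t s Hat Hts. destruct (Hf t Hat) as [U1 [Z1 D1]]. destruct (Hf s ltac:(lra)) as [U2 [Z2 D2]].
    destruct (transition_map (f t) (f s) U1 U2 Z1 Z2 (Hsub t s Hat Hts)) as [phi [P1 [P2 [P3 P4]]]].
    exists phi. repeat split; auto; try (apply P1; auto).
    replace (Cexp (alpha * RtoC (t - s))) with (C_derive (f t) 0 / C_derive (f s) 0)%C; auto.
    rewrite D1, D2.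
    replace (alpha * RtoC t)%C with (alpha * RtoC (t - s) + alpha * RtoC s)%C by (rewrite RtoC_minus; ring).
    rewrite Cexp_add. field. apply Cexp_nz. }
  assert (HfT := holomorphic_ball (f T) (proj1 (proj1 (Hf T ltac:(lra))))).
  destruct (holo_ball_bounded (f T) 1 (1 / 2) HfT ltac:(lra)) as [M [HM0 HM]].
  (* Every f_t is f_T after a self-map that does not increase moduli, so a bound for f_T serves all
     t. *)
  assert (HMt : forall t, a <= t <= T -> forall z, Cmod z <= 1 / 2 -> Cmod (f t z) <= M).
  { intros t Ht z Hz. destruct (Htr t T ltac:(lra) ltac:(lra)) as [phi [P1 [P2 [P3 _]]]].
    assert (Hd : Disc z) by (unfold Disc; lra).
    rewrite (proj2 (P1 z Hd)). apply HM.
    assert (S := schwarz phi P2 (fun w Hw => Rlt_le _ _ (proj1 (P1 w Hw))) P3 z ltac:(lra)). lra. }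
  assert (Ha0 := Cmod_ge_0 alpha).
  set (L := exp (Cmod alpha * (T - a) + 1) * Cmod alpha).
  assert (HL : 0 <= L) by (apply Rmult_le_pos; auto; left; apply exp_pos).
  assert (H : forall t s, a <= t -> t <= s -> s <= T -> forall z, Cmod z < 1 / 4 ->
    Cmod (f t z - f s z) <= 16 * M * (3 * L * (s - t))).
  { intros t s Hat Hts HsT z Hz. destruct (Htr t s Hat Hts) as [phi [P1 [P2 [P3 P4]]]].
    set (c := Cexp (alpha * RtoC (t - s))) in *.
    assert (P1' : forall w, Cmod w < 1 -> Cmod (phi w) <= 1) by (intros w Hw; left; apply P1, Hw).
    destruct (self_map_near_id phi c P2 P1' P3 P4) as [Hc1 Hid].
    assert (Hzd : Disc z) by (unfold Disc; lra).
    rewrite (proj2 (P1 z Hzd)).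
    assert (Hpz := schwarz phi P2 P1' P3 z ltac:(lra)).
    assert (E0 : forall z, (z - 0)%C = z) by (intros; ring).
    assert (HfS := holomorphic_ball (f s) (proj1 (proj1 (Hf s ltac:(lra))))).
    (* The bound M holds on |z| <= 1/2; Cauchy's estimate on discs of radius 1/4 gives |f_s'| <= 4 M
       / (1/4) = 16 M on |z| < 1/4. *)
    eapply Rle_trans; [apply (cder_lipschitz (f s) 0 (1 / 4) (16 * M)); rewrite ?E0; try lra|].
    - intros w Hw. rewrite E0 in Hw. exists (C_derive (f s) w).
      assert (Hd : cder (f s) w (C_derive (f s) w)) by (apply (holo_C_derive 1); auto; lra).
      split; auto. replace (16 * M) with (4 * M / (1 / 4)) by field.
      apply (deriv_bound (f s) w); auto; [lra| |].
      + intros v Hv. apply HfS. generalize (Cmod_sub_ge v w). lra.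
      + intros v Hv. apply HMt. lra. generalize (Cmod_sub_ge v w). lra.
    - apply Rmult_le_compat_l. lra. eapply Rle_trans; [apply Hid; lra|].
      assert (A := Cexp_lip alpha (T - a) (t - s)). fold c in A.
      rewrite Rabs_minus_sym, Rabs_pos_eq in A by lra. specialize (A ltac:(lra)).
      replace (exp (Cmod alpha * (T - a) + 1) * (Cmod alpha * (s - t))) with (L * (s - t)) in A by (unfold L; ring).
      rewrite Cmod_sub_sym in A.
      (* Since |c| <= 1, one has 1 - |c|^2 <= 2 (1 - |c|) <= 2 |1 - c|, which explains the factor
         3. *)
      assert (B := Cmod_sub_ge 1 c). rewrite Cmod_1 in B.
      generalize (Cmod_ge_0 c). intros. nra. }
  exists (16 * M * (3 * L)). split. apply Rmult_le_pos; lra.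
  intros s t Hs Ht z Hz. rewrite Rmult_assoc. destruct (Rle_lt_dec t s) as [Hts|Hts].
  - rewrite Rabs_minus_sym, Rabs_pos_eq by lra. apply H; lra.
  - rewrite Rabs_pos_eq by lra. rewrite Cmod_sub_sym. apply H; lra.
Qed.

(** * Coefficients of families of functions *)

Lemma power_coef_minus R0 f g k : 0 < R0 -> holo_ball R0 f -> holo_ball R0 g ->
  power_coef (fun z => f z - g z)%C k = (power_coef f k - power_coef g k)%C.
Proof.
  intros HR Hf Hg. rewrite (power_coef_eq R0 _ (S k) (fun k => power_coef f k + - (1) * power_coef g k)%C k); auto.
  - ring.
  - intros z Hz. destruct (Hf z Hz) as [d Hd]. destruct (Hg z Hz) as [e He].
    exists (d - e)%C. apply der_on_minus; auto.
  - apply (jet_ext_f _ (fun z => f z + - (1) * g z)%C _ _ 1). lra. intros; ring.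
    apply jet_plus. apply (power_coef_jet R0); auto. apply jet_scal. apply (power_coef_jet R0); auto.
Qed.

(** The constant depends on f through [B] only. Applied to an increment F s - F t bounded by K |s -
    t|, the remainder is again proportional to |s - t|. *)
Lemma taylor_uniform R0 f B n z : 0 < R0 -> holo_ball R0 f ->
  (forall z, Cmod z < R0 -> Cmod (f z) <= B) -> Cmod z <= R0 / 4 ->
  Cmod (f z - csum (fun k => power_coef f k * z ^ k)%C n) <= 4 * B * (2 / R0) ^ n * Cmod z ^ n.
Proof.
  intros HR Hf HB Hz.
  assert (HB' : forall z, Cmod z = R0 / 2 -> Cmod (f z) <= B) by (intros; apply HB; lra).
  assert (HB0 : 0 <= B).
  { eapply Rle_trans; [apply Cmod_ge_0|]. apply (HB 0). rewrite Cmod_0; lra. }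
  destruct (cauchy_series f R0 (R0 / 2) B Hf ltac:(lra) HB') as [_ Hs].
  rewrite (csum_ext _ (fun k => cauchy_coef f (R0 / 2) k * z ^ k)%C).
  2: { intros k _. f_equal. apply (power_coef_eq R0 f (S k)); auto.
       apply (cauchy_jet f R0 (R0 / 2) B); auto; lra. }
  eapply Rle_trans; [apply Hs; lra|].
  assert (Hq : R0 / 2 / (R0 / 2 - Cmod z) <= 2) by (apply geom_ratio_le_2; lra).
  replace (4 * B * (2 / R0) ^ n * Cmod z ^ n) with (2 * B * (Cmod z / (R0 / 2)) ^ n * 2).
  - apply Rmult_le_compat_l; auto. apply Rmult_le_pos. lra.
    apply pow_le. apply Rdiv_le_0_compat; [apply Cmod_ge_0|lra].
  - replace (Cmod z / (R0 / 2)) with (2 / R0 * Cmod z) by (field; lra).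
    rewrite Rpow_mult_distr. ring.
Qed.

Lemma rder_from_csum a (x : nat -> R -> C) (d c : nat -> C) t n :
  (forall j, (j < n)%nat -> rder_from a (x j) t (d j)) ->
  rder_from a (fun s => csum (fun j => x j s * c j)%C n) t (csum (fun j => d j * c j)%C n).
Proof.
  intros H. induction n as [|n IH]; simpl. apply der_on_const.
  apply (der_on_plus _ (fun w => csum (fun j => x j (Re w) * c j)%C n) (fun w => x n (Re w) * c n)%C).
  apply IH. auto.
  eapply der_on_eq; [| |apply (der_on_scal _ (c n)); apply (H n); auto].
  intros w. cbv beta. ring. cbv beta. ring.
Qed.

(* Pointwise differentiability in the parameter passes to the coefficients because the
   difference quotients are bounded: the k-th coefficient is read off at one small z. *)
Lemma coef_rder (F : R -> C -> C) G R0 K t T gam n : t < T -> 0 < R0 ->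
  (forall s, t <= s <= T -> holo_ball R0 (F s)) ->
  (forall s, t <= s <= T -> forall z, Cmod z < R0 -> Cmod (F s z - F t z) <= K * Rabs (s - t)) ->
  (forall z, Cmod z < R0 -> rder_from t (fun s => F s z) t (G z)) ->
  jet n G gam ->
  forall k, (k < n)%nat -> rder_from t (fun s => power_coef (F s) k) t (gam k).
Proof.
  intros HtT HR HF HK HG HJ k. induction k as [k IH] using lt_wf_ind. intros Hk.
  assert (HK0 : 0 <= K).
  { specialize (HK T ltac:(lra) 0). rewrite Cmod_0 in HK. specialize (HK HR).
    rewrite Rabs_pos_eq in HK by lra. generalize (Cmod_ge_0 (F T 0 - F t 0)). nra. }
  assert (HJ' := jet_mono n (S k) G gam Hk HJ). apply jet_bound in HJ'.
  destruct HJ' as [M2 [r [HM2 [Hr [_ HJ']]]]].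
  set (M1 := 4 * K * (2 / R0) ^ S k).
  assert (HM1 : 0 <= M1).
  { apply Rmult_le_pos. lra. apply pow_le, Rdiv_le_0_compat; lra. }
  apply rder_from_iff. intros eps He.
  (* The point z = x is fixed first, so small that the two Taylor remainders together stay below
     eps/2 after division by x^k; only then does s approach t. *)
  destruct (small_mult (M1 + M2) (eps / 2)) as [d0 [Hd0 Hsm]]; [lra|lra|].
  destruct (small3 (R0 / 4) (r / 2) d0) as [x [Hx Bx]]; try lra.
  assert (HxM := Hsm x ltac:(lra)).
  set (z := RtoC x). assert (Ez : Cmod z = x) by (apply Cmod_Rabs_RtoC; lra).
  assert (Hxk : 0 < x ^ k) by (apply pow_lt; auto).
  (* By induction the lower coefficients are differentiable; once they are subtracted, the term in
     z^k dominates up to the remainders. *)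
  assert (HQ : rder_from t (fun s => F s z - csum (fun j => power_coef (F s) j * z ^ j) k)%C t
     (G z - csum (fun j => gam j * z ^ j) k)%C).
  { apply (der_on_minus _ (fun w => F (Re w) z)). apply HG. lra.
    apply (rder_from_csum t (fun j s => power_coef (F s) j) gam (fun j => z ^ j)%C).
    intros j Hj. apply IH; auto. lia. }
  destruct (proj1 (rder_from_iff _ _ _ _) HQ (eps / 2 * x ^ k)) as [del [Hdel Hd]].
  { apply Rmult_lt_0_compat; lra. }
  exists (Rmin del (T - t)). split. apply Rmin_pos; lra. intros s Hs Hst.
  assert (S1 := Rlt_le_trans _ _ _ Hst (Rmin_l _ _)). assert (S2 := Rlt_le_trans _ _ _ Hst (Rmin_r _ _)).
  rewrite (Rabs_pos_eq (s - t)) in * by lra.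
  specialize (Hd s Hs). rewrite (Rabs_pos_eq (s - t)) in Hd by lra. specialize (Hd S1).
  assert (Hs' : t <= s <= T) by lra. assert (Ht' : t <= t <= T) by lra.
  assert (HD : holo_ball R0 (fun z => F s z - F t z)%C).
  { intros u Hu. destruct (HF s Hs' u Hu) as [d1 H1]. destruct (HF t Ht' u Hu) as [d2 H2].
    exists (d1 - d2)%C. apply der_on_minus; auto. }
  assert (HT := taylor_uniform R0 _ (K * (s - t)) (S k) z HR HD).
  assert (HB : forall z, Cmod z < R0 -> Cmod (F s z - F t z) <= K * (s - t)).
  { intros u Hu. specialize (HK s Hs' u Hu). rewrite Rabs_pos_eq in HK by lra. auto. }
  specialize (HT HB ltac:(lra)). rewrite Ez in HT.
  replace (4 * (K * (s - t)) * (2 / R0) ^ S k * x ^ S k) with (M1 * x * x ^ k * (s - t)) in HT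
    by (unfold M1; simpl; ring).
  rewrite (csum_ext _ (fun j => power_coef (F s) j * z ^ j - power_coef (F t) j * z ^ j)%C), csum_minus in HT.
  2: { intros j _. rewrite (power_coef_minus R0) by auto. ring. }
  simpl csum in HT. specialize (HJ' z ltac:(lra)). simpl csum in HJ'. rewrite Ez in HJ'.
  set (as_ := power_coef (F s) k) in *. set (at_ := power_coef (F t) k) in *.
  set (Ps := csum (fun j => power_coef (F s) j * z ^ j)%C k) in *.
  set (Pt := csum (fun j => power_coef (F t) j * z ^ j)%C k) in *.
  set (Pg := csum (fun j => gam j * z ^ j)%C k) in *.
  assert (H : Cmod ((as_ - at_ - gam k * (RtoC s - RtoC t)) * z ^ k) <=
     (M1 * x * x ^ k * (s - t) + eps / 2 * x ^ k * (s - t)) + M2 * x ^ S k * (s - t)).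
  { eapply (Cmod_tri (- (F s z - F t z - (Ps + as_ * z ^ k - (Pt + at_ * z ^ k))) +
       (F s z - Ps - (F t z - Pt) - (G z - Pg) * (RtoC s - RtoC t)))
       ((G z - (Pg + gam k * z ^ k)) * RtoC (s - t))).
    - rewrite RtoC_minus. ring.
    - eapply Cmod_tri; [reflexivity|rewrite Cmod_opp; exact HT|exact Hd].
    - rewrite Cmod_mult, Cmod_Rabs_RtoC by lra. apply Rmult_le_compat_r; auto. lra. }
  rewrite Cmod_mult, Cmod_pow, Ez in H.
  apply Rmult_le_reg_r with (1 := Hxk). eapply Rle_trans; [exact H|].
  replace (M1 * x * x ^ k * (s - t) + eps / 2 * x ^ k * (s - t) + M2 * x ^ S k * (s - t)) with
    (((M1 + M2) * x + eps / 2) * (s - t) * x ^ k) by (simpl; ring).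
  apply Rmult_le_compat_r. lra. apply Rmult_le_compat_r; lra.
Qed.

Lemma coef_lip (F : R -> C -> C) R0 K s t k : 0 < R0 ->
  holo_ball R0 (F s) -> holo_ball R0 (F t) ->
  (forall z, Cmod z < R0 -> Cmod (F t z - F s z) <= K * Rabs (t - s)) ->
  Cmod (power_coef (F t) k - power_coef (F s) k) <= 2 * K / (R0 / 2) ^ k * Rabs (t - s).
Proof.
  intros HR Hs Ht HK. rewrite <- (power_coef_minus R0) by auto.
  replace (2 * K / (R0 / 2) ^ k * Rabs (t - s)) with (2 * (K * Rabs (t - s)) / (R0 / 2) ^ k)
    by (unfold Rdiv; ring).
  apply power_coef_bound; auto.
  intros z Hz. destruct (Hs z Hz) as [d1 H1]. destruct (Ht z Hz) as [d2 H2].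
  exists (d2 - d1)%C. apply der_on_minus; auto.
Qed.

(* The coefficient of z^(k+1) in z^(i+1) p(z). *)
Definition shifted_coef (p : C -> C) (i k : nat) : C :=
  if (k <? i)%nat then RtoC 0 else power_coef p (k - i).

Lemma jet_shifted p i n : holo_ball 1 p ->
  jet n (fun z => z ^ S i * p z)%C (fun k => match k with O => RtoC 0 | S k => shifted_coef p i k end).
Proof.
  intros Hp. assert (H := jet_mulpow n (S i) p _ (power_coef_jet 1 p n Rlt_0_1 Hp)).
  eapply jet_ext_c; [|exact H]. intros [|k] Hk; reflexivity.
Qed.

(** * The partial differential equation *)

(** The derivative f' is known to order n only; the factor z restores order n + 1. Multiplying z
    p(z) by the terms (j+1) a_(j+1) z^j gives the convolution. *)
Lemma pde_jet p f n : holo_ball 1 p -> holo_ball 1 f ->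
  jet (S n) (fun z => z * p z * C_derive f z)%C
    (fun k => match k with O => RtoC 0 | S k => csum (fun j => RtoC (INR (S j)) * shifted_coef p j k * power_coef f (S j))%C n end).
Proof.
  intros Hp Hf.
  assert (HJ := jet_deriv n f (C_derive f) _ 1 Rlt_0_1 (fun z => holo_C_derive 1 f z Hf)
    (power_coef_jet 1 f (S n) Rlt_0_1 Hf)).
  destruct (jet_bound _ _ _ HJ) as [M [r [HM [Hr [_ HJ']]]]].
  destruct (holo_ball_nbhd 1 p Rlt_0_1 Hp) as [d [Hd Hpd]].
  set (B := Cmod (p 0) + 1) in *.
  apply (jet_ext_f _ (fun z => csum (fun j => (RtoC (INR (S j)) * power_coef f (S j)) * (z ^ S j * p z)) n +
     z * p z * (C_derive f z - csum (fun k => RtoC (INR (S k)) * power_coef f (S k) * z ^ k) n))%C _ _ 1).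
  lra.
  { intros z _. rewrite (csum_ext _ (fun j => (z * p z) * (RtoC (INR (S j)) * power_coef f (S j) * z ^ j))%C), csum_scal.
    ring. intros; simpl; ring. }
  eapply jet_ext_c; [|apply jet_plus; [apply jet_csum; intros j _; apply jet_scal, jet_shifted, Hp|]].
  2: { apply (jet_O (S n) _ (B * M) (Rmin d r)). apply Rmin_pos; auto.
    intros z Hz. generalize (Rmin_l d r) (Rmin_r d r). intros.
    rewrite !Cmod_mult. simpl.
    replace (B * M * (Cmod z * Cmod z ^ n)) with (Cmod z * B * (M * Cmod z ^ n)) by ring.
    apply Rmult_le_compat; auto using Cmod_ge_0.
    apply Rmult_le_pos; apply Cmod_ge_0. apply Rmult_le_compat_l. lra. apply Hpd. lra.
    apply HJ'. lra. }
  intros [|k] _; cbv beta iota.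
  - rewrite csum_0. ring. intros; ring.
  - rewrite (csum_ext _ (fun j => RtoC (INR (S j)) * shifted_coef p j k * power_coef f (S j))%C).
    ring. intros; ring.
Qed.

Lemma C_R_norm_minus (u v d : C) (h : R) :
  @norm R_AbsRing C_R_NormedModule (minus (minus u v) (scal h d)) = Cmod (u - v - d * RtoC h).
Proof.
  transitivity (Cmod (@minus C_R_NormedModule (@minus C_R_NormedModule u v) (@scal R_AbsRing C_R_NormedModule h d))).
  symmetry. apply Cmod_norm.
  f_equal. destruct u, v, d. apply injective_projections; simpl;
  unfold minus, plus, opp, scal; simpl; unfold mult; simpl; ring.
Qed.

Lemma pde_rder p f t : Loewner_PDE_at p f t -> forall z, Disc z ->
  rder (fun s => f s z) t (z * p z * C_derive (f t) z)%C.
Proof.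
  intros H z Hz. destruct (H z Hz) as [_ H']. apply rder_iff. intros eps He.
  destruct (H' t (fun P HP => HP) (mkposreal _ He)) as [del Hd].
  exists del; split; [apply cond_pos|]. intros y Hy. specialize (Hd y Hy).
  rewrite <- RtoC_minus, <- C_R_norm_minus. exact Hd.
Qed.

(** Vectors are indexed from 0: entry k is the coefficient of z^(k+1). The coefficient of z^(j+1)
    acts on that of z^(k+1) only for j <= k, so the first n form a closed system. *)
Theorem pde_coefs p a f T n : holo_ball 1 p -> Loewner_chain a f ->
  almost_every_from a (Loewner_PDE_at p f) -> a < T ->
  forall y : nat -> nat -> C,
  (forall k, (k < n)%nat -> y O k = power_coef (f a) (S k)) ->
  (forall m k, (k < n)%nat -> y (S m) k = csum (fun j => RtoC (INR (S j)) * shifted_coef p j k * y m j)%C n) ->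
  forall eps, 0 < eps -> exists q0, forall q, (q0 <= q)%nat -> forall t k, a <= t <= T -> (k < n)%nat ->
    Cmod (power_coef (f t) (S k) - csum (fun m => RtoC (exp_coef (t - a) m) * y m k)%C q) < eps.
Proof.
  intros Hp Hch HN HaT y Hy0 HyS.
  destruct (chain_lipschitz a f T HaT Hch) as [K [HK0 HK]].
  assert (Hf : forall t, a <= t -> holo_ball 1 (f t)).
  { intros t Ht. destruct Hch as [alpha [H _]]. apply holomorphic_ball, (H t Ht). }
  assert (Hf4 : forall t, a <= t -> holo_ball (1 / 4) (f t)).
  { intros t Ht. apply holo_ball_mono with 1. lra. auto. }
  assert (HL : exists L, 0 <= L /\ forall k, (k < n)%nat -> 2 * K / (1 / 4 / 2) ^ S k <= L).
  { exists (2 * K * 8 ^ n). split. apply Rmult_le_pos. lra. apply pow_le; lra.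
    intros k Hk. replace (1 / 4 / 2) with (/ 8) by field. unfold Rdiv.
    rewrite pow_inv, Rinv_inv. apply Rmult_le_compat_l. lra. apply Rle_pow. lra. lia. }
  destruct HL as [L [HL0 HL]].
  apply (linear_ode n (fun k t => power_coef (f t) (S k)) (fun k j => RtoC (INR (S j)) * shifted_coef p j k)%C y a T
    (fun t => a <= t /\ ~ Loewner_PDE_at p f t) L); auto; try lra.
  - intros k Hk s t Hs Ht. eapply Rle_trans.
    apply (coef_lip f (1 / 4) K); try apply Hf4; try lra. intros z Hz. apply HK; auto.
    apply Rmult_le_compat_r. apply Rabs_pos. auto.
  - intros t Ht Nt k Hk.
    assert (HP : Loewner_PDE_at p f t) by (apply NNPP; intros HP; apply Nt; split; auto; lra).
    apply (coef_rder f (fun z => z * p z * C_derive (f t) z)%C (1 / 4) K t T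
      (fun k => match k with O => RtoC 0 | S k => csum (fun j => RtoC (INR (S j)) * shifted_coef p j k * power_coef (f t) (S j))%C n end)
      (S n)); try lra; try lia.
    + intros s Hs. apply Hf4. lra.
    + intros s Hs z Hz. apply HK; auto; lra.
    + intros z Hz. apply rder_rder_from. apply pde_rder; auto. unfold Disc. lra.
    + apply pde_jet; auto. apply Hf. lra.
Qed.

(** * The ordinary differential equation *)

Lemma ode_rder p a w0 w : Loewner_ODE_solution p a w0 w -> forall z, Disc z -> forall t, a <= t ->
  rder_from a (fun s => w s z) t (- (w t z * p (w t z)))%C.
Proof.
  intros H z Hz t Ht. destruct (H z Hz) as [_ [_ H3]]. destruct (H3 t Ht) as [_ H4].
  apply rder_from_iff. intros eps He.
  assert (H5 := H4 t (filter_le_within (F := locally t) (fun s => a <= s)) (mkposreal _ He)).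
  destruct H5 as [del Hd]. exists del; split; [apply cond_pos|]. intros y Hay Hy.
  specialize (Hd y Hy Hay). rewrite <- RtoC_minus, <- C_R_norm_minus. exact Hd.
Qed.

Lemma Re_le_mul (z w : C) : Re (Cconj z * w) <= Cmod z * Cmod w.
Proof.
  eapply Rle_trans; [apply Rle_abs|]. eapply Rle_trans; [apply re_le_Cmod|].
  rewrite Cmod_mult, Cmod_conj. lra.
Qed.

Lemma exp_ge_1 x : 0 <= x -> 1 <= exp x.
Proof. intros H. generalize (exp_ineq1_le x). lra. Qed.

(** This is [energy_estimate] with m = eta^2, through 2 |v| (K |v| + eta) <= (2K + 1) |v|^2 + eta^2.
    Squares are used because |v| may fail to be differentiable where v vanishes. *)
Lemma gronwall (v v' : R -> C) a T K eta : a <= T -> 0 <= K -> 0 <= eta ->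
  (forall t, a <= t <= T -> rder_from a v t (v' t)) ->
  (forall t, a <= t <= T -> Cmod (v' t) <= K * Cmod (v t) + eta) ->
  Cmod (v T) <= exp ((2 * K + 1) * (T - a)) * (Cmod (v a) + eta).
Proof.
  intros HaT HK Heta Hv Hb.
  assert (E := energy_estimate v v' a T (2 * K + 1) (eta ^ 2) HaT Hv).
  assert (X1 : 1 <= exp ((2 * K + 1) * (T - a))).
  { apply exp_ge_1. apply Rmult_le_pos; lra. }
  assert (Hva := Cmod_ge_0 (v a)). assert (HvT := Cmod_ge_0 (v T)).
  assert (H : Cmod (v T) ^ 2 + eta ^ 2 <= exp ((2 * K + 1) * (T - a)) * (Cmod (v a) ^ 2 + eta ^ 2)).
  { apply E. intros t Ht. specialize (Hb t Ht). assert (A := Re_le_mul (v t) (v' t)).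
    assert (Hvt := Cmod_ge_0 (v t)).
    assert (Cmod (v t) * Cmod (v' t) <= Cmod (v t) * (K * Cmod (v t) + eta)) by (apply Rmult_le_compat_l; auto).
    assert (0 <= (Cmod (v t) - eta) ^ 2) by apply pow2_ge_0.
    assert (0 <= K * eta ^ 2) by (apply Rmult_le_pos; auto; apply pow2_ge_0). nra. }
  apply Rsqr_incr_0_var. 2: apply Rmult_le_pos; lra.
  rewrite !Rsqr_pow2. set (X := exp ((2 * K + 1) * (T - a))) in *.
  assert (0 <= eta ^ 2) by apply pow2_ge_0.
  apply Rle_trans with (X * (Cmod (v a) ^ 2 + eta ^ 2)). lra.
  apply Rle_trans with (X * (Cmod (v a) + eta) ^ 2).
  { apply Rmult_le_compat_l. lra. assert (0 <= Cmod (v a) * eta) by (apply Rmult_le_pos; auto). nra. }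
  rewrite Rpow_mult_distr. apply Rmult_le_compat_r. apply pow2_ge_0. simpl. nra.
Qed.

Lemma holo_ball_times_id p : holo_ball 1 p -> holo_ball 1 (fun z => z * p z)%C.
Proof.
  intros Hp z Hz. destruct (Hp z Hz) as [d Hd]. exists (1 * p z + z * d)%C.
  apply der_on_mult; auto. apply der_on_id.
Qed.

(** The derivative of |w|^2 is - 2 |w|^2 Re p(w) <= 0. *)
Lemma ode_modulus p a w0 w : (forall z, Disc z -> 0 < Re (p z)) -> Loewner_ODE_solution p a w0 w ->
  forall z, Disc z -> forall t, a <= t -> Cmod (w t z) <= Cmod (w0 z).
Proof.
  intros Hpos HO z Hz t Ht.
  destruct (HO z Hz) as [E0 [HD _]].
  assert (E := energy_estimate (fun s => w s z) (fun s => - (w s z * p (w s z)))%C a t 0 0 Ht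
    (fun s Hs => ode_rder p a w0 w HO z Hz s (proj1 Hs))).
  rewrite Rmult_0_l, exp_0, !Rplus_0_r, Rmult_1_l, E0 in E.
  apply Rsqr_incr_0_var; [|apply Cmod_ge_0]. rewrite !Rsqr_pow2. apply E.
  intros s Hs. rewrite Rmult_0_l. assert (P := Hpos _ (HD s (proj1 Hs))).
  replace (Re (Cconj (w s z) * - (w s z * p (w s z)))) with (- (Cmod (w s z) ^ 2 * Re (p (w s z)))).
  assert (0 <= Cmod (w s z) ^ 2) by apply pow2_ge_0. nra.
  rewrite Cmod2_alt. destruct (w s z) as [x y]. destruct (p (x, y)) as [u v]. simpl. ring.
Qed.

(* The linearised flow: u' = - H(u) yields a solution of E' = - H'(u) E, namely H(u(t))/H(u(a))
   away from the fixed point, and an exponential at the fixed point 0. *)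
Lemma linearised_flow p a (u : R -> C) : holo_ball 1 p -> (forall z, Disc z -> 0 < Re (p z)) ->
  (forall t, a <= t -> Cmod (u t) <= Cmod (u a)) -> Cmod (u a) < 1 ->
  (forall t, a <= t -> rder_from a u t (- (u t * p (u t)))%C) ->
  exists E : R -> C, E a = 1 /\ forall t, a <= t ->
    rder_from a E t (- C_derive (fun z => z * p z)%C (u t) * E t)%C.
Proof.
  intros Hp Hpos Hmod Hua Hu.
  set (H := fun z => (z * p z)%C).
  assert (HH := holo_ball_times_id p Hp). fold H in HH.
  destruct (Ceq_dec (u a) 0) as [E0|E0].
  - assert (Hu0 : forall t, a <= t -> u t = 0).
    { intros t Ht. apply Cmod_eq_0. apply Rle_antisym; [|apply Cmod_ge_0].
      rewrite <- Cmod_0, <- E0. auto. }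
    set (k := (- C_derive H 0)%C).
    exists (fun t => Cexp (k * RtoC (t - a))). split.
    + rewrite Rminus_diag. replace (k * 0)%C with (RtoC 0) by ring. apply Cexp_0.
    + intros t Ht. rewrite Hu0 by auto. fold k.
      eapply der_on_eq; [| |apply (rder_rder_from a (fun t => Cexp (k * RtoC (t - a))) t
         (Cexp (k * RtoC (t - a)) * (k * 1))%C)].
      reflexivity. ring.
      apply (rder_comp (fun t => k * RtoC (t - a))%C Cexp); [|apply cder_Cexp].
      apply (der_on_scal _ k (fun w => RtoC (Re w - a))).
      apply (proj2 (rder_iff (fun t => RtoC (t - a)) t 1)).
      intros eps He. exists 1. split. lra. intros y _.
      replace (RtoC (y - a) - RtoC (t - a) - 1 * (RtoC y - RtoC t))%C with (RtoC 0).
      rewrite Cmod_0. apply Rmult_le_pos. lra. apply Rabs_pos. rewrite !RtoC_minus. ring.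
  - assert (Hnz : H (u a) <> 0).
    { apply Cmult_neq_0; auto. intros E. assert (P := Hpos (u a) Hua). rewrite E in P. simpl in P. lra. }
    exists (fun t => H (u t) / H (u a))%C. split. field; auto.
    intros t Ht. assert (Hut := Hmod t Ht).
    eapply der_on_eq; [| |apply (der_on_scal _ (/ H (u a))%C (fun w => H (u (Re w))) (RtoC t)
      (C_derive H (u t) * - (u t * p (u t)))%C)].
    intros w. unfold Cdiv. ring. change (u t * p (u t))%C with (H (u t)). unfold Cdiv. fold H. ring.
    apply (der_on_comp _ (fun _ => True) (fun w => u (Re w)) H); auto.
    + apply Hu; auto.
    + apply (holo_C_derive 1); auto. simpl. lra.
Qed.

(** The derivative at z1 is E(T) w0'(z1), with [E] the linearised flow along the orbit of z1.
    Gronwall's inequality is used twice: it makes w_t Lipschitz in the initial value, and it then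
    bounds the error of linearisation, whose forcing term is quadratic in w0 z2 - w0 z1. *)
Theorem flow_holomorphic p a w0 w : holo_ball 1 p -> (forall z, Disc z -> 0 < Re (p z)) ->
  holo_ball 1 w0 -> (forall z, Disc z -> Disc (w0 z)) -> Loewner_ODE_solution p a w0 w ->
  forall T, a <= T -> holo_ball 1 (w T).
Proof.
  intros Hp Hpos Hw0 Hw0D HO T HT z1 Hz1.
  assert (HD1 := Hw0D z1 Hz1). unfold Disc in HD1.
  set (H := fun z => (z * p z)%C).
  assert (HH := holo_ball_times_id p Hp). fold H in HH.
  assert (Hmod := ode_modulus p a w0 w Hpos HO).
  assert (Hder := ode_rder p a w0 w HO).
  assert (Hini : forall z, Disc z -> w a z = w0 z) by (intros z Hz; apply (HO z Hz)).
  destruct (linearised_flow p a (fun t => w t z1) Hp Hpos) as [E [Ea HE]].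
  { intros t Ht. rewrite (Hini z1 Hz1). auto. }
  { rewrite (Hini z1 Hz1). auto. }
  { intros t Ht. apply Hder; auto. }
  (* Orbits that start in |u| < q stay there, since moduli do not increase; the collar of width R0
     leaves room for Cauchy's estimates inside the unit disc. *)
  set (q := (1 + Cmod (w0 z1)) / 2). assert (Hq : Cmod (w0 z1) < q < 1) by (unfold q; lra).
  set (R0 := (1 - q) / 2). assert (HR0 : 0 < R0) by (unfold R0; lra).
  destruct (holo_ball_bounded H 1 (q + R0) HH) as [M [HM0 HM]].
  { generalize (Cmod_ge_0 (w0 z1)). unfold R0. lra. }
  assert (HqR : q + R0 < 1) by (unfold R0; lra).
  set (K := 4 * M / R0). assert (HK : 0 <= K) by (apply Rdiv_le_0_compat; lra).
  assert (HdK : forall u, Cmod u < q -> cder H u (C_derive H u) /\ Cmod (C_derive H u) <= K).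
  { intros u Hu. assert (Hd := holo_C_derive 1 H u HH ltac:(lra)). split; auto.
    apply (deriv_bound H u R0 M); auto.
    - intros v Hv. apply HH. generalize (Cmod_sub_ge v u). lra.
    - intros v Hv. apply HM. generalize (Cmod_sub_ge v u). lra. }
  set (Q := 16 * M / (R0 * R0)).
  assert (HQ : 0 <= Q) by (apply Rdiv_le_0_compat; [lra|apply Rmult_lt_0_compat; auto]).
  assert (Htay : forall u v, Cmod u < q -> Cmod (v - u) <= R0 / 4 ->
    Cmod (H v - H u - C_derive H u * (v - u)) <= Q * Cmod (v - u) ^ 2).
  { intros u v Hu Huv.
    destruct (taylor2 (fun h => H (u + h)%C) R0 M HR0) as [d [Hd [_ Ht]]].
    - intros h Hh. destruct (HH (u + h)%C) as [e He]. generalize (Cmod_triangle u h). lra.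
      exists e. apply cder_shift; auto.
    - intros h Hh. apply HM. generalize (Cmod_triangle u h). lra.
    - specialize (Ht (v - u)%C Huv). replace (u + (v - u))%C with v in Ht by ring.
      replace (u + 0)%C with u in Ht by ring.
      replace (C_derive H u) with d. simpl. rewrite Rmult_1_r. exact Ht.
      eapply cder_unique; [exact Hd|]. apply cder_shift. replace (u + 0)%C with u by ring.
      apply HdK; auto. }
  set (X := exp ((2 * K + 1) * (T - a))).
  assert (HX : 1 <= X) by (apply exp_ge_1, Rmult_le_pos; lra).
  (* Orbits whose initial points are within [del] stay within R0/4 of each other up to time T, which
     is the range of [Htay]. *)
  set (del := R0 / 4 / X). assert (Hdel : 0 < del) by (apply Rdiv_lt_0_compat; lra).
  assert (Edel : X * del = R0 / 4) by (unfold del; field; lra).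
  assert (key : forall z2, Disc z2 -> Cmod (w0 z2) < q -> Cmod (w0 z2 - w0 z1) <= del ->
    Cmod (w T z2 - w T z1 - E T * (w0 z2 - w0 z1)) <= X * (Q * X ^ 2) * Cmod (w0 z2 - w0 z1) ^ 2).
  { intros z2 Hz2 Hq2 Hdl. set (D0 := (w0 z2 - w0 z1)%C) in *.
    assert (Hlt : forall z t, Disc z -> Cmod (w0 z) < q -> a <= t -> Cmod (w t z) < q).
    { intros z t Hz Hzq Ht. eapply Rle_lt_trans; [apply Hmod; auto|auto]. }
    assert (E0 : forall z, (z - 0)%C = z) by (intros; ring).
    assert (Hlip : forall t, a <= t <= T -> Cmod (w t z2 - w t z1) <= X * Cmod D0).
    { intros t Ht. replace (Cmod D0) with (Cmod (w a z2 - w a z1) + 0) by (rewrite !Hini by auto; unfold D0; ring).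
      eapply Rle_trans; [apply (gronwall (fun s => w s z2 - w s z1)%C
         (fun s => - (H (w s z2)) - - (H (w s z1)))%C a t K 0)|].
      - lra.
      - auto.
      - lra.
      - intros s Hs. apply (der_on_minus _ (fun x => w (Re x) z2) (fun x => w (Re x) z1)); apply Hder; auto; lra.
      - intros s Hs. rewrite Rplus_0_r.
        replace (- H (w s z2) - - H (w s z1))%C with (- (H (w s z2) - H (w s z1)))%C by ring.
        rewrite Cmod_opp. apply (cder_lipschitz H 0 q).
        + intros u Hu. rewrite E0 in Hu. exists (C_derive H u). auto.
        + rewrite E0. apply Hlt; auto; lra.
        + rewrite E0. apply Hlt; auto; lra.
      - apply Rmult_le_compat_r. generalize (Cmod_ge_0 (w a z2 - w a z1)). lra.
        unfold X. destruct (Rle_lt_or_eq_dec t T (proj2 Ht)) as [L|L].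
        left. apply exp_increasing. apply Rmult_lt_compat_l; lra.
        right. rewrite L. reflexivity. }
    assert (HD0 := Cmod_ge_0 D0).
    (* The forcing term: [Q] comes from the quadratic Taylor remainder of H, and X |D0| bounds the
       distance between the two orbits. *)
    set (eta := Q * X ^ 2 * Cmod D0 ^ 2).
    assert (Heta : 0 <= eta).
    { apply Rmult_le_pos; [|apply pow2_ge_0]. apply Rmult_le_pos; auto. apply pow2_ge_0. }
    assert (G := gronwall (fun t => w t z2 - w t z1 - E t * D0)%C
      (fun t => - (H (w t z2)) - - (H (w t z1)) - (- C_derive H (w t z1) * E t) * D0)%C a T K eta HT HK Heta).
    cbv beta in G. rewrite !Hini, Ea in G by auto.
    replace (w0 z2 - w0 z1 - 1 * D0)%C with (RtoC 0) in G by (unfold D0; ring).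
    rewrite Cmod_0, Rplus_0_l in G. fold X in G.
    eapply Rle_trans; [apply G|unfold eta; right; ring].
    - intros t Ht. apply (der_on_minus _ (fun x => w (Re x) z2 - w (Re x) z1)%C (fun x => E (Re x) * D0)%C).
      apply (der_on_minus _ (fun x => w (Re x) z2) (fun x => w (Re x) z1)); apply Hder; auto; lra.
      eapply der_on_eq; [| |apply (der_on_scal _ D0 (fun x => E (Re x))); apply HE; lra].
      intros x. cbv beta. ring. fold H. ring.
    - intros t Ht. set (u1 := w t z1). set (u2 := w t z2).
      replace (- H u2 - - H u1 - (- C_derive H u1 * E t) * D0)%C with
        (- (C_derive H u1 * (u2 - u1 - E t * D0)) + - (H u2 - H u1 - C_derive H u1 * (u2 - u1)))%C by ring.
      assert (Hu1 : Cmod u1 < q) by (apply Hlt; auto; lra).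
      eapply Cmod_tri; [reflexivity| |].
      + rewrite Cmod_opp, Cmod_mult. apply Rmult_le_compat_r. apply Cmod_ge_0. apply HdK; auto.
      + rewrite Cmod_opp. assert (Hl := Hlip t Ht). fold u1 u2 in Hl.
        eapply Rle_trans; [apply Htay; auto|].
        * eapply Rle_trans; [exact Hl|]. rewrite <- Edel. apply Rmult_le_compat_l; lra.
        * unfold eta. rewrite Rmult_assoc, <- Rpow_mult_distr. apply Rmult_le_compat_l; auto.
          apply pow_incr. split; auto. apply Cmod_ge_0. }
  destruct (Hw0 z1 Hz1) as [d0 Hd0].
  exists (E T * d0)%C.
  set (G := X * (Q * X ^ 2)).
  assert (HG : 0 <= G) by (apply Rmult_le_pos; [lra|apply Rmult_le_pos; auto; apply pow2_ge_0]).
  set (B := Cmod d0 + 1). assert (HB : 1 <= B) by (unfold B; generalize (Cmod_ge_0 d0); lra).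
  assert (HGB : 0 <= G * B ^ 2) by (apply Rmult_le_pos; auto; apply pow2_ge_0).
  intros eps He. assert (HEp := Cmod_ge_0 (E T)).
  destruct (small2 del (q - Cmod (w0 z1))) as [d2 [Hd2 B2]]; try lra.
  destruct (small_mult (Cmod (E T)) (eps / 2)) as [e3 [He3 H3]]; try lra.
  destruct (small_mult (G * B ^ 2) (eps / 2)) as [d4 [Hd4 H4]]; try lra.
  generalize (nearby_and _ _ _ _
    (nearby_and _ _ _ _ (der_on_lip _ _ _ _ Hd0) (der_on_cont _ _ _ _ Hd0 d2 Hd2))
    (nearby_and _ _ _ _ (Hd0 e3 He3)
      (nearby_and _ _ _ _ (nearby_ball _ z1 d4 Hd4) (nearby_ball _ z1 (1 - Cmod z1) ltac:(unfold Disc in Hz1; lra))))).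
  apply nearby_imp. fold B. intros z2 _ [[H1 H2] [H5 [Z4 Z5]]].
  assert (Hz2 : Disc z2) by (unfold Disc; generalize (Cmod_sub_ge z2 z1); lra).
  assert (Kz := key z2 Hz2 ltac:(generalize (Cmod_sub_ge (w0 z2) (w0 z1)); lra) ltac:(lra)). fold G in Kz.
  set (x := Cmod (z2 - z1)) in *. assert (Hx : 0 <= x) by apply Cmod_ge_0.
  replace (eps * x) with (eps / 2 * x + eps / 2 * x) by field.
  eapply (Cmod_tri (w T z2 - w T z1 - E T * (w0 z2 - w0 z1)) (E T * (w0 z2 - w0 z1 - d0 * (z2 - z1)))).
  ring.
  - eapply Rle_trans; [exact Kz|].
    apply Rle_trans with (G * (B * x) ^ 2).
    { apply Rmult_le_compat_l; auto. apply pow_incr. split; auto. apply Cmod_ge_0. }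
    replace (G * (B * x) ^ 2) with (G * B ^ 2 * x * x) by ring. apply Rmult_le_compat_r; auto.
    apply H4. lra.
  - rewrite Cmod_mult.
    apply Rle_trans with (Cmod (E T) * (e3 * x)). apply Rmult_le_compat_l; auto.
    specialize (H3 e3 ltac:(lra)). nra.
Qed.

(** The jet of u^(m+1) p(u) is evaluated at u = g z; since |g z| <= B |z|, its error stays of order
    n + 1 in z. The terms are powers of g, so the coefficients are combinations of rows of the power
    matrix of g. *)
Lemma jet_comp_pow p g m n B : holo_ball 1 p -> holo_ball 1 g -> 0 < B ->
  (forall z, Cmod z < 1 -> Cmod (g z) <= B * Cmod z) ->
  jet (S n) (fun z => g z ^ S m * p (g z))%C
    (fun k => csum (fun j => shifted_coef p m j * power_coef (fun z => g z ^ S j)%C k)%C n).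
Proof.
  intros Hp Hg HB HgB.
  destruct (jet_bound _ _ _ (jet_shifted p m (S n) Hp)) as [M [r [HM [Hr [Hr1 HJ]]]]].
  set (c := fun k => match k with O => RtoC 0 | S k => shifted_coef p m k end) in *.
  assert (Hgp : forall k, holo_ball 1 (fun z => g z ^ k)%C).
  { intros k z Hz. destruct (Hg z Hz) as [d Hd]. eexists. apply der_on_pow. exact Hd. }
  set (Err := fun u => (u ^ S m * p u - csum (fun k => c k * u ^ k) (S n))%C).
  apply (jet_ext_f _ (fun z => csum (fun j => shifted_coef p m j * g z ^ S j) n + Err (g z))%C _ _ 1).
  lra.
  { intros z _. unfold Err. rewrite csum_shift. unfold c. simpl. ring. }
  eapply jet_ext_c; [|apply jet_plus; [apply jet_csum; intros j _; apply jet_scal, (power_coef_jet 1); [lra|apply Hgp]|]].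
  2: { apply (jet_O (S n) _ (M * B ^ S n) (Rmin 1 (r / B))).
    apply Rmin_pos. lra. apply Rdiv_lt_0_compat; auto.
    intros z Hz. generalize (Rmin_l 1 (r / B)) (Rmin_r 1 (r / B)). intros.
    specialize (HgB z ltac:(lra)).
    assert (Hzr : B * Cmod z < r).
    { apply Rmult_lt_reg_r with (/ B). apply Rinv_0_lt_compat; auto.
      replace (B * Cmod z * / B) with (Cmod z) by (field; lra). unfold Rdiv in *. lra. }
    (* Jets exclude the argument 0, which g may take at some z <> 0. *)
    destruct (Ceq_dec (g z) 0) as [E|E].
    - rewrite E. unfold Err. rewrite csum_shift, csum_0. 2: intros; simpl; ring.
      replace (0 ^ S m * p 0 - (c O * 0 ^ 0 + 0))%C with (RtoC 0) by (unfold c; simpl; ring).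
      rewrite Cmod_0. apply Rmult_le_pos. apply Rmult_le_pos; auto. apply pow_le; lra. apply pow_le; lra.
    - apply Cmod_gt_0 in E. eapply Rle_trans; [apply HJ; lra|].
      rewrite Rmult_assoc, <- Rpow_mult_distr. apply Rmult_le_compat_l; auto. apply pow_incr. lra. }
  intros k _. cbv beta. ring.
Qed.

(** The column [k0] is fixed and the row i varies: the derivative of w^(i+1) involves higher powers
    of w, so the first row alone does not form a closed system. Powers beyond n contribute nothing
    to z^k0, because k0 <= n. *)
Theorem ode_coefs p a w0 w T n k0 : holo_ball 1 p -> (forall z, Disc z -> 0 < Re (p z)) ->
  holo_ball 1 w0 -> (forall z, Disc z -> Disc (w0 z)) -> w0 0 = 0 ->
  Loewner_ODE_solution p a w0 w -> a < T -> (k0 <= n)%nat ->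
  forall y : nat -> nat -> C,
  (forall i, (i < n)%nat -> y O i = power_coef (fun z => w a z ^ S i)%C k0) ->
  (forall m i, (i < n)%nat -> y (S m) i = csum (fun j => - (RtoC (INR (S i)) * shifted_coef p i j) * y m j)%C n) ->
  forall eps, 0 < eps -> exists q0, forall q, (q0 <= q)%nat -> forall t i, a <= t <= T -> (i < n)%nat ->
    Cmod (power_coef (fun z => w t z ^ S i)%C k0 - csum (fun m => RtoC (exp_coef (t - a) m) * y m i)%C q) < eps.
Proof.
  intros Hp Hpos Hw0 Hw0D Hw00 HO HaT Hk0 y Hy0 HyS.
  assert (Hhol := flow_holomorphic p a w0 w Hp Hpos Hw0 Hw0D HO).
  assert (Hmod : forall t z, a <= t -> Cmod z < 1 -> Cmod (w t z) <= Cmod z).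
  { intros t z Ht Hz. eapply Rle_trans; [apply (ode_modulus p a w0 w); auto|].
    apply schwarz; auto. intros v Hv. left. apply Hw0D, Hv. }
  assert (Hder := ode_rder p a w0 w HO).
  assert (Hpow : forall t i, a <= t -> holo_ball (1 / 2) (fun z => w t z ^ i)%C).
  { intros t i Ht z Hz. destruct (Hhol t Ht z) as [d Hd]. lra. eexists. apply der_on_pow. exact Hd. }
  assert (Hdpow : forall t i z, a <= t -> Cmod z < 1 ->
     rder_from a (fun s => w s z ^ S i)%C t (- RtoC (INR (S i)) * (w t z ^ S i * p (w t z)))%C).
  { intros t i z Ht Hz.
    eapply der_on_eq; [| |apply (der_on_pow _ (fun x => w (Re x) z) (RtoC t) (- (w t z * p (w t z)))%C (S i)); apply Hder; auto].
    reflexivity. cbv beta. change (Re (RtoC t)) with t.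
    replace (S i - 1)%nat with i by lia. rewrite Cpow_S. ring. }
  destruct (holo_ball_bounded p 1 (1 / 2) Hp) as [M [HM0 HM]]. lra.
  assert (HLip : forall i s t z, a <= s -> a <= t -> Cmod z < 1 / 2 ->
    Cmod (w t z ^ S i - w s z ^ S i) <= INR (S i) * M * Rabs (t - s)).
  { assert (HLip : forall i s t z, a <= s -> s <= t -> Cmod z < 1 / 2 ->
      Cmod (w t z ^ S i - w s z ^ S i) <= INR (S i) * M * (t - s)).
    { intros i s t z Hs Ht Hz. apply (mvt_const (fun t => w t z ^ S i)%C); auto.
      intros x Hx. eexists. split. apply rder_from_mono with a; [exact Hs|apply Hdpow; lra].
      rewrite !Cmod_mult, Cmod_opp, Cmod_pow, Cmod_Rabs_RtoC by apply pos_INR.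
      apply Rmult_le_compat_l. apply pos_INR. replace M with (1 * M) by ring.
      assert (Hx1 := Hmod x z ltac:(lra) ltac:(lra)).
      apply Rmult_le_compat. apply pow_le, Cmod_ge_0. apply Cmod_ge_0.
      rewrite <- (pow1 (S i)). apply pow_incr. split. apply Cmod_ge_0. lra.
      apply HM. lra. }
    intros i s t z Hs Ht Hz. destruct (Rle_lt_dec s t).
    rewrite Rabs_pos_eq by lra. auto.
    rewrite Rabs_left, Cmod_sub_sym by lra. replace (- (t - s)) with (s - t) by ring. apply HLip; auto; lra. }
  set (L := 2 * (INR (S n) * M) / (1 / 2 / 2) ^ k0).
  assert (Hp4 : 0 < (1 / 2 / 2) ^ k0) by (apply pow_lt; lra).
  assert (HL : 0 <= L).
  { apply Rdiv_le_0_compat; auto. apply Rmult_le_pos. lra. apply Rmult_le_pos; auto using pos_INR. }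
  apply (linear_ode n (fun i t => power_coef (fun z => w t z ^ S i)%C k0)
    (fun i j => - (RtoC (INR (S i)) * shifted_coef p i j))%C y a T (fun _ => False) L); auto; try lra.
  - apply null_set_empty; auto.
  - intros i Hi s t Hs Ht. eapply Rle_trans.
    apply (coef_lip (fun t z => w t z ^ S i)%C (1 / 2) (INR (S i) * M)); try apply Hpow; try lra.
    intros z Hz. apply HLip; lra.
    apply Rmult_le_compat_r. apply Rabs_pos. unfold L, Rdiv. apply Rmult_le_compat_r.
    left; apply Rinv_0_lt_compat; auto. apply Rmult_le_compat_l. lra.
    apply Rmult_le_compat_r; auto. apply le_INR. lia.
  - intros t Ht _ i Hi.
    apply (coef_rder (fun t z => w t z ^ S i)%C (fun z => - RtoC (INR (S i)) * (w t z ^ S i * p (w t z)))%C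
      (1 / 2) (INR (S i) * M) t T
      (fun k => csum (fun j => - (RtoC (INR (S i)) * shifted_coef p i j) * power_coef (fun z => w t z ^ S j)%C k)%C n)
      (S n)); try lra; try lia.
    + intros s Hs. apply Hpow. lra.
    + intros s Hs z Hz. apply HLip; lra.
    + intros z Hz. apply rder_from_mono with a. lra. apply Hdpow; lra.
    + eapply jet_ext_c; [|apply jet_scal; apply (jet_comp_pow p (w t) i n 1 Hp (Hhol t ltac:(lra)) Rlt_0_1)].
      intros k _. cbv beta. rewrite <- csum_scal. apply csum_ext. intros; ring.
      intros z Hz. rewrite Rmult_1_l. apply Hmod; lra.
Qed.

(** * Matrices *)

Definition entry {N} (A : @matrix C N N) (i j : nat) : C := coeff_mat (RtoC 0) A i j.

Lemma entry_Mmult N (A B : @matrix C N N) i j : (i < N)%nat -> (j < N)%nat ->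
  entry (@Mmult C_Ring _ _ _ A B) i j = csum (fun l => entry A i l * entry B l j)%C N.
Proof.
  intros Hi Hj. unfold entry at 1, Mmult. rewrite coeff_mat_bij by auto.
  etransitivity; [apply (sum_n_csum (fun l => entry A i l * entry B l j)%C (Nat.pred N))|].
  destruct N; [lia|reflexivity].
Qed.

Lemma entry_Mone N i j : (i < N)%nat -> (j < N)%nat ->
  entry (@Mone C_Ring N) i j = if (i =? j)%nat then RtoC 1 else RtoC 0.
Proof.
  intros Hi Hj. unfold entry, Mone. rewrite coeff_mat_bij by auto.
  revert j Hj. clear. revert i. induction i as [|i IH]; intros [|j] Hj; simpl; auto.
  apply (IH j). lia.
Qed.

Lemma entry_Mscal N c (A : @matrix C N N) i j : (i < N)%nat -> (j < N)%nat ->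
  entry (Mscal c A) i j = (c * entry A i j)%C.
Proof. intros Hi Hj. unfold entry, Mscal. rewrite coeff_mat_bij by auto. reflexivity. Qed.

Lemma entry_Msum N (F : nat -> @matrix C N N) q i j : (i < N)%nat -> (j < N)%nat ->
  entry (Msum F q) i j = csum (fun m => entry (F m) i j) (S q).
Proof.
  intros Hi Hj. induction q as [|q IH]; unfold Msum in *.
  - rewrite sum_O. simpl. ring.
  - rewrite sum_Sn.
    change (csum (fun m => entry (F m) i j) (S (S q))) with
      (csum (fun m => entry (F m) i j) (S q) + entry (F (S q)) i j)%C.
    rewrite <- IH. unfold plus; simpl. unfold entry at 1, Mplus. rewrite coeff_mat_bij by auto.
    reflexivity.
Qed.

Lemma Mpow_S_l N (A : @matrix C N N) m : Mpow A (S m) = @Mmult C_Ring _ _ _ A (Mpow A m).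
Proof. reflexivity. Qed.

Lemma Mpow_S_r N (A : @matrix C N N) m : Mpow A (S m) = @Mmult C_Ring _ _ _ (Mpow A m) A.
Proof. symmetry. apply (@pow_n_comm_1 (@matrix_Ring C_Ring N)). Qed.

Lemma csum_delta_l (u : nat -> C) N k : (k < N)%nat ->
  csum (fun l => u l * (if (l =? k)%nat then RtoC 1 else RtoC 0))%C N = u k.
Proof.
  intros Hk. rewrite (csum_single _ N k Hk).
  - rewrite Nat.eqb_refl. ring.
  - intros l _ Hl. apply Nat.eqb_neq in Hl. rewrite Hl. ring.
Qed.

Lemma csum_delta_r (u : nat -> C) N k : (k < N)%nat ->
  csum (fun l => (if (k =? l)%nat then RtoC 1 else RtoC 0) * u l)%C N = u k.
Proof.
  intros Hk. rewrite (csum_single _ N k Hk).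
  - rewrite Nat.eqb_refl. ring.
  - intros l _ Hl. apply not_eq_sym, Nat.eqb_neq in Hl. rewrite Hl. ring.
Qed.

Lemma block_size_nat n : block_size 1 (Z.of_nat n) = n.
Proof. unfold block_size. lia. Qed.

Lemma entry_block A n i j : (i < n)%nat -> (j < n)%nat ->
  entry (principal_block 1 (Z.of_nat n) A) i j = A (Z.of_nat (S i)) (Z.of_nat (S j)).
Proof.
  intros Hi Hj. unfold entry, principal_block. rewrite coeff_mat_bij by (rewrite block_size_nat; auto).
  f_equal; lia.
Qed.

(** As f 0 = 0, the power f^(i+1) is O(z^(i+1)), which is what an expansion starting at order i + 1
    requires; uniqueness of jets identifies it with the expansion from order 0. *)
Lemma power_matrix_coef R0 f i j : 0 < R0 -> holo_ball R0 f -> f 0 = 0 ->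
  power_matrix f (Z.of_nat (S i)) (Z.of_nat j) = power_coef (fun z => f z ^ S i)%C j.
Proof.
  intros HR Hf H0. unfold power_matrix.
  assert (HP : holo_ball R0 (fun z => f z ^ S i)%C).
  { intros z Hz. destruct (Hf z Hz) as [d Hd]. eexists. apply der_on_pow. exact Hd. }
  replace (fun z => Cpow_Z (f z) (Z.of_nat (S i))) with (fun z => f z ^ S i)%C.
  2: { apply functional_extensionality. intros z. rewrite Cpow_Z_nat. reflexivity. }
  destruct (Hf 0) as [d Hd]. rewrite Cmod_0; auto.
  destruct (der_on_lip _ _ _ _ Hd) as [del [Hdel Hl]].
  assert (HJ : jet (S i) (fun z => f z ^ S i)%C (fun _ => 0)).
  { apply (jet_O _ _ ((Cmod d + 1) ^ S i) del); auto. intros w Hw.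
    rewrite Cmod_pow, <- Rpow_mult_distr. apply pow_incr. split. apply Cmod_ge_0.
    specialize (Hl w I). rewrite H0 in Hl.
    replace (w - 0)%C with w in Hl by ring. replace (f w - 0)%C with (f w) in Hl by ring.
    apply Hl. lra. }
  destruct (expansion_coef (S i) _ _ R0 HR HP HJ (fun _ _ => eq_refl)) as [_ H].
  symmetry. apply (power_coef_eq R0 _ (S j)
    (fun k => expansion (Z.of_nat (S i)) (fun z => f z ^ S i)%C (Z.of_nat k))); auto.
Qed.

(** Row i + 1, column j + 1 reads the coefficient of order j - i + 1 of z p(z), that is, of order j
    - i of p. *)
Lemma angle_matrix_coef p i j : holo_ball 1 p ->
  angle_matrix (fun z => z * p z)%C (Z.of_nat (S i)) (Z.of_nat (S j)) =
  (RtoC (INR (S i)) * shifted_coef p i j)%C.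
Proof.
  intros Hp. unfold angle_matrix. rewrite <- INR_IZR_INZ. f_equal.
  assert (HJ : jet 1 (fun z => z ^ 1 * p z)%C (fun _ => 0)).
  { eapply jet_ext_c; [|apply (jet_shifted p 0 1 Hp)]. intros k Hk. replace k with O by lia. reflexivity. }
  assert (HJ' : jet 1 (fun z => z * p z)%C (fun _ => 0)).
  { apply (jet_ext_f _ (fun z => z ^ 1 * p z)%C _ _ 1); auto. lra. intros; simpl; ring. }
  destruct (expansion_coef 1 (fun z => z * p z)%C _ 1 Rlt_0_1 (holo_ball_times_id p Hp) HJ' (fun _ _ => eq_refl))
    as [Hlow H].
  change (Z.of_nat 1) with 1%Z in *.
  unfold shifted_coef. destruct (Nat.ltb_spec j i) as [L|L].
  - apply Hlow. lia.
  - replace (Z.of_nat (S j) - Z.of_nat (S i) + 1)%Z with (Z.of_nat (S (j - i))) by lia.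
    assert (HJp : jet (S (S (j - i))) (fun z => z * p z)%C
      (fun k => match k with O => RtoC 0 | S k => shifted_coef p 0 k end)).
    { apply (jet_ext_f _ (fun z => z ^ 1 * p z)%C _ _ 1). lra. intros; simpl; ring. apply jet_shifted; auto. }
    rewrite (jet_unique (S (S (j - i))) (fun z => z * p z)%C _ _ (H _) HJp (S (j - i))) by lia.
    unfold shifted_coef. simpl. rewrite Nat.sub_0_r. reflexivity.
Qed.

Theorem theorem4p4 (p : C -> C) (p_holo : holomorphic p)
    (p_pos : forall z, Disc z -> 0 < Re (p z)) :
  (forall (a : R) (f : R -> C -> C),
     Loewner_chain a f ->
     almost_every_from a (Loewner_PDE_at p f) ->
     forall (T : R) (n : nat) (eps : R),
       a < T -> (1 <= n)%nat -> 0 < eps ->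
       exists q : nat, forall (t : R) (k : nat),
         a <= t <= T -> (1 <= k <= n)%nat ->
         let block := principal_block 1 (Z.of_nat n) in
         let zp := block (angle_matrix (fun z => Cmult z (p z))) in
         Cmod (Cminus (power_coef (f t) k)
           (first_row
              (@Mmult C_Ring _ _ _ (block (power_matrix (f a)))
                 (Msum (fun m => Mscal (RtoC ((t - a) ^ m / INR (fact m)))
                                       (Mpow zp m)) q))
              k)) < eps)
  /\
  (forall (a : R) (w0 : C -> C) (w : R -> C -> C),
     univalent w0 ->
     (forall z, Disc z -> Disc (w0 z)) ->
     w0 (RtoC 0) = RtoC 0 ->
     (exists c : R, C_derive w0 (RtoC 0) = RtoC c /\ 0 < c < 1) ->
     Loewner_ODE_solution p a w0 w ->
     forall (T : R) (n : nat) (eps : R),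
       a < T -> (0 < n)%nat -> 0 < eps ->
       exists q : nat, forall (t : R) (k : nat),
         a <= t <= T -> (1 <= k <= n)%nat ->
         let block := principal_block 1 (Z.of_nat n) in
         let zp := block (angle_matrix (fun z => Cmult z (p z))) in
         Cmod (Cminus (power_coef (w t) k)
           (first_row
              (@Mmult C_Ring _ _ _
                 (Msum (fun m => Mscal (RtoC ((-1) ^ m * ((t - a) ^ m / INR (fact m))))
                                       (Mpow zp m)) q)
                 (block (power_matrix (w a))))
              k)) < eps).
Proof.
  assert (Hp := holomorphic_ball p p_holo).
  assert (Hzp : forall n i j, (i < n)%nat -> (j < n)%nat ->
    entry (principal_block 1 (Z.of_nat n) (angle_matrix (fun z => Cmult z (p z)))) i j =
    (RtoC (INR (S i)) * shifted_coef p i j)%C).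
  { intros n i j Hi Hj. rewrite entry_block by auto. apply angle_matrix_coef; auto. }
  split.
  - intros a f Hch HN T n eps HaT Hn He.
    (* The dimension of the block equals [n] only propositionally, so the sums run to [N] and are
       rewritten by [EN]. *)
    set (N := block_size 1 (Z.of_nat n)). assert (EN : N = n) by apply block_size_nat.
    set (zp := principal_block 1 (Z.of_nat n) (angle_matrix (fun z => Cmult z (p z)))).
    set (P := principal_block 1 (Z.of_nat n) (power_matrix (f a))).
    assert (Hfa : holo_ball 1 (f a) /\ f a 0 = 0).
    { destruct Hch as [alpha [H _]]. destruct (H a (Rle_refl a)) as [H1 [H2 _]].
      split; auto. apply holomorphic_ball, H1. }
    assert (HP : forall l, (l < n)%nat -> entry P 0 l = power_coef (f a) (S l)).
    { intros l Hl. unfold P. rewrite entry_block by lia.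
      rewrite (power_matrix_coef 1) by (lra || apply Hfa). f_equal.
      apply functional_extensionality. intros z. apply Cpow_1_r. }
    (* [y m] is the first row of [P] times the m-th power of [zp]. Splitting off the last factor on
       the right gives the recursion, with the transpose of [zp] as the matrix of the system. *)
    set (y := fun m k => csum (fun l => entry P 0 l * entry (Mpow zp m) l k)%C N).
    destruct (pde_coefs p a f T n Hp Hch HN HaT y) with (eps := eps) as [q0 Hq0]; auto.
    + intros k Hk. unfold y. rewrite <- HP by auto.
      rewrite (csum_ext _ (fun l => entry P 0 l * (if (l =? k)%nat then RtoC 1 else RtoC 0))%C).
      apply csum_delta_l. lia.
      intros l Hl. f_equal. apply entry_Mone; lia.
    + intros m k Hk. unfold y.
      rewrite (csum_ext _ (fun l => csum (fun j => entry P 0 l * (entry (Mpow zp m) l j * entry zp j k))%C N)).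
      2: { intros l Hl. rewrite Mpow_S_r, entry_Mmult by lia. rewrite csum_scal. reflexivity. }
      rewrite csum_comm, EN. apply csum_ext. intros j Hj.
      rewrite <- csum_scal. apply csum_ext. intros l Hl. unfold zp at 2. rewrite Hzp by auto.
      ring.
    + exists q0. intros t k Ht Hk. cbv zeta. fold zp P.
      destruct k as [|k]; [lia|].
      (* [Msum] up to q0 has q0 + 1 terms. *)
      replace (first_row _ (S k)) with (csum (fun m => RtoC (exp_coef (t - a) m) * y m k)%C (S q0)).
      apply Hq0; auto; lia.
      unfold first_row. replace (S k - 1)%nat with k by lia.
      match goal with |- _ = coeff_mat _ ?A _ _ => change (coeff_mat (RtoC 0) A 0 k) with (entry A 0 k) end.
      rewrite entry_Mmult by lia.
      unfold y. symmetry.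
      etransitivity; [|apply csum_ext; intros m _; apply csum_scal].
      rewrite csum_comm. apply csum_ext. intros l Hl.
      rewrite entry_Msum by lia. rewrite <- csum_scal. apply csum_ext. intros m _.
      rewrite entry_Mscal by lia. unfold exp_coef, N. ring.
  - intros a w0 w Hw0 Hw0D Hw00 _ HO T n eps HaT Hn He.
    assert (Hw0h := holomorphic_ball w0 (proj1 Hw0)).
    set (N := block_size 1 (Z.of_nat n)). assert (EN : N = n) by apply block_size_nat.
    set (zp := principal_block 1 (Z.of_nat n) (angle_matrix (fun z => Cmult z (p z)))).
    set (W := principal_block 1 (Z.of_nat n) (power_matrix (w a))).
    assert (Hwa := flow_holomorphic p a w0 w Hp p_pos Hw0h Hw0D HO a (Rle_refl a)).
    assert (Hwa0 : w a 0 = 0).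
    { rewrite <- Hw00 at 2. apply (HO 0). unfold Disc. rewrite Cmod_0. lra. }
    assert (HW : forall i l, (i < n)%nat -> (l < n)%nat -> entry W i l = power_coef (fun z => w a z ^ S i)%C (S l)).
    { intros i l Hi Hl. unfold W. rewrite entry_block by lia.
      apply (power_matrix_coef 1); auto. lra. }
    (* [y k m] is column k of the m-th power of [- zp] times [W]; here the first factor is split off
       on the left. *)
    set (y := fun k m i => (RtoC ((-1) ^ m) * csum (fun l => entry (Mpow zp m) i l * entry W l k)%C N)%C).
    assert (Hk : forall k, (k < n)%nat -> exists q0, forall q, (q0 <= q)%nat -> forall t i, a <= t <= T -> (i < n)%nat ->
      Cmod (power_coef (fun z => w t z ^ S i)%C (S k) - csum (fun m => RtoC (exp_coef (t - a) m) * y k m i)%C q) < eps).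
    { intros k Hk. apply (ode_coefs p a w0 w T n (S k)); auto.
      - intros i Hi. unfold y. rewrite <- HW by auto.
        rewrite (csum_ext _ (fun l => (if (i =? l)%nat then RtoC 1 else RtoC 0) * entry W l k)%C).
        rewrite csum_delta_r by lia. simpl. ring.
        intros l Hl. f_equal. apply entry_Mone; lia.
      - intros m i Hi. unfold y.
        rewrite (csum_ext (fun l => entry (Mpow zp (S m)) i l * entry W l k)%C
          (fun l => csum (fun j => entry zp i j * (entry (Mpow zp m) j l * entry W l k))%C N)).
        2: { intros l Hl. rewrite Mpow_S_l, entry_Mmult by lia.
             rewrite Cmult_comm, <- csum_scal. apply csum_ext. intros; ring. }
        rewrite csum_comm, <- csum_scal, EN. apply csum_ext. intros j Hj.
        rewrite csum_scal. unfold zp at 1. rewrite Hzp by auto.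
        change ((-1) ^ S m) with (-1 * (-1) ^ m). rewrite RtoC_mult.
        replace (RtoC (-1)) with (- (1))%C by (unfold RtoC, Copp; simpl; f_equal; ring). ring. }
    (* Each column has its own threshold. The estimate holds for all larger q, so adding the
       thresholds serves every column at once. *)
    assert (Hall : forall n', (n' <= n)%nat -> exists q0, forall q, (q0 <= q)%nat -> forall k, (k < n')%nat ->
      forall t i, a <= t <= T -> (i < n)%nat ->
      Cmod (power_coef (fun z => w t z ^ S i)%C (S k) - csum (fun m => RtoC (exp_coef (t - a) m) * y k m i)%C q) < eps).
    { induction n' as [|n' IH]; intros Hn'. exists O. intros; lia.
      destruct (IH ltac:(lia)) as [q1 Hq1]. destruct (Hk n' ltac:(lia)) as [q2 Hq2].
      exists (q1 + q2)%nat. intros q Hq k Hkn t i Ht Hi.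
      destruct (Nat.eq_dec k n') as [->|E]. apply Hq2; auto; lia. apply Hq1; auto; lia. }
    destruct (Hall n (Nat.le_refl n)) as [q0 Hq0].
    exists q0. intros t k Ht Hkn. cbv zeta. fold zp W.
    destruct k as [|k]; [lia|].
    replace (power_coef (w t) (S k)) with (power_coef (fun z => w t z ^ 1)%C (S k)).
    2: { f_equal. apply functional_extensionality. intros z. apply Cpow_1_r. }
    replace (first_row _ (S k)) with (csum (fun m => RtoC (exp_coef (t - a) m) * y k m O)%C (S q0)).
    apply Hq0; auto; lia.
    unfold first_row. replace (S k - 1)%nat with k by lia.
    match goal with |- _ = coeff_mat _ ?A _ _ => change (coeff_mat (RtoC 0) A 0 k) with (entry A 0 k) end.
    rewrite entry_Mmult by lia.
    unfold y. symmetry.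
    etransitivity; [|apply csum_ext; intros m _;
      etransitivity; [apply csum_scal|symmetry; apply Cmult_assoc]].
    rewrite csum_comm. apply csum_ext. intros l Hl.
    rewrite entry_Msum by lia. rewrite Cmult_comm, <- csum_scal. apply csum_ext. intros m _.
    rewrite entry_Mscal by lia. unfold exp_coef, N. rewrite RtoC_mult. ring.
Qed.
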